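(* Let $m,n\ge 2$ be integers, let $\lambda=(\lambda_{ij})_{ij=11}^{mn}\in\mathbb{R}^{mn}$, let $U$ be a Haar-distributed random unitary matrix in $\mathrm{U}(mn)$, and let $H=(H_{ij,kl})=U\,\mathrm{diag}(\lambda)\,U^\dagger$. Let $p,q$ be nonnegative integers and let $\bm{i}=(i_1,\dots,i_p),\bm{k}=(k_1,\dots,k_p)\in\{1,\dots,m\}^{\times p}$ and $\bm{j}=(j_1,\dots,j_q),\bm{l}=(l_1,\dots,l_q)\in\{1,\dots,n\}^{\times q}$. Then $$\mathbb{E}\left[\prod_{\alpha=1}^p \pi_1(H)_{i_\alpha,k_\alpha}\cdot\prod_{\beta=1}^q\pi_2(H)_{j_\beta,l_\beta}\right]=\sum_{\sigma,\tau\in\mathfrak{S}_{p+q}}\delta_{\mathrm{pr}_1(\sigma)}(\bm{i},\bm{k})\,\delta_{\mathrm{pr}_2(\sigma)}(\bm{j},\bm{l})\,n^{\kappa_2(\sigma)}m^{\kappa_1(\sigma)}\,\mathrm{Wg}_{mn}(\sigma^{-1}\tau)\,\mathrm{Tr}_\tau(\lambda).$$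
   Context: Rows and columns of $mn\times mn$ matrices are indexed by double indices $ij$ ($1\le i\le m$, $1\le j\le n$) in lexicographic order, corresponding to $\mathbb{C}^{mn}\cong\mathbb{C}^m\otimes\mathbb{C}^n$. The marginals (partial traces) are the $m\times m$ matrix $\pi_1(H)_{i,k}=\sum_{j=1}^n H_{ij,kj}$ and the $n\times n$ matrix $\pi_2(H)_{j,l}=\sum_{i=1}^m H_{ij,il}$. For $\sigma\in\mathfrak{S}_d$ and sequences $\bm{a}=(a_1,\dots,a_d)$, $\bm{b}=(b_1,\dots,b_d)$, $\delta_\sigma(\bm{a},\bm{b})=\prod_{r=1}^d\delta(a_{\sigma(r)},b_r)$, where $\delta$ is the Kronecker delta. For $\sigma\in\mathfrak{S}_{p+q}$: $\mathrm{pr}_1(\sigma)\in\mathfrak{S}_p$ is obtained by writing $\sigma$ as a product of disjoint cycles and erasing the letters $p+1,\dots,p+q$ from each cycle (equivalently, for $x\le p$, $\mathrm{pr}_1(\sigma)(x)$ is the first element of $\sigma(x),\sigma^2(x),\dots$ lying in $\{1,\dots,p\}$); $\mathrm{pr}_2(\sigma)\in\mathfrak{S}_q$ is obtained by erasing the letters $1,\dots,p$ from each cycle and relabeling $p+1,\dots,p+q$ as $1,\dots,q$. $\kappa_1(\sigma)$ is the number of cycles of $\sigma$ whose support is contained in $\{p+1,\dots,p+q\}$, and $\kappa_2(\sigma)$ is the number of cycles of $\sigma$ whose support is contained in $\{1,\dots,p\}$. For $\tau$ with cycle type $(\mu_1,\mu_2,\dots)$, $\mathrm{Tr}_\tau(\lambda)=\prod_j\mathrm{Tr}(\mathrm{diag}(\lambda)^{\mu_j})$.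 The unitary Weingarten function is $\mathrm{Wg}_{N}(\sigma)=\mathrm{Wg}_{N,d}(\sigma)=\frac{1}{d!}\sum_{\rho\vdash d,\ C_\rho(N)\neq 0}\frac{\chi^\rho(\mathrm{id}_d)\chi^\rho(\sigma)}{C_\rho(N)}$ for $\sigma\in\mathfrak{S}_d$, where $\chi^\rho$ is the irreducible character of $\mathfrak{S}_d$ indexed by the partition $\rho$ and $C_\rho(N)=\prod_{i=1}^{\ell(\rho)}\prod_{j=1}^{\rho_i}(N+j-i)$. *)

(* Defs.v *)
From HB Require Import structures.
From mathcomp Require Import all_boot all_order all_algebra all_fingroup.
From mathcomp Require Import all_classical all_reals all_analysis.
From mathcomp Require Import complex.

Set Implicit Arguments.
Unset Strict Implicit.
Unset Printing Implicit Defensive.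

Import Order.TTheory GRing.Theory Num.Theory numFieldNormedType.Exports.
Local Open Scope ring_scope.

Definition conjT (R : realType) (m n : nat) (A : 'M[R[i]]_(m, n)) : 'M[R[i]]_(n, m) :=
  (map_mx (fun z : R[i] => Complex (complex.Re z) (- complex.Im z)) A)^T.

Definition unitary (R : realType) (N : nat) (U : 'M[R[i]]_N) : Prop :=
  U *m conjT U = 1%:M.

Definition reim (R : realType) (m n : nat) (A : 'M[R[i]]_(m, n)) : 'M[R]_(m, n + n) :=
  row_mx (map_mx (@complex.Re R) A) (map_mx (@complex.Im R) A).

(* U : T -> 'M[C]_N is a Haar-distributed random unitary matrix on the
   probability space (T, P): its entries are random variables, it is a.s.
   unitary, and its law is invariant under left multiplication by any fixed
   unitary V (equality in law tested against bounded continuous functions of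
   the real coordinates).  A left-invariant Borel probability on the compact
   group U(N) is the Haar measure. *)
Definition haar_unitary (R : realType) (d : measure_display) (T : measurableType d)
    (P : probability T R) (N : nat) (U : T -> 'M[R[i]]_N) : Prop :=
  [/\ (forall i j : 'I_N, measurable_fun setT (fun t => complex.Re (U t i j)) /\
                          measurable_fun setT (fun t => complex.Im (U t i j))),
      {ae P, forall t, unitary (U t)} &
      forall V : 'M[R[i]]_N, unitary V ->
      forall f : 'M[R]_(N, N + N) -> R, continuous f ->
        (exists M : R, forall x, `|f x| <= M) ->
        Rintegral P setT (fun t => f (reim (U t)))
        = Rintegral P setT (fun t => f (reim (V *m U t)))].

Definition cexpect (R : realType) (d : measure_display) (T : measurableType d)
    (P : probability T R) (X : T -> R[i]) : R[i] :=
  Complex (Rintegral P setT (fun t => complex.Re (X t))) (Rintegral P setT (fun t => complex.Im (X t))).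

(* Marginals (partial traces); double index ij <-> mxvec_index i j,
   which is the lexicographic order (index i*n + j). *)
Definition ptr1 (R : realType) (m n : nat) (H : 'M[R[i]]_(m * n)) : 'M[R[i]]_m :=
  \matrix_(i < m, k < m) \sum_(j < n) H (mxvec_index i j) (mxvec_index k j).

Definition ptr2 (R : realType) (m n : nat) (H : 'M[R[i]]_(m * n)) : 'M[R[i]]_n :=
  \matrix_(j < n, l < n) \sum_(i < m) H (mxvec_index i j) (mxvec_index i l).

Definition first_return (N : nat) (s : {perm 'I_N}) (A : pred 'I_N) (x : 'I_N) : 'I_N :=
  iter (find (fun k => A (iter k.+1 s x)) (iota 0 N)).+1 s x.

(* pr_1(sigma) : erase letters p+1..p+q (0-based: p..p+q-1) from the cycles *)
Definition pr1 (p q : nat) (s : 'S_(p + q)) (r : 'I_p) : 'I_p :=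
  insubd r (val (first_return s (fun z : 'I_(p + q) => (z < p)%N) (lshift q r))).

(* pr_2(sigma) : erase letters 1..p and relabel *)
Definition pr2 (p q : nat) (s : 'S_(p + q)) (r : 'I_q) : 'I_q :=
  insubd r (val (first_return s (fun z : 'I_(p + q) => (p <= z)%N) (rshift p r)) - p)%N.

Definition delta_perm (R : realType) (T : eqType) (d : nat) (f : 'I_d -> 'I_d)
    (a b : 'I_d -> T) : R :=
  \prod_(r < d) ((a (f r) == b r) : nat)%:R.

Definition kappa1 (p q : nat) (s : 'S_(p + q)) : nat :=
  #|[set c in porbits s | c \subset [set x : 'I_(p + q) | (p <= x)%N]]|.

Definition kappa2 (p q : nat) (s : 'S_(p + q)) : nat :=
  #|[set c in porbits s | c \subset [set x : 'I_(p + q) | (x < p)%N]]|.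

Definition TrPerm (R : realType) (N d : nat) (t : 'S_d) (lam : 'I_N -> R) : R :=
  \prod_(c in porbits t) \sum_(x < N) lam x ^+ #|c|.

(* a partition of d, padded with zeros to length d *)
Definition is_partition (d : nat) (rho : {ffun 'I_d -> 'I_d.+1}) : bool :=
  [forall i : 'I_d, forall j : 'I_d, (i <= j)%N ==> (rho j <= rho i)%N]
  && (\sum_(i < d) (rho i : nat) == d)%N.

(* Irreducible character chi^rho of S_d, by the Frobenius character formula
   with d variables:  chi^rho(s) = [x^(rho + delta)] (Delta(x) * p_{type(s)}(x)),
   delta = (d-1, ..., 0), Delta = prod_{i<j}(x_i - x_j)
         = sum_pi sgn(pi) prod_v x_v^(d-1-pi v),
   p_{type(s)} = prod_{cycles c} (sum_v x_v^|c|) = sum over f constant on the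
   cycles of s of prod_x x_{f x}. *)
Definition chi (d : nat) (rho : {ffun 'I_d -> 'I_d.+1}) (s : 'S_d) : int :=
  \sum_(pi : 'S_d) (-1) ^+ pi *
    (#|[set f : {ffun 'I_d -> 'I_d} |
        [forall x, f (s x) == f x] &&
        [forall v, #|[set x | f x == v]| + (d.-1 - pi v) == rho v + (d.-1 - v)]]|%N)%:Z.

(* C_rho(N) = prod_i prod_{j=1}^{rho_i} (N + j - i)  (1-based i, j) *)
Definition Crho (R : realType) (d : nat) (rho : {ffun 'I_d -> 'I_d.+1}) (N : nat) : R :=
  \prod_(i < d) \prod_(j < rho i) (N%:R + j%:R - i%:R).

Definition Wg (R : realType) (N d : nat) (s : 'S_d) : R :=
  (d`!%:R)^-1 *
  \sum_(rho : {ffun 'I_d -> 'I_d.+1} | is_partition rho && (Crho R rho N != 0))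
     ((chi rho 1)%:~R * (chi rho s)%:~R / Crho R rho N).

(* Main.v *)
(* Let d = p + q and N = mn.  On (C^N)^{(x)d} consider the moment M = E[H^{(x)d}] and let S_d act
   by the permutation operators R_s.  By invariance of Haar measure M commutes with V^{(x)d} for
   unitary V, hence (spectral theorem for hermitian matrices, then polynomial continuation from
   A + tB to complex t) with all A^{(x)d}, hence (polarization) with every operator invariant under
   conjugation by S_d.  Let G(t) = tr R_t = N^{#cycles(t)}.  If G * Wg * G = G, then Wg * G acts as
   the identity on tensors: the difference D satisfies tr(D D^T) = 0.  Writing the identity as
   sum_{s,t} Wg(s^-1 t) tr(R_t^-1) R_s and moving M through the invariant operators
   sum_{s,t} Wg(s^-1 t) R_s E_{jk} R_t^-1 gives M = sum_{s,t} Wg(s^-1 t) tr(R_t^-1 M) R_s, where the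
   traces are deterministic.  Summing over the traced-out indices counts functions that are
   constrained along the cycles of s, which yields pr_1, pr_2, kappa_1 and kappa_2.

   For G * Wg * G = G one needs chi^rho * G = C_rho(N) chi^rho and
   sum_rho chi^rho(1) chi^rho = d! delta_1 for the functions chi^rho given by Frobenius' formula.
   On alternating polynomials the adjoint of multiplication by p_k is k d/dp_k, which yields column
   orthogonality of the chi^rho.  They are integral combinations of permutation characters, so
   integrality of their coordinates makes each of them proportional to an irreducible character.
   Hence chi^rho is an eigenvector of G, and the eigenvalue follows from Burnside's lemma and a
   determinant of binomial coefficients. *)

Require Import Defs.
From HB Require Import structures.
From mathcomp Require Import all_boot all_order all_algebra all_fingroup.
From mathcomp Require Import all_solvable all_field all_character.
From mathcomp Require Import zify ring lra.
Set Implicit Arguments.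
Unset Strict Implicit.
Unset Printing Implicit Defensive.
Import Order.TTheory GRing.Theory Num.Theory.
Local Open Scope ring_scope.

(** * Alternating polynomials and power sums *)

(** When [mn < p + q], some [C_rho] vanish and G has no convolution inverse. The identity G * Wg * G
    = G still suffices, because G is the Gram matrix of the permutation operators: a combination of
    them that G annihilates is zero as an operator.

    Only general character theory is used, so [chi] must be understood from its formula. It is
    enough to know each [chi rho] up to a scalar; since that scalar is not shown to be nonzero,
    identities keep a factor [chi rho 1] instead of dividing by it.

    The rule that the adjoint of p_k is k d/dp_k holds in finitely many variables only for small
    degrees. It is a boundary effect: raising and lowering exponents commute except where an
    exponent would become negative. Alternation cancels these exceptions when the two degrees
    differ; when both equal k, exactly k exponents lie below k.

    Entries of the random unitary are bounded only almost surely, while invariance is given for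
    bounded continuous test functions on all matrices. This forces a detour through a clamped
    matrix. *)

Section Alternants.
Variable n : nat.
Implicit Types (w : {ffun 'I_n -> nat}) (F H : {ffun 'I_n -> nat} -> int).

Definition expo_up w (v : 'I_n) k : {ffun 'I_n -> nat} := [ffun u => (w u + (u == v) * k)%N].
Definition expo_dn w (v : 'I_n) k : {ffun 'I_n -> nat} := [ffun u => (w u - (u == v) * k)%N].
Definition expo_perm w (p : 'S_n) : {ffun 'I_n -> nat} := [ffun v => w (p v)].

Definition staircase : {ffun 'I_n -> nat} := [ffun v : 'I_n => (n.-1 - v)%N].

Definition vdm w : int := \sum_(p : 'S_n) (-1) ^+ p * ((w == expo_perm staircase p)%:R : int).

(* A function on exponent vectors stands for the polynomial with these coefficients: [vdm] is
   the Vandermonde polynomial, [pmul k] multiplies by the power sum of degree [k], and [padj k]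
   is the adjoint for which monomials are orthonormal. *)
Definition pmul k F w : int := \sum_v if (k <= w v)%N then F (expo_dn w v k) else 0.
Definition padj k F w : int := \sum_v F (expo_up w v k).
Definition pmuls (ks : seq nat) : {ffun 'I_n -> nat} -> int := foldr pmul vdm ks.

Definition alternating F :=
  forall w (p : 'S_n), F (expo_perm w p) = (-1) ^+ p * F w.

Lemma expo_permM w p q : expo_perm (expo_perm w p) q = expo_perm w (q * p)%g.
Proof. by apply/ffunP => v; rewrite !ffunE permM. Qed.

Lemma expo_perm_inj p : injective (expo_perm^~ p).
Proof.
move=> w w' /ffunP E; apply/ffunP => v.
by have := E (p^-1%g v); rewrite !ffunE permKV.
Qed.

Lemma vdm_alt : alternating vdm.
Proof.
move=> w p; rewrite /vdm mulr_sumr.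
rewrite (reindex_inj (mulgI p)) /=; apply: eq_bigr => q _.
rewrite odd_permM signr_addb mulrA -expo_permM.
by rewrite (inj_eq (@expo_perm_inj p)).
Qed.

Lemma expo_dn_perm w p v k :
  expo_dn (expo_perm w p) v k = expo_perm (expo_dn w (p v) k) p.
Proof. by apply/ffunP => u; rewrite !ffunE (inj_eq perm_inj). Qed.

Lemma expo_up_perm w p v k :
  expo_up (expo_perm w p) v k = expo_perm (expo_up w (p v) k) p.
Proof. by apply/ffunP => u; rewrite !ffunE (inj_eq perm_inj). Qed.

Lemma pmul_alt k F : alternating F -> alternating (pmul k F).
Proof.
move=> aF w p; rewrite /pmul mulr_sumr [RHS](reindex_inj (@perm_inj _ p)) /=.
apply: eq_bigr => v _; rewrite ffunE expo_dn_perm aF.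
by case: ifP; rewrite ?mulr0.
Qed.

Lemma pmuls_alt ks : alternating (pmuls ks).
Proof. by elim: ks => [|k ks IH]; [exact: vdm_alt | exact: pmul_alt]. Qed.

Lemma alt_dup F w u v : alternating F -> u != v -> w u = w v -> F w = 0.
Proof.
move=> aF uv E; have := aF w (tperm u v).
have -> : expo_perm w (tperm u v) = w.
  by apply/ffunP => x; rewrite ffunE; case: tpermP => // ->.
by rewrite odd_tperm uv expr1 mulN1r; lia.
Qed.

(** Monomials of the Vandermonde polynomial use every exponent below [n]. A power sum of degree [k]
    can vacate [c] only by raising it to [c + k], which is occupied by induction, and a repeated
    exponent kills an alternating function. So low exponents survive. *)
Lemma pmuls_support ks w c :
  pmuls ks w != 0 -> (c + sumn ks < n)%N -> exists v, w v = c.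
Proof.
elim: ks w c => [|k ks IH] w c /=.
  rewrite addn0 => nz cn.
  have [p /eqP wE|none] := pickP (fun p : 'S_n => w == expo_perm staircase p).
    have cn' : (n.-1 - c < n)%N by lia.
    exists (p^-1%g (Ordinal cn')); rewrite wE !ffunE permKV /=; lia.
  case/eqP: nz; rewrite /vdm big1 // => p _.
  by rewrite none mulr0.
move=> nz cn.
have /exists_inP[v kv nz1] : [exists (v | (k <= w v)%N), pmuls ks (expo_dn w v k) != 0].
  apply: contraNT nz => /exists_inPn h; rewrite /pmul big1 // => v _.
  by case: ifP => // /h; rewrite negbK => /eqP.
have [|u uE] := IH _ c nz1; first by lia.
move: uE; rewrite ffunE; case: (eqVneq u v) => [-> | _]; last first.
  by rewrite mul0n subn0; exists u.
rewrite mul1n => cE; have [k0|k0] := posnP k; first by exists v; lia.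
(* the entry [c] was raised to [c + k], which collides with another entry *)
have [|u' u'E] := IH _ (c + k)%N nz1; first by lia.
have u'v : u' != v by apply: contraPneq u'E => ->; rewrite ffunE eqxx mul1n; lia.
move: u'E; rewrite ffunE (negPf u'v) mul0n subn0 => u'E.
case/eqP: nz; apply: (alt_dup (pmuls_alt (k :: ks)) u'v); lia.
Qed.

(** Homogeneity: each factor adds its degree. This confines the supports to a finite box later
    on. *)
Lemma pmuls_total ks w :
  pmuls ks w != 0 -> (\sum_v w v = sumn ks + \sum_v staircase v)%N.
Proof.
elim: ks w => [|k ks IH] w /= nz.
  have [p /eqP wE|none] := pickP (fun p : 'S_n => w == expo_perm staircase p).
    rewrite add0n [RHS](reindex_inj (@perm_inj _ p)); apply: eq_bigr => v _.
    by rewrite wE ffunE.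
  case/eqP: nz; rewrite /vdm big1 // => p _.
  by rewrite none mulr0.
have /exists_inP[v kv nz1] : [exists (v | (k <= w v)%N), pmuls ks (expo_dn w v k) != 0].
  apply: contraNT nz => /exists_inPn h; rewrite /pmul big1 // => v _.
  by case: ifP => // /h; rewrite negbK => /eqP.
have := IH _ nz1; rewrite (bigD1 v) //= ffunE eqxx mul1n.
rewrite (eq_bigr (fun u => w u)); last by move=> u /negPf uv; rewrite ffunE uv mul0n subn0.
move=> E; rewrite [LHS](bigD1 v) //=; move: E.
set S := (\sum_(u | u != v) w u)%N; set S2 := (\sum_v _)%N.
clearbody S S2; lia.
Qed.

Lemma pmulC k l F w : pmul k (pmul l F) w = pmul l (pmul k F) w.
Proof.
rewrite /pmul.
transitivity (\sum_v \sum_u (if (k <= w v)%N && (l <= expo_dn w v k u)%N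
    then F (expo_dn (expo_dn w v k) u l) else 0)).
  apply: eq_bigr => v _; case: ifP => kv //=.
  by rewrite big1.
rewrite exchange_big /=; apply: eq_bigr => u _.
transitivity (\sum_v (if (l <= w u)%N && (k <= expo_dn w u l v)%N
    then F (expo_dn (expo_dn w u l) v k) else 0)); last first.
  by case: ifP => lu //=; rewrite big1.
apply: eq_bigr => v _.
have -> : expo_dn (expo_dn w v k) u l = expo_dn (expo_dn w u l) v k.
  by apply/ffunP => x; rewrite !ffunE subnAC.
congr (if _ then _ else _); rewrite !ffunE.
by rewrite eq_sym; case: eqVneq => [->|_]; lia.
Qed.

Lemma eq_pmul k F H : F =1 H -> pmul k F =1 pmul k H.
Proof. by move=> E w; apply: eq_bigr => v _; rewrite E. Qed.

Lemma pmuls_rem k ks : k \in ks -> pmuls ks =1 pmul k (pmuls (rem k ks)).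
Proof.
elim: ks => //= l ks IH; rewrite in_cons => kin w.
case: (eqVneq l k) kin => [-> //| lk] /= kin.
by rewrite (eq_pmul l (IH kin)) pmulC.
Qed.

Lemma pmuls_perm ks ls : perm_eq ks ls -> pmuls ks =1 pmuls ls.
Proof.
elim: ks ls => [|k ks IH] ls; first by rewrite perm_sym => /perm_nilP ->.
move=> E w; have kl : k \in ls by rewrite -(perm_mem E) inE eqxx.
rewrite (pmuls_rem kl) /=; apply: eq_pmul; apply: IH.
by rewrite -(perm_cons k); apply: perm_trans E (perm_to_rem kl).
Qed.


Lemma padj_alt k F : alternating F -> alternating (padj k F).
Proof.
move=> aF w p; rewrite /padj mulr_sumr [RHS](reindex_inj (@perm_inj _ p)) /=.
by apply: eq_bigr => v _; rewrite expo_up_perm aF.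
Qed.

(** If raising entry [v] lands in the support of [vdm], then [w v + k < n], and the raised vector
    contains the exponent [w v] at another place. So [w] has a repeated entry, where the alternating
    function [padj k vdm] vanishes. *)
Lemma padj_vdm k w : (0 < k)%N -> padj k vdm w = 0.
Proof.
move=> k0; have [/existsP[v nz]|/existsPn h] :=
    boolP [exists v, vdm (expo_up w v k) != 0]; last first.
  by rewrite /padj big1 // => v _; apply/eqP; rewrite -[_ == _]negbK.
have wv : (w v + k < n)%N.
  have [p /eqP/ffunP/(_ v) E|none] :=
      pickP (fun p : 'S_n => expo_up w v k == expo_perm staircase p).
    by move: E; rewrite !ffunE eqxx mul1n => ->; have := ltn_ord v; lia.
  by case/eqP: nz; rewrite /vdm big1 // => p _; rewrite none mulr0.
have [|u uE] := @pmuls_support [::] _ (w v) nz; first by rewrite /= addn0; lia.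
have uv : u != v by apply: contraPneq uE => ->; rewrite ffunE eqxx mul1n; lia.
move: uE; rewrite ffunE (negPf uv) mul0n addn0 => uE.
exact: alt_dup (padj_alt k vdm_alt) uv uE.
Qed.

(** The commutator of [padj k] and [pmul l]. Shifts of different entries commute; at a single entry,
    raising first permits a lowering that would otherwise pass below zero. *)
Definition pdefect k l F w : int :=
  \sum_v if (w v < l <= w v + k)%N then F (expo_dn (expo_up w v k) v l) else 0.

Lemma pdefect_alt k l F : alternating F -> alternating (pdefect k l F).
Proof.
move=> aF w p; rewrite /pdefect mulr_sumr [RHS](reindex_inj (@perm_inj _ p)) /=.
apply: eq_bigr => v _; rewrite ffunE expo_up_perm expo_dn_perm aF.
by case: ifP; rewrite ?mulr0.
Qed.

Lemma padj_pmul k l F w :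
  padj k (pmul l F) w = pmul l (padj k F) w + pdefect k l F w.
Proof.
rewrite /padj /pmul /pdefect.
transitivity (\sum_u \sum_v (if (l <= expo_up w v k u)%N
    then F (expo_dn (expo_up w v k) u l) else 0)).
  by rewrite exchange_big.
rewrite -big_split /=; apply: eq_bigr => u _.
rewrite (bigD1 u) //= [X in _ = X + _](_ : _ =
  \sum_v (if (l <= w u)%N then F (expo_up (expo_dn w u l) v k) else 0)); last first.
  by case: ifP => // _; rewrite big1.
rewrite [in RHS](bigD1 u) //= addrAC; congr (_ + _); last first.
  apply: eq_bigr => v /negPf vu; rewrite !ffunE eq_sym vu mul0n addn0.
  case: ifP => // lu; congr F; apply/ffunP => x; rewrite !ffunE.
  by case: (eqVneq x u) => [->|]; rewrite ?[u == v]eq_sym ?vu ?mul0n ?addn0 ?subn0.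
rewrite ffunE eqxx mul1n; case: (leqP l (w u)) => /= lu; last by rewrite add0r.
rewrite (leq_trans lu (leq_addr _ _)) addr0; congr F; apply/ffunP => x; rewrite !ffunE.
by case: (eqVneq x u) => [->|]; rewrite ?mul1n ?mul0n ?addn0 ?subn0 //; lia.
Qed.

(** In a nonzero term, [w v < l] makes [w v] low enough to occur in the shifted vector by
    [pmuls_support], and [k != l] puts that occurrence at some [u != v]. Hence [w] has a repeated
    entry. *)
Lemma pdefect_neq k l ks w : k != l -> (l + sumn ks <= n)%N ->
  pdefect k l (pmuls ks) w = 0.
Proof.
move=> kl ln; have [/exists_inP[v lv nz]|/exists_inPn h] := boolP [exists (v | (w v < l <= w v + k)%N),
    pmuls ks (expo_dn (expo_up w v k) v l) != 0]; last first.
  by rewrite /pdefect big1 // => v _; case: ifP => // /h; rewrite negbK => /eqP.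
have [|u uE] := @pmuls_support ks _ (w v) nz; first by lia.
have uv : u != v.
  by apply: contraPneq uE => ->; rewrite !ffunE eqxx !mul1n; lia.
move: uE; rewrite !ffunE (negPf uv) !mul0n addn0 subn0 => uE.
exact: alt_dup (pdefect_alt k l (pmuls_alt ks)) uv uE.
Qed.

Lemma pmuls_count_small k ks w : pmuls ks w != 0 -> (k + sumn ks <= n)%N ->
  #|[set v | (w v < k)%N]| = k.
Proof.
move=> nz kn.
have inj : injective w.
  move=> u v uv; apply/eqP; apply: contraNT nz => ne.
  exact/eqP/(alt_dup (pmuls_alt ks) ne uv).
have ex (c : 'I_k) : exists v, w v == c.
  by have [|v <-] := pmuls_support (c := c) nz; [have := ltn_ord c; lia | exists v].
pose g c := xchoose (ex c); have gE c : w (g c) = c := eqP (xchooseP (ex c)).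
have injg : injective g by move=> c c' /(congr1 w); rewrite !gE => /val_inj.
rewrite -[RHS]card_ord -(card_imset _ injg); apply: eq_card => v; rewrite !inE.
apply/idP/imsetP => [vk | [c _ ->]]; last by rewrite gE.
by exists (Ordinal vk) => //; apply: inj; rewrite gE.
Qed.

(** Raising and then lowering by [k] returns to [w], so the defect counts the entries below [k]. On
    the support these are the values [0, ..., k - 1], once each. *)
Lemma pdefect_eq k ks w : (k + sumn ks <= n)%N ->
  pdefect k k (pmuls ks) w = k%:R * pmuls ks w.
Proof.
move=> kn; rewrite /pdefect.
transitivity (\sum_(v | (w v < k)%N) pmuls ks w).
  rewrite [RHS]big_mkcond; apply: eq_bigr => v _; rewrite leq_addl andbT.
  by case: ifP => // _; congr (pmuls _ _); apply/ffunP => x; rewrite !ffunE addnK.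
have [->|nz] := eqVneq (pmuls ks w) 0; first by rewrite mulr0 big1.
by rewrite sumr_const -[in RHS](pmuls_count_small nz kn) cardsE mulr_natl.
Qed.

(* [padj k] acts like [k] times the derivation with respect to the [k]-th power sum, because it
   commutes with the other power sums on these alternating functions and kills [vdm]. *)
Lemma padj_pmuls k ks w : (0 < k)%N -> (sumn ks <= n)%N ->
  padj k (pmuls ks) w = (k * count_mem k ks)%:R * pmuls (rem k ks) w.
Proof.
move=> k0; elim: ks w => [|l ks IH] w /= ln.
  by rewrite muln0 mul0r; exact: padj_vdm.
rewrite padj_pmul.
have -> : pmul l (padj k (pmuls ks)) w =
    (k * count_mem k ks)%:R * pmul l (pmuls (rem k ks)) w.
  rewrite /pmul mulr_sumr; apply: eq_bigr => v _.
  by case: ifP => _; rewrite ?mulr0 // IH //; lia.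
case: (eqVneq l k) ln => [-> | lk] ln; last first.
  by rewrite pdefect_neq 1?eq_sym // addr0.
rewrite pdefect_eq // /= [in RHS]mulnDr muln1 natrD mulrDl [RHS]addrC; congr (_ + _).
have [kin|/count_memPn ->] := boolP (k \in ks); last by rewrite muln0 !mul0r.
by rewrite (pmuls_rem kin).
Qed.

End Alternants.

(** * Scalar product of alternating functions on a finite box of exponents *)

Section Box.
Variables n B : nat.
Local Notation box := {ffun 'I_n -> 'I_B}.
Implicit Types (F H : {ffun 'I_n -> nat} -> int) (w : {ffun 'I_n -> 'I_B}).

Definition natw w : {ffun 'I_n -> nat} := [ffun v => nat_of_ord (w v)].
Definition boxw (w : {ffun 'I_n -> 'I_B}) (e : {ffun 'I_n -> nat}) : {ffun 'I_n -> 'I_B} :=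
  [ffun v => insubd (w v) (e v)].

Definition alt_dot F H : int := \sum_(w : {ffun 'I_n -> 'I_B}) F (natw w) * H (natw w).

Lemma box_lt w v : (w v < B)%N.
Proof. exact: ltn_ord. Qed.

Lemma natw_box w (e : {ffun 'I_n -> nat}) : (forall v, e v < B)%N -> natw (boxw w e) = e.
Proof. by move=> eB; apply/ffunP => v; rewrite !ffunE val_insubd eB. Qed.

Lemma natw_inj : injective natw.
Proof.
by move=> w w' /ffunP E; apply/ffunP => v; apply: val_inj; have := E v; rewrite !ffunE.
Qed.

(** Lowering entry [v] by [k] is a bijection from the vectors with [k <= w v] to those with
    [w v + k < B]. Truncating to the box loses nothing because [H] vanishes outside it. *)
Lemma alt_dot_pmul k F H :
  (forall (e : {ffun 'I_n -> nat}) v, (B <= e v)%N -> H e = 0) ->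
  alt_dot (pmul k F) H = alt_dot F (padj k H).
Proof.
move=> Hb; rewrite /alt_dot.
transitivity (\sum_v \sum_(w : box | (k <= w v)%N) F (expo_dn (natw w) v k) * H (natw w)).
  under eq_bigr do rewrite /pmul mulr_suml.
  rewrite exchange_big; apply: eq_bigr => v _; rewrite [RHS]big_mkcond.
  by apply: eq_bigr => w _; rewrite ffunE; case: ifP; rewrite ?mul0r.
under [RHS]eq_bigr do rewrite /padj mulr_sumr.
rewrite [RHS]exchange_big; apply: eq_bigr => v _.
transitivity (\sum_(w : box | (w v + k < B)%N) F (natw w) * H (expo_up (natw w) v k)); last first.
  rewrite [LHS]big_mkcond; apply: eq_bigr => w _; case: ltnP => // wB.
  by rewrite (Hb _ v) ?mulr0 // !ffunE eqxx mul1n.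
rewrite (reindex_onto (fun w : box => boxw w (expo_up (natw w) v k))
                      (fun w : box => boxw w (expo_dn (natw w) v k))); last first.
  move=> w kw; apply: natw_inj.
  have E : natw (boxw w (expo_dn (natw w) v k)) = expo_dn (natw w) v k.
    by apply: natw_box => u; rewrite !ffunE (leq_ltn_trans (leq_subr _ _)).
  rewrite natw_box E => [|u].
    by apply/ffunP => u; rewrite !ffunE; case: eqVneq => [->|_]; lia.
  rewrite !ffunE; have := box_lt w u; case: (eqVneq u v) => [->|_]; lia.
have upB (w : box) : (w v + k < B)%N ->
    natw (boxw w (expo_up (natw w) v k)) = expo_up (natw w) v k.
  move=> wB; apply: natw_box => u; rewrite !ffunE.
  by case: (eqVneq u v) => [->|_]; rewrite ?mul1n ?mul0n ?addn0.
have dnup (w : box) : (w v + k < B)%N -> let w' := boxw w (expo_up (natw w) v k) in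
    expo_dn (natw w') v k = natw w.
  by move=> wB /=; rewrite upB //; apply/ffunP => u; rewrite !ffunE addnK.
apply: eq_big => [w|w /andP[]].
  (* If raising leaves the box, [boxw] falls back on the old entry [w v]; lowering it by a positive
     [k <= w v] does not give [w v] back, so such [w] fail the round trip. *)
  have [wB|wB] := ltnP (natw w v + k)%N B; rewrite ffunE in wB; last first.
    rewrite [RHS]ltnNge wB; apply/negbTE/andP => -[+ /eqP/ffunP/(_ v)].
    rewrite !ffunE eqxx mul1n => kw /(congr1 val).
    rewrite /= val_insubd; move: kw; rewrite !val_insubd (ltnNge _ B) wB /=.
    by have := box_lt w v; case: ifP; lia.
  rewrite [RHS]wB; apply/andP; split.
    by rewrite ffunE val_insubd !ffunE eqxx mul1n wB leq_addl.
  apply/eqP/natw_inj; rewrite natw_box ?dnup // => u; rewrite ffunE; exact: ltn_ord.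
move=> kw /eqP/ffunP/(_ v); rewrite ffunE => /(congr1 val)/=.
have [wB|wB] := ltnP (natw w v + k)%N B; rewrite ffunE in wB; first by rewrite dnup // upB.
move: kw; rewrite !(ffunE, eqxx, mul1n, val_insubd) (ltnNge _ B) wB /=.
by have := box_lt w v; case: ifP; lia.
Qed.

Lemma pmuls_bounded ks (e : {ffun 'I_n -> nat}) v :
  (sumn ks + \sum_v staircase n v < B)%N -> (B <= e v)%N -> pmuls ks e = 0 :> int.
Proof.
move=> sB eB; apply/eqP; apply: contraTT isT => /pmuls_total E.
suff : (e v <= \sum_v e v)%N by lia.
by rewrite (bigD1 v) //= leq_addr.
Qed.

Lemma alt_dot_pmuls k ks ls : (0 < k)%N -> (sumn ls <= n)%N ->
  (sumn ls + \sum_v staircase n v < B)%N ->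
  alt_dot (pmuls (k :: ks)) (pmuls ls) =
  (k * count_mem k ls)%:R * alt_dot (pmuls ks) (pmuls (rem k ls)).
Proof.
move=> k0 ln lB; rewrite alt_dot_pmul => [|e v]; last exact: pmuls_bounded.
rewrite /alt_dot mulr_sumr; apply: eq_bigr => w _.
by rewrite padj_pmuls // mulrCA.
Qed.

Lemma expo_perm1 (e : {ffun 'I_n -> nat}) : expo_perm e 1 = e.
Proof. by apply/ffunP => v; rewrite ffunE perm1. Qed.

(** The support consists of the [n!] distinct rearrangements of the staircase, with coefficients [1]
    or [-1]; all lie in the box because [n <= B]. *)
Lemma alt_dot_vdm : (n <= B)%N -> alt_dot (@vdm n) (@vdm n) = n`!%:R.
Proof.
move=> nB.
have dB (p : 'S_n) v : (expo_perm (staircase n) p v < B)%N.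
  rewrite !ffunE; have := ltn_ord v; lia.
transitivity (\sum_(p : 'S_n) (-1) ^+ p * vdm (expo_perm (staircase n) p) : int).
  rewrite /alt_dot; under eq_bigr do rewrite {1}/vdm mulr_suml.
  rewrite exchange_big; apply: eq_bigr => p _.
  have [w0 wE] : exists w0 : {ffun 'I_n -> 'I_B}, natw w0 = expo_perm (staircase n) p.
    exists [ffun v => Ordinal (dB p v)]; apply/ffunP => v.
    by rewrite [LHS]ffunE ffunE.
  rewrite (bigD1 w0) //= wE eqxx mulr1 big1 ?addr0 // => w ne.
  by rewrite -wE (inj_eq natw_inj) (negPf ne) mulr0 mul0r.
transitivity (\sum_(p : 'S_n) 1 : int); last first.
  by rewrite sumr_const card_Sn.
apply: eq_bigr => p _; rewrite vdm_alt mulrA -expr2 sqrr_sign mul1r /vdm.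
rewrite (bigD1 1%g) //= odd_perm1 expo_perm1 eqxx mul1r big1 ?addr0 // => q ne.
case: eqP; rewrite ?mulr0 // => /ffunP E; case/eqP: ne.
apply/permP => v; rewrite perm1; apply: val_inj => /=.
have := E v; rewrite !ffunE; have := ltn_ord v; have := ltn_ord (q v); lia.
Qed.

End Box.

(** * Cycles of permutations *)

Section FfunCons.
Variables (K : finType) (k : nat).

Definition ffun_cons (v : K) (f : {ffun 'I_k -> K}) : {ffun 'I_k.+1 -> K} :=
  [ffun i => if unlift ord0 i is Some j then f j else v].

Lemma ffun_cons0 v f : ffun_cons v f ord0 = v.
Proof. by rewrite ffunE unlift_none. Qed.

Lemma ffun_consS v f j : ffun_cons v f (lift ord0 j) = f j.
Proof. by rewrite ffunE liftK. Qed.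

Lemma big_ffun_cons (R : Type) (idx : R) (op : Monoid.com_law idx)
    (A : {ffun 'I_k.+1 -> K} -> R) :
  \big[op/idx]_f A f = \big[op/idx]_v \big[op/idx]_f A (ffun_cons v f).
Proof.
rewrite pair_big /= (reindex (fun vf => ffun_cons vf.1 vf.2)) //=.
exists (fun f => (f ord0, [ffun j => f (lift ord0 j)])).
  move=> [v f] _ /=; rewrite ffun_cons0; congr (_, _).
  by apply/ffunP => j; rewrite ffunE ffun_consS.
move=> f _; apply/ffunP => i /=.
by case: (unliftP ord0 i) => [j|] ->; rewrite ?ffun_consS ?ffun_cons0 ?ffunE.
Qed.

Lemma ffun_forallS v f (A : 'I_k.+1 -> K -> bool) :
  [forall i, A i (ffun_cons v f i)] =
  A ord0 v && [forall j, A (lift ord0 j) (f j)].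
Proof.
apply/forallP/andP => [h|[h0 /forallP h] i].
  split; first by have := h ord0; rewrite ffun_cons0.
  by apply/forallP => j; have := h (lift ord0 j); rewrite ffun_consS.
by case: (unliftP ord0 i) => [j|] ->; rewrite ?ffun_consS ?ffun_cons0.
Qed.

End FfunCons.

Section Orbits.
Variables (X : finType) (s : {perm X}).

Lemma mem_porbits x : porbit s x \in porbits s.
Proof. exact: imset_f. Qed.

Definition porb_idx (x : X) : 'I_#|porbits s| := enum_rank_in (mem_porbits x) (porbit s x).

Lemma porb_idxK x : enum_val (porb_idx x) = porbit s x.
Proof. by rewrite enum_rankK_in // mem_porbits. Qed.

Lemma porb_rep_subproof (i : 'I_#|porbits s|) : exists x, porbit s x == enum_val i.
Proof. by have /imsetP[x _ ->] := enum_valP i; exists x. Qed.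

Definition porb_rep i := xchoose (porb_rep_subproof i).

Lemma porb_repE i : porbit s (porb_rep i) = enum_val i.
Proof. exact/eqP/(xchooseP (porb_rep_subproof i)). Qed.

Lemma porb_repK : cancel porb_rep porb_idx.
Proof. by move=> i; apply: enum_val_inj; rewrite porb_idxK porb_repE. Qed.

Lemma porb_idx_eq x y : (porb_idx x == porb_idx y) = (porbit s x == porbit s y).
Proof. by rewrite -(inj_eq enum_val_inj) !porb_idxK. Qed.

Lemma porbit_perm1 x : porbit s (s x) = porbit s x.
Proof. by rewrite -[in LHS](expg1 s) porbit_perm. Qed.

Lemma porb_idx_perm x : porb_idx (s x) = porb_idx x.
Proof. by apply/eqP; rewrite porb_idx_eq porbit_perm1. Qed.

Definition porb_exp x := index x (traject s (porb_rep (porb_idx x)) #|porbit s x|).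

Lemma porb_expK x : iter (porb_exp x) s (porb_rep (porb_idx x)) = x.
Proof.
have pE : porbit s (porb_rep (porb_idx x)) = porbit s x by rewrite porb_repE porb_idxK.
have xin : x \in traject s (porb_rep (porb_idx x)) #|porbit s x|.
  by rewrite -pE -porbit_traject pE porbit_id.
have := nth_index (porb_rep (porb_idx x)) xin.
by rewrite nth_traject // -[X in (_ < X)%N](size_traject s (porb_rep (porb_idx x))) index_mem.
Qed.

Lemma porbit_iter m x : porbit s (iter m s x) = porbit s x.
Proof. by rewrite -permX porbit_perm. Qed.

Lemma iter_porbit_eq m x : (iter m s x == x) = (#|porbit s x| %| m)%N.
Proof.
set k := #|porbit s x|; have k0 : (0 < k)%N by rewrite lt0n card_porbit_neq0.
have itk q : iter (q * k) s x = x.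
  by elim: q => // q IH; rewrite mulSn iterD IH iter_porbit.
rewrite [in LHS](divn_eq m k) addnC iterD itk /dvdn.
have mk := ltn_pmod m k0; have := uniq_traject_porbit s x.
rewrite -/k => /(nth_uniq x); rewrite size_traject => /(_ _ _ mk k0).
by rewrite !nth_traject.
Qed.

Lemma big_perm_invariant (R : Type) (idx : R) (op : Monoid.com_law idx)
    (K : finType) (A : {ffun X -> K} -> R) :
  \big[op/idx]_(f : {ffun X -> K} | [forall x, f (s x) == f x]) A f =
  \big[op/idx]_(f : {ffun 'I_#|porbits s| -> K}) A [ffun x => f (porb_idx x)].
Proof.
rewrite (reindex_onto (fun f : {ffun 'I_#|porbits s| -> K} => [ffun x => f (porb_idx x)])
  (fun f => [ffun i => f (porb_rep i)])) /=; last first.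
  move=> f /forallP fs; apply/ffunP => x; rewrite !ffunE.
  have fi m y : f (iter m s y) = f y by elim: m => //= m <-; exact/eqP.
  by rewrite -{2}(porb_expK x) fi.
apply: eq_bigl => f; apply/andP; split.
  by apply/forallP => x; rewrite !ffunE porb_idx_perm.
by apply/eqP/ffunP => i; rewrite !ffunE porb_repK.
Qed.

Lemma card_porb_fiber (K : finType) (f : {ffun 'I_#|porbits s| -> K}) v :
  #|[set x | f (porb_idx x) == v]| = (\sum_(i | f i == v) #|enum_val i|)%N.
Proof.
rewrite -sum1_card (partition_big porb_idx (fun i => f i == v)) => [|x]; last by rewrite inE.
apply: eq_bigr => i /eqP fi; rewrite sum1dep_card; apply: eq_card => x.
rewrite !inE; apply/andP/idP => [[_ /eqP <-]|xi].
  by rewrite porb_idxK porbit_id.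
suff -> : porb_idx x = i by rewrite fi.
by apply/eqP; rewrite -(porb_repK i) porb_idx_eq eq_porbit_mem porb_repE.
Qed.

End Orbits.

(** Both equalities say that the common cycle length divides the difference of [a] and [b]. This
    makes maps built step by step along cycles well defined. *)
Lemma iter_porbit_congr (X Y : finType) (s : {perm X}) (t : {perm Y}) x y a b :
  #|porbit s x| = #|porbit t y| -> iter a s x = iter b s x -> iter a t y = iter b t y.
Proof.
move=> E; wlog ab : a b / (a <= b)%N.
  by case: (leqP a b) => [ab|/ltnW ba] h; [exact: h | move=> /esym /h ->].
have iterK m : cancel (iter m s) (iter m s^-1%g).
  by elim: m => // m IH z; rewrite iterSr iterS permK IH.
rewrite -(subnKC ab) !iterD => /(can_inj (iterK a)) h.
by congr (iter a t _); apply/esym/eqP; rewrite iter_porbit_eq -E -iter_porbit_eq -h.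
Qed.

Lemma big_ffun0 (R : Type) (idx : R) (op : Monoid.law idx) (K : finType)
    (A : {ffun 'I_0 -> K} -> R) :
  \big[op/idx]_f A f = A (ffun0 (card_ord 0)).
Proof. by apply: big_pred1 => f; apply/esym/eqP/ffunP => -[]. Qed.

(** Full expansion of the product: [p] selects a term of the Vandermonde polynomial and [f i] the
    variable taken from the power sum number [i]. *)
Lemma pmulsE n ks (w : {ffun 'I_n -> nat}) :
  pmuls ks w = \sum_(p : 'S_n) (-1) ^+ p *
    \sum_(f : {ffun 'I_(size ks) -> 'I_n})
      ([forall v, \sum_(i | f i == v) nth 0 ks i + staircase n (p v) == w v]%N%:R : int).
Proof.
elim: ks w => [|k ks IH] w /=.
  apply: eq_bigr => p _; congr (_ * _); rewrite big_ffun0; congr (_%:R).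
  congr (nat_of_bool _); apply/eqP/forallP => [-> v|h].
    by rewrite big_ord0 add0n [X in _ == X]ffunE.
  by apply/ffunP => v; have /eqP <- := h v; rewrite big_ord0 add0n [RHS]ffunE.
transitivity (\sum_(v : 'I_n) \sum_(p : 'S_n) (-1) ^+ p *
    \sum_(f : {ffun 'I_(size ks) -> 'I_n})
      ([forall u, \sum_(i | ffun_cons v f i == u) nth 0 (k :: ks) i
          + staircase n (p u) == w u]%N%:R : int)); last first.
  rewrite exchange_big; apply: eq_bigr => p _; rewrite -mulr_sumr.
  by rewrite big_ffun_cons.
rewrite /pmul; apply: eq_bigr => v _; rewrite IH.
have E (p : 'S_n) (f : {ffun 'I_(size ks) -> 'I_n}) :
   [forall u, \sum_(i | ffun_cons v f i == u) nth 0 (k :: ks) i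
          + staircase n (p u) == w u]%N =
   (k <= w v)%N && [forall u, \sum_(i | f i == u) nth 0 ks i
          + staircase n (p u) == expo_dn w v k u]%N.
  have S u : (\sum_(i | ffun_cons v f i == u) nth 0 (k :: ks) i =
              (u == v) * k + \sum_(i | f i == u) nth 0 ks i)%N.
    rewrite big_mkcond big_ord_recl /= ffun_cons0 eq_sym [in RHS]big_mkcond /=.
    congr (_ + _)%N; first by case: (u == v); rewrite ?mul1n.
    by apply: eq_bigr => i _; rewrite ffun_consS.
  apply/forallP/andP => [h | [kw /forallP h] u].
    split; first by have /eqP <- := h v; rewrite S eqxx mul1n -addnA leq_addr.
    by apply/forallP => u; rewrite [X in _ == X]ffunE; have /eqP <- := h u; rewrite S -addnA addKn.
  rewrite S -addnA; have /eqP -> := h u; rewrite ffunE.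
  by case: (eqVneq u v) => [->|_]; rewrite ?mul1n ?mul0n ?subnKC ?subn0.
case: ifP => kw; last first.
  rewrite big1 // => p _; rewrite big1 ?mulr0 // => f _.
  by rewrite E kw.
by apply: eq_bigr => p _; congr (_ * _); apply: eq_bigr => f _; rewrite E kw.
Qed.

Definition porbit_sizes (X : finType) (s : {perm X}) : seq nat :=
  [seq #|c| | c : {set X} <- enum (porbits s)].

Definition chi_weight d (rho : {ffun 'I_d -> 'I_d.+1}) : {ffun 'I_d -> nat} :=
  [ffun v => rho v + (d.-1 - v)]%N.

Lemma chi_pmuls d (rho : {ffun 'I_d -> 'I_d.+1}) (s : 'S_d) :
  chi rho s = pmuls (porbit_sizes s) (chi_weight rho).
Proof.
rewrite pmulsE /chi; apply: eq_bigr => p _; congr (_ * _).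
have sz : size (porbit_sizes s) = #|porbits s| by rewrite size_map -cardE.
have nthE (i : 'I_#|porbits s|) : nth 0%N (porbit_sizes s) i = #|enum_val i|.
  rewrite (nth_map set0) -?cardE //; congr #|(_ : {set _})|.
  exact: (esym (enum_val_nth set0 i)).
have -> : #|[set f : {ffun 'I_d -> 'I_d} | [forall x, f (s x) == f x] &&
    [forall v, #|[set x | f x == v]| + (d.-1 - p v) == rho v + (d.-1 - v)]]|%N%:Z =
  \sum_(f : {ffun 'I_d -> 'I_d} | [forall x, f (s x) == f x])
    ([forall v, #|[set x | f x == v]| + (d.-1 - p v) == rho v + (d.-1 - v)]%N%:R : int).
  rewrite -sum1dep_card big_mkcondr /= -natz natr_sum.
  by apply: eq_bigr => f _; case: ifP.
rewrite big_perm_invariant.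
move: (porbit_sizes s) sz nthE => ks sz; rewrite sz => nthE.
apply: eq_bigr => f _; congr (nat_of_bool _)%:R; apply: eq_forallb => v.
rewrite !ffunE; congr (_ + _ == _)%N.
transitivity #|[set x | f (porb_idx s x) == v]|.
  by congr #|pred_of_set _|; apply/setP => x; rewrite !inE ffunE.
by rewrite card_porb_fiber; apply: eq_bigr => i _; rewrite nthE.
Qed.

Lemma sumn_porbit_sizes (X : finType) (s : {perm X}) : sumn (porbit_sizes s) = #|X|.
Proof.
rewrite sumnE big_map big_enum /= -cardsT; apply/esym/card_partition.
have := equivalence_partitionP (R := fun x y => porbit s x == porbit s y) (D := setT).
rewrite (_ : equivalence_partition _ _ = porbits s); first apply.
  by move=> x y z _ _ _; split=> // /eqP ->.
apply/setP => c; apply/imsetP/imsetP => -[x _ ->]; exists x => //.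
  by apply/setP => y; rewrite !inE eq_porbit_mem porbit_sym.
by apply/setP => y; rewrite !inE eq_porbit_mem porbit_sym.
Qed.

(** * Matching the cycles of two permutations *)

Section Matchings.
Variables (Y : finType) (t : {perm Y}).

(* [f] lists one point in each cycle belonging to [D], the cycle lengths being [ks]. *)
Definition orbit_match (ks : seq nat) (D : {set {set Y}}) (f : {ffun 'I_(size ks) -> Y}) :=
  [&& injectiveb (fun i => porbit t (f i)),
      [forall i, #|porbit t (f i)| == nth 0 ks i]%N &
      [set porbit t (f i) | i in 'I_(size ks)] == D].

Definition orbit_matchings ks D : nat := (\sum_f orbit_match (ks := ks) D f)%N.

Lemma orbit_matchings_nil D : orbit_matchings [::] D = (D == set0).
Proof.
rewrite /orbit_matchings big_ffun0; congr nat_of_bool; rewrite /orbit_match.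
have -> : injectiveb (fun i => porbit t (ffun0 (card_ord 0) i : Y)) by apply/injectiveP => -[].
rewrite (_ : [forall i, _] = true) /=; last by apply/forallP => -[].
rewrite eq_sym; congr (_ == _); apply/setP => c; rewrite inE.
by apply/imsetP => -[[]].
Qed.

Lemma orbit_matchings_cons k ks D :
  orbit_matchings (k :: ks) D =
  (\sum_(y | (porbit t y \in D) && (#|porbit t y| == k))
      orbit_matchings ks (D :\ porbit t y))%N.
Proof.
rewrite /orbit_matchings /= (big_ffun_cons addn).
rewrite [RHS]big_mkcond; apply: eq_bigr => y _.
rewrite (_ : (if _ then _ else _) = (\sum_f [&& porbit t y \in D, #|porbit t y| == k
  & @orbit_match ks (D :\ porbit t y) f])%N); last first.
  by case: (_ \in D) => /=; [case: (_ == k) => //=; rewrite big1 | rewrite big1].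
apply: eq_bigr => f _; congr nat_of_bool; rewrite /orbit_match /=.
rewrite (ffun_forallS y f (fun i z => #|porbit t z| == nth 0 (k :: ks) i)%N) /=.
have imE : [set porbit t (ffun_cons y f i) | i in 'I_(size ks).+1] =
   porbit t y |: [set porbit t (f i) | i in 'I_(size ks)].
  apply/setP => c; rewrite !inE; apply/imsetP/orP.
    move=> [i _ ->]; case: (unliftP ord0 i) => [j|] ->.
      by rewrite ffun_consS; right; apply: imset_f.
    by rewrite ffun_cons0 eqxx; left.
  move=> [/eqP ->|/imsetP[j _ ->]]; first by exists ord0; rewrite ?ffun_cons0.
  by exists (lift ord0 j); rewrite ?ffun_consS.
rewrite imE; set I := [set _ | _ in _].
have injE : injectiveb (fun i => porbit t (ffun_cons y f i)) =
    (porbit t y \notin I) && injectiveb (fun i => porbit t (f i)).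
  apply/injectiveP/andP => [inj|[yI /injectiveP inj] i j].
    split; last by apply/injectiveP => i j e; apply: (@lift_inj _ ord0); apply: inj; rewrite !ffun_consS.
    apply/imsetP => -[j _ e]; have : ord0 = lift ord0 j.
      by apply: inj; rewrite ffun_cons0 ffun_consS.
    by move/(congr1 val).
  case: (unliftP ord0 i) => [i'|] ->; case: (unliftP ord0 j) => [j'|] ->;
    rewrite ?ffun_consS ?ffun_cons0 //.
  - by move=> /inj ->.
  - by move=> e; case/negP: yI; rewrite -e; apply: imset_f.
  - by move=> e; case/negP: yI; rewrite e; apply: imset_f.
rewrite injE; case: (injectiveb _); rewrite ?andbF ?andbT //=.
case: (_ == k); rewrite ?andbF ?andbT //=.
case: [forall j, _]; rewrite ?andbF ?andbT //=.
apply/andP/andP => [[yI /eqP <-]|[yD /eqP ->]].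
  by rewrite setU11 setU1K.
by rewrite !inE eqxx setD1K.
Qed.

End Matchings.

(** Such a [g] maps cycles onto cycles of equal length and is determined by the images of the chosen
    representatives; conversely every matching of cycles extends along them. *)
Lemma card_intertwiners (X : finType) (s t : {perm X}) :
  #|[set g : {perm X} | [forall x, g (s x) == t (g x)]]| =
  orbit_matchings t (porbit_sizes s) (porbits t).
Proof.
rewrite /orbit_matchings.
have sz : size (porbit_sizes s) = #|porbits s| by rewrite size_map -cardE.
have nthE (i : 'I_#|porbits s|) : nth 0%N (porbit_sizes s) i = #|enum_val i|.
  rewrite (nth_map set0) -?cardE //; congr #|pred_of_set _|.
  exact: (esym (enum_val_nth set0 i)).
rewrite /orbit_match.
move: (porbit_sizes s) sz nthE => ks sz; rewrite sz => nthE.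
pose C (f : {ffun 'I_#|porbits s| -> X}) := [&& injectiveb (fun i => porbit t (f i)),
  [forall i, #|porbit t (f i)| == nth 0 ks i]%N
  & [set porbit t (f i) | i in 'I_#|porbits s|] == porbits t].
transitivity (\sum_(f | C f) 1)%N; last first.
  by rewrite [LHS]big_mkcond; apply: eq_bigr => f _; rewrite -/(C f); case: (C f).
rewrite sum1dep_card.
pose h (g : {perm X}) := [ffun i => g (porb_rep (s := s) i)].
have gi (g : {perm X}) m x : (forall x, g (s x) = t (g x)) -> g (iter m s x) = iter m t (g x).
  by move=> gs; elim: m => //= m <-.
have sizeE (g : {perm X}) x : (forall x, g (s x) = t (g x)) -> #|porbit t (g x)| = #|porbit s x|.
  move=> gs; rewrite -[RHS](card_imset _ (@perm_inj _ g)); apply: eq_card => y.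
  apply/porbitP/imsetP => [[i ->]|[z /porbitP[i ->] ->]].
    by exists ((s ^+ i)%g x); rewrite ?mem_porbit // !permX gi.
  by exists i; rewrite !permX gi.
rewrite -(card_in_imset (f := h)); last first.
  move=> g g'; rewrite !inE => /forallP gs /forallP gs' /ffunP E.
  apply/permP => x; rewrite -(porb_expK s x) !gi; try by move=> z; exact/eqP.
  by have := E (porb_idx s x); rewrite !ffunE => ->.
suff -> : [set h g | g in [set g : {perm X} | [forall x, g (s x) == t (g x)]]] = [set f | C f] by [].
apply/setP => f; rewrite [RHS]inE; apply/imsetP/idP.
  move=> [g + ->]; rewrite inE => /forallP gs0.
  have gs x : g (s x) = t (g x) by exact/eqP.
  have pg x y : (porbit t (g x) == porbit t (g y)) = (porbit s x == porbit s y).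
    rewrite !eq_porbit_mem; apply/porbitP/porbitP => -[i].
      rewrite permX -gi // => /perm_inj ->; exists i; by rewrite permX.
    by move=> ->; exists i; rewrite !permX gi.
  apply/and3P; split.
  - apply/injectiveP => i j /eqP; rewrite !ffunE pg !porb_repE.
    by move/eqP/enum_val_inj.
  - by apply/forallP => i; rewrite ffunE sizeE // nthE porb_repE.
  - apply/eqP/setP => c; apply/imsetP/imsetP => -[x _ ->].
      by exists (g (porb_rep x)); rewrite ?ffunE.
    exists (porb_idx s (g^-1%g x)) => //; apply/eqP; rewrite ffunE.
    by rewrite -{1}(permKV g x) pg porb_repE porb_idxK.
case/and3P => /injectiveP inj /forallP fk _.
pose g0 x := iter (porb_exp s x) t (f (porb_idx s x)).
have fsz x : #|porbit s (porb_rep (porb_idx s x))| = #|porbit t (f (porb_idx s x))|.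
  by rewrite (eqP (fk _)) nthE porb_repE.
have g0s x : g0 (s x) = t (g0 x).
  rewrite /g0 porb_idx_perm -iterS; apply: (iter_porbit_congr (fsz x)).
  by rewrite -{1}(porb_idx_perm s) porb_expK /= porb_expK.
have g0_inj : injective g0.
  move=> x y E; have exy : porb_idx s x = porb_idx s y.
    apply: inj; apply/eqP; rewrite -(porbit_iter t (porb_exp s x) (f (porb_idx s x))).
    rewrite -(porbit_iter t (porb_exp s y) (f (porb_idx s y))).
    by rewrite -/(g0 x) E.
  rewrite -(porb_expK s x) -(porb_expK s y) exy.
  apply: (iter_porbit_congr (esym (fsz y))).
  by move: E; rewrite /g0 exy.
exists (perm g0_inj); first by rewrite inE; apply/forallP => x; rewrite !permE g0s.
apply/ffunP => i; rewrite ffunE permE /g0 porb_repK.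
rewrite -[LHS]/(iter 0 t (f i)); apply: (iter_porbit_congr (s := s) (x := porb_rep i)).
  by have := fsz (porb_rep i); rewrite porb_repK.
by have := porb_expK s (porb_rep i); rewrite porb_repK => ->.
Qed.

Definition block_sizes (Y : finType) (D : {set {set Y}}) : seq nat :=
  [seq #|c| | c : {set Y} <- enum D].

Lemma block_sizes_rem (Y : finType) (D : {set {set Y}}) c :
  c \in D -> perm_eq (rem #|c| (block_sizes D)) (block_sizes (D :\ c)).
Proof.
move=> cD; have E : perm_eq (enum D) (c :: enum (D :\ c)).
  apply: uniq_perm; rewrite /= ?mem_enum ?inE ?eqxx ?enum_uniq // => z.
  by rewrite inE !mem_enum !inE; case: eqVneq => [->|].
have cin : #|c| \in block_sizes D by apply: map_f; rewrite mem_enum.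
rewrite -(perm_cons #|c|); apply: perm_trans (perm_map (fun c : {set Y} => #|c|) E).
by rewrite perm_sym; exact: perm_to_rem.
Qed.

Lemma eq_alt_dotr d B (F H H' : {ffun 'I_d -> nat} -> int) :
  H =1 H' -> alt_dot B F H = alt_dot B F H'.
Proof. by move=> E; apply: eq_bigr => w _; rewrite E. Qed.

Lemma card_porbit_points (Y : finType) (t : {perm Y}) (D : {set {set Y}}) k :
  D \subset porbits t ->
  (\sum_(y | (porbit t y \in D) && (#|porbit t y| == k)) 1 = k * count_mem k (block_sizes D))%N.
Proof.
move=> /subsetP DY.
rewrite (partition_big (porbit t) (fun c => (c \in D) && (#|c| == k))) //=.
transitivity (\sum_(c | (c \in D) && (#|c| == k)) k)%N.
  apply: eq_bigr => c /andP[cD /eqP ck]; rewrite -[RHS]ck -sum1_card.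
  apply: eq_bigl => y; have /imsetP[z _ zE] := DY c cD.
  apply/andP/idP => [[_ /eqP <-]|]; first exact: porbit_id.
  by rewrite zE -eq_porbit_mem => /eqP ->; rewrite -zE cD ck !eqxx.
rewrite -sum1_count big_map big_enum_cond big_distrr /=.
by apply: eq_bigr => c _; rewrite muln1.
Qed.

(** Both sides satisfy one recursion in [ks]: the factor [k * count_mem k] of [alt_dot_pmuls] is the
    number of points on cycles of length [k] in [D], that is, of choices for the first matched
    point. Equality of total sizes leaves no cycle over at the end, where the norm [d!] of [vdm]
    remains. *)
Lemma alt_dot_matchings d B (ks : seq nat) (Y : finType) (t : {perm Y}) (D : {set {set Y}}) :
  all (leq 1) ks -> D \subset porbits t ->
  sumn ks = (\sum_(c in D) #|c|)%N -> (sumn ks <= d)%N ->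
  (d + \sum_v staircase d v < B)%N ->
  alt_dot B (@pmuls d ks) (@pmuls d (block_sizes D)) =
  (d`! * orbit_matchings t ks D)%:R.
Proof.
move=> + + + + dB; have d_leB : (d <= B)%N by lia.
have sumE (E : {set {set Y}}) : (\sum_(c in E) #|c| = sumn (block_sizes E))%N.
  by rewrite sumnE big_map big_enum.
elim: ks D => [|k ks IH] D /=.
  move=> _ /subsetP DY sD _; rewrite orbit_matchings_nil.
  have D0 : D = set0.
    apply/eqP; apply: contraTT isT => /set0Pn[c cD].
    have /imsetP[z _ zE] := DY c cD.
    move: sD; rewrite (bigD1 c) //= => /esym/eqP; rewrite addn_eq0 zE.
    by rewrite (negPf (card_porbit_neq0 _ _)).
  by rewrite D0 /block_sizes enum_set0 /= eqxx muln1 alt_dot_vdm.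
case/andP=> k0 kspos DY sD dk.
have sDd : sumn (block_sizes D) = (k + sumn ks)%N by rewrite -sumE -sD.
rewrite alt_dot_pmuls ?sDd //; last by lia.
rewrite -(card_porbit_points k DY) orbit_matchings_cons.
rewrite [X in _ = X%:R]big_distrr /= !natr_sum [LHS]mulr_suml; apply: eq_bigr => y /andP[yD /eqP yk].
rewrite mul1r -IH //.
- by rewrite -yk; apply: eq_alt_dotr; apply: pmuls_perm; exact: block_sizes_rem.
- by apply: subset_trans DY; exact: subsetDl.
- by move: sD; rewrite (big_setD1 _ yD) /= yk => /addnI.
- lia.
Qed.

(** * Strictly decreasing exponents and partitions *)

Section Sorting.
Variable d : nat.
Implicit Types (e : {ffun 'I_d -> nat}) (rho : {ffun 'I_d -> 'I_d.+1}).

(** On a rearrangement of a strictly decreasing vector, this rank recovers the permutation that was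
    applied. *)
Definition expo_rank e (x : 'I_d) : nat := #|[set u | (e x < e u)%N]|.

Definition decreasing_expo e := forall u v : 'I_d, (u < v)%N -> (e v < e u)%N.

Lemma expo_rank_perm e p x : expo_rank (expo_perm e p) x = expo_rank e (p x).
Proof.
rewrite /expo_rank -[RHS](card_imset _ (@perm_inj _ p^-1%g)); apply: eq_card => u.
rewrite !inE !ffunE; apply/idP/imsetP => [h|[y + ->]]; last by rewrite inE permKV.
by exists (p u); rewrite ?inE // permK.
Qed.

Lemma decreasing_rank e v : decreasing_expo e -> expo_rank e v = v.
Proof.
move=> dec; rewrite /expo_rank.
transitivity #|[set u : 'I_d | (u < v)%N]|.
  congr #|pred_of_set _|; apply/setP => u; rewrite !inE.
  case: (ltngtP u v) => [/dec -> //|/dec vu|/val_inj ->].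
    by apply/negbTE; rewrite -leqNgt ltnW.
  by rewrite ltnn.
have vd : (v <= d)%N by rewrite ltnW.
by rewrite -sum1dep_card (big_ord_narrow (F := fun=> 1%N) vd) sum_nat_const card_ord muln1.
Qed.

Lemma decreasing_gap e (u v : 'I_d) : decreasing_expo e ->
  (u <= v)%N -> (e v + (v - u) <= e u)%N.
Proof.
move=> dec; have [k] := ubnP (v - u)%N; elim: k u => // k IH u.
rewrite ltnS => kv; rewrite leq_eqVlt => /predU1P[/val_inj ->|uv].
  by rewrite subnn addn0.
have u1d : (u.+1 < d)%N by apply: leq_ltn_trans uv (ltn_ord v).
have := IH (Ordinal u1d); rewrite /= => /(_ _ uv) h.
have := dec u (Ordinal u1d) (ltnSn u); have := h ltac:(lia); lia.
Qed.

Lemma chi_weight_decreasing rho : is_partition rho -> decreasing_expo (chi_weight rho).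
Proof.
case/andP=> /forallP dec _ u v uv; rewrite !ffunE.
have /forallP/(_ v) := dec u; rewrite (ltnW uv) /= => h.
by have := ltn_ord v; lia.
Qed.

Lemma chi_weight_inj : injective (@chi_weight d).
Proof.
move=> rho rho' /ffunP E; apply/ffunP => v; apply: val_inj => /=.
by have := E v; rewrite !ffunE; lia.
Qed.

Lemma sum_chi_weight rho : is_partition rho ->
  (\sum_v chi_weight rho v = d + \sum_v staircase d v)%N.
Proof.
case/andP=> _ /eqP E; rewrite -[X in _ = (X + _)%N]E -big_split; apply: eq_bigr => v _.
by rewrite !ffunE.
Qed.

Lemma partition_of_decreasing e : decreasing_expo e ->
  (\sum_v e v = d + \sum_v staircase d v)%N ->
  exists2 rho, is_partition rho & chi_weight rho = e.
Proof.
move=> dec tot.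
have ge v : (staircase d v <= e v)%N.
  rewrite ffunE; have d1 : (d.-1 < d)%N by have := ltn_ord v; lia.
  have := @decreasing_gap e v (Ordinal d1) dec; rewrite /= => h.
  by have := h ltac:(have := ltn_ord v; lia); lia.
have sumE : (\sum_v (e v - staircase d v) = d)%N.
  apply: (@addIn (\sum_v staircase d v)); rewrite -tot -big_split /=.
  by apply: eq_bigr => v _; rewrite subnK.
have led v : (e v - staircase d v < d.+1)%N.
  by rewrite ltnS -[X in (_ <= X)%N]sumE (bigD1 v) //= leq_addr.
exists [ffun v => Ordinal (led v)]; last first.
  by apply/ffunP => v; rewrite !ffunE /=; have := ge v; rewrite ffunE; lia.
apply/andP; split; last by apply/eqP; rewrite -[RHS]sumE; apply: eq_bigr => v _; rewrite ffunE.
apply/forallP => u; apply/forallP => v; apply/implyP => uv; rewrite (ffunE _ u) (ffunE _ v) /=.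
have := ge u; have := ge v; have := decreasing_gap dec uv.
have stE x : staircase d x = (d.-1 - x)%N by rewrite ffunE.
by rewrite !stE; have := ltn_ord v; lia.
Qed.

Lemma sort_expo e : injective e -> exists p : 'S_d, decreasing_expo (expo_perm e p^-1%g).
Proof.
move=> inj; have rkd x : (expo_rank e x < d)%N.
  rewrite -[X in (_ < X)%N]card_ord; apply: proper_card.
  apply/properP; split; first exact/subsetP.
  by exists x; rewrite // inE ltnn.
have lt_rk x y : (e x < e y)%N -> (expo_rank e y < expo_rank e x)%N.
  move=> xy; apply: proper_card; apply/properP; split.
    by apply/subsetP => u; rewrite !inE; apply: ltn_trans.
  by exists y; rewrite !inE ?ltnn.
have rk_inj : injective (fun x => Ordinal (rkd x)).
  move=> x y /(congr1 val)/= E; apply: inj.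
  by case: (ltngtP (e x) (e y)) => // /lt_rk; rewrite E ltnn.
exists (perm rk_inj) => u v uv; rewrite !ffunE.
set p := perm rk_inj; rewrite ltnNge leq_eqVlt; apply/negP => /predU1P[/inj|/lt_rk].
  by move/perm_inj => E; move: uv; rewrite E ltnn.
have pE x : expo_rank e (p^-1%g x) = x.
  by have /(congr1 val)/= := permE rk_inj (p^-1%g x); rewrite -/p permKV.
by rewrite !pE; lia.
Qed.

(** An injective exponent vector of the right total is a rearrangement of [chi_weight rho] for a
    unique partition [rho] and a unique permutation, so each partition is counted [d!] times. *)
Lemma sum_box_partitions B (A : {ffun 'I_d -> nat} -> int) :
  (forall e p, A (expo_perm e p) = A e) ->
  (forall e, A e != 0 -> injective e /\ (\sum_v e v = d + \sum_v staircase d v)%N) ->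
  (d + \sum_v staircase d v < B)%N ->
  \sum_(w : {ffun 'I_d -> 'I_B}) A (natw w) =
  d`!%:R * \sum_(rho | is_partition rho) A (chi_weight rho).
Proof.
move=> symA suppA; case: B => // B dB.
have le_tot e v : (e v <= \sum_v e v)%N by rewrite (bigD1 v) //= leq_addr.
pose h (x : {ffun 'I_d -> 'I_d.+1} * 'S_d) : {ffun 'I_d -> 'I_B.+1} :=
  [ffun v => inord (chi_weight x.1 (x.2 v))].
have hE rho p : is_partition rho -> natw (h (rho, p)) = expo_perm (chi_weight rho) p.
  move=> pr; apply/ffunP => v; rewrite [LHS]ffunE [in LHS]ffunE [RHS]ffunE /=.
  by rewrite inordK //; apply: leq_ltn_trans (le_tot _ _) _; rewrite sum_chi_weight.
pose S := setX [set rho : {ffun 'I_d -> 'I_d.+1} | is_partition rho] [set: 'S_d].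
have hS : {in S &, injective h}.
  move=> [rho p] [rho' p']; rewrite !inE !andbT /= => pr pr' /(congr1 (@natw d B.+1)).
  rewrite !hE // => E; have pp : p = p'.
    apply/permP => x; apply: val_inj => /=.
    rewrite -(decreasing_rank (p x) (chi_weight_decreasing pr)).
    rewrite -(decreasing_rank (p' x) (chi_weight_decreasing pr')).
    by rewrite -!expo_rank_perm E.
  by move: E; rewrite pp => /expo_perm_inj/chi_weight_inj ->.
transitivity (\sum_(w in h @: S) A (natw w)).
  rewrite [RHS]big_mkcond; apply: eq_bigr => w _; case: ifPn => // wS.
  apply: contraNeq wS => /suppA[inj tot].
  have [p /partition_of_decreasing[]] := sort_expo inj.
    by rewrite -tot [RHS](reindex_inj (@perm_inj _ p^-1%g)); apply: eq_bigr => v _; rewrite ffunE.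
  move=> rho pr rhoE; apply/imsetP; exists (rho, p); first by rewrite !inE pr.
  apply: natw_inj; rewrite hE // rhoE expo_permM mulgV.
  by apply/ffunP => v; rewrite [RHS]ffunE perm1.
rewrite big_imset //= mulr_sumr.
transitivity (\sum_(rho | is_partition rho) \sum_(p : 'S_d) A (chi_weight rho)); last first.
  by apply: eq_bigr => rho _; rewrite sumr_const card_Sn mulr_natl.
rewrite pair_big /=; apply: eq_big => [[rho p]|[rho p]]; first by rewrite !inE.
by rewrite !inE andbT => pr; rewrite hE // symA.
Qed.

End Sorting.

Lemma porbit_sizes_pos (X : finType) (s : {perm X}) : all (leq 1) (porbit_sizes s).
Proof.
apply/allP => k /mapP[c]; rewrite mem_enum => /imsetP[x _ ->] ->.
by rewrite lt0n card_porbit_neq0.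
Qed.

(** A product of two alternating functions is symmetric, so [alt_dot] is [d!] times the sum over
    partitions; by [alt_dot_matchings] it is also [d!] times the number of intertwiners. *)
Lemma chi_column_orthogonality d (s t : 'S_d) :
  \sum_(rho : {ffun 'I_d -> 'I_d.+1} | is_partition rho) chi rho s * chi rho t =
  #|[set g : 'S_d | [forall x, g (s x) == t (g x)]]|%:R :> int.
Proof.
pose B := (d + \sum_v staircase d v).+1.
have d0 : (d`!%:R != 0 :> int) by rewrite pnatr_eq0 -lt0n fact_gt0.
apply: (mulfI d0); rewrite card_intertwiners -natrM.
have sD : sumn (porbit_sizes s) = (\sum_(c in porbits t) #|c|)%N.
  rewrite sumn_porbit_sizes -(sumn_porbit_sizes t) sumnE big_map big_enum.
  by [].
rewrite -(@alt_dot_matchings d B) ?porbit_sizes_pos ?sumn_porbit_sizes ?card_ord -?sD ?sumn_porbit_sizes ?card_ord //.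
rewrite /alt_dot (@sum_box_partitions d B (fun e => pmuls (porbit_sizes s) e * pmuls (porbit_sizes t) e)) //.
- by congr (_ * _); apply: eq_bigr => rho _; rewrite !chi_pmuls.
- by move=> e p; rewrite !pmuls_alt mulrACA -expr2 sqrr_sign mul1r.
move=> e; rewrite mulf_eq0 negb_or => /andP[nz _]; split; last first.
  by rewrite (pmuls_total nz) sumn_porbit_sizes card_ord.
move=> u v uv; apply: contraNeq nz => ne.
by rewrite (alt_dup (pmuls_alt (porbit_sizes s)) ne).
Qed.

(** * Characters of the symmetric group *)

Section PermutationCharacter.
Variables (gT : finGroupType) (T : finType) (to : {action gT &-> T}) (S : {set T}).
Hypothesis actsS : forall g x, x \in S -> to x g \in S.

Definition fixmx g : 'M[algC]_#|S| :=
  \matrix_(i, j) (to (enum_val i) g == enum_val j)%:R.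

Lemma fixmx_repr : mx_repr [set: gT] fixmx.
Proof.
split=> [|g h _ _]; apply/matrixP => i j; rewrite !mxE.
  by rewrite act1 (inj_eq enum_val_inj) eq_sym.
have gS := actsS g (enum_valP i).
rewrite (bigD1 (enum_rank_in gS (to (enum_val i) g))) //= !mxE enum_rankK_in // eqxx mul1r.
rewrite actM big1 ?addr0 // => k ne; rewrite mxE.
case: eqP => [E|]; rewrite ?mul0r //.
by case/eqP: ne; apply: enum_val_inj; rewrite enum_rankK_in // E.
Qed.

Definition fixchar : 'CF([set: gT]) := cfRepr (MxRepresentation fixmx_repr).

Lemma fixchar_char : fixchar \is a character.
Proof. exact: cfRepr_char. Qed.

Lemma fixcharE g : fixchar g = #|[set x in S | to x g == x]|%:R.
Proof.
rewrite cfunE in_setT mulr1n /mxtrace.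
transitivity (\sum_(x in S) (to x g == x)%:R : algC).
  by rewrite [RHS]big_enum_val; apply: eq_bigr => i _; rewrite mxE.
rewrite -sum1dep_card big_mkcondr natr_sum; apply: eq_bigr => x _.
by case: eqP.
Qed.

End PermutationCharacter.

Section FfunAction.
Variables (d : nat) (K : finType).

Definition ffun_perm (f : {ffun 'I_d -> K}) (s : 'S_d) : {ffun 'I_d -> K} :=
  [ffun x => f (s^-1%g x)].

Lemma ffun_perm_is_action : is_action [set: 'S_d] ffun_perm.
Proof.
apply: is_total_action => [f|f s t]; apply/ffunP => x; rewrite !ffunE.
  by rewrite invg1 perm1.
by rewrite invMg permM.
Qed.
Canonical ffun_perm_action := Action ffun_perm_is_action.

Lemma ffun_perm_fixed f s : (ffun_perm f s == f) = [forall x, f (s x) == f x].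
Proof.
apply/eqP/forallP => [/ffunP E x|E].
  by have := E (s x); rewrite ffunE permK => ->.
by apply/ffunP => x; rewrite ffunE -{2}(permKV s x) (eqP (E _)).
Qed.

Lemma card_ffun_perm_fiber (f : {ffun 'I_d -> K}) s v :
  #|[set x | ffun_perm f s x == v]| = #|[set x | f x == v]|.
Proof.
rewrite -[RHS](card_imset _ (@perm_inj _ s)); apply: eq_card => x.
rewrite !inE ffunE; apply/idP/imsetP => [h|[y + ->]]; last by rewrite inE permK.
by exists (s^-1%g x); rewrite ?inE ?permKV.
Qed.
End FfunAction.

(** The fibre sizes are those of one term of the Jacobi-Trudi determinant for [rho]. Adding
    [d.-1 - p v] on the left avoids truncated subtraction: the set is empty when a size would be
    negative. *)
Definition content_set d (rho : {ffun 'I_d -> 'I_d.+1}) (p : 'S_d) :=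
  [set f : {ffun 'I_d -> 'I_d} |
    [forall v, #|[set x | f x == v]| + (d.-1 - p v) == rho v + (d.-1 - v)]%N].

Lemma content_set_stable d (rho : {ffun 'I_d -> 'I_d.+1}) (p s : 'S_d) f :
  f \in content_set rho p -> ffun_perm_action d 'I_d f s \in content_set rho p.
Proof.
rewrite !inE => /forallP h; apply/forallP => v.
by rewrite card_ffun_perm_fiber.
Qed.

Definition chi_cf d (rho : {ffun 'I_d -> 'I_d.+1}) : 'CF([set: 'S_d]) :=
  \sum_(p : 'S_d) (-1) ^+ p *: fixchar (@content_set_stable d rho p).

Lemma chi_cfE d (rho : {ffun 'I_d -> 'I_d.+1}) s : chi_cf rho s = (chi rho s)%:~R.
Proof.
rewrite /chi_cf /chi sum_cfunE rmorph_sum; apply: eq_bigr => p _.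
rewrite cfunE fixcharE rmorphM rmorphXn rmorphN1; congr (_ * _).
rewrite [RHS]/= -pmulrn; congr (_%:R); apply: eq_card => f; rewrite !inE andbC.
by rewrite -ffun_perm_fixed.
Qed.

Lemma chi_cf_vchar d (rho : {ffun 'I_d -> 'I_d.+1}) : chi_cf rho \in 'Z[irr [set: 'S_d]]%g.
Proof.
by apply: rpred_sum => p _; rewrite rpredZsign char_vchar // fixchar_char.
Qed.

Lemma card_intertwiners_conj d (s t : 'S_d) :
  #|[set g : 'S_d | [forall x, g (s x) == t (g x)]]| = #|[set g : 'S_d | s ^ g == t]%g|.
Proof.
apply: eq_card => g; rewrite !inE; apply/forallP/eqP => [h|<- x].
  by apply/permP => x; rewrite conjgE !permM (eqP (h _)) permKV.
by rewrite conjgE !permM permK.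
Qed.

(** * Proportionality to irreducible characters *)

Section Irreducibility.
Variable d : nat.
Local Notation G := [set: 'S_d]%G.
Implicit Types (rho : {ffun 'I_d -> 'I_d.+1}).

(** Column orthogonality summed against ['chi_i]: weighting [s] by the number of [g] that conjugate
    it to [t] averages a class function to its value at [t]. *)
Lemma chi_cf_frame (i : Iirr G) :
  \sum_(rho | is_partition rho) '['chi_i, chi_cf rho] *: chi_cf rho = 'chi_i.
Proof.
apply/cfunP => t; rewrite sum_cfunE.
have d0 : (#|G|%:R != 0 :> algC) := neq0CG _.
transitivity (#|G|%:R^-1 * \sum_(s : 'S_d) 'chi_i s *
   (\sum_(rho | is_partition rho) chi rho s * chi rho t)%:~R).
  under eq_bigr do rewrite cfunE cfdotE mulrAC -mulrA.
  rewrite -mulr_sumr; congr (_ * _).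
  under eq_bigr do rewrite mulr_sumr.
  rewrite exchange_big /=; apply: eq_big => [s|s _]; first by rewrite inE.
  rewrite rmorph_sum mulr_sumr; apply: eq_bigr => rho _.
  rewrite !chi_cfE rmorphM /= conj_intr ?rpred_int //; ring.
transitivity (#|G|%:R^-1 * \sum_(s : 'S_d) \sum_(g : 'S_d) 'chi_i s * (s ^ g == t)%g%:R).
  congr (_ * _); apply: eq_bigr => s _; rewrite chi_column_orthogonality.
  rewrite card_intertwiners_conj -mulr_sumr; congr (_ * _).
  rewrite rmorph_nat -sum1dep_card natr_sum big_mkcond.
  by apply: eq_bigr => g _; case: ifP.
rewrite exchange_big /= (eq_bigr (fun=> 'chi_i t)).
  by rewrite sumr_const -cardsT -[X in _ * X]mulr_natl mulKf.
move=> g _; rewrite (bigD1 (t ^ g^-1)%g) //= conjgKV eqxx mulr1 big1 ?addr0.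
  by rewrite cfunJ // inE.
move=> s ne; case: eqP => [E|]; rewrite ?mulr0 //.
by case/eqP: ne; rewrite -E conjgK.
Qed.

Lemma chi_cf_int rho (i : Iirr G) : '[chi_cf rho, 'chi_i] \is a Num.int.
Proof. by rewrite Cint_cfdot_vchar ?chi_cf_vchar ?irr_vchar. Qed.

Lemma cfdot_chi_cfC rho (i : Iirr G) : '['chi_i, chi_cf rho] = '[chi_cf rho, 'chi_i].
Proof. by rewrite cfdotC conj_intr ?chi_cf_int. Qed.

Lemma chi_cf_gram (i j : Iirr G) :
  \sum_(rho | is_partition rho) '[chi_cf rho, 'chi_i] * '[chi_cf rho, 'chi_j] = (i == j)%:R.
Proof.
rewrite -cfdot_irr -{2}(chi_cf_frame i) cfdot_suml; apply: eq_bigr => rho _.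
by rewrite cfdotZl cfdot_chi_cfC.
Qed.

(* Each irreducible character occurs in exactly one [chi_cf rho], with coefficient
   [1] or [-1]: its coefficients are integers with squares summing to [1]. *)
Lemma chi_cf_proportional rho : is_partition rho ->
  exists c (i : Iirr G), chi_cf rho = c *: 'chi_i.
Proof.
move=> pr; have [i zi|z0] := pickP (fun i : Iirr G => '[chi_cf rho, 'chi_i] != 0); last first.
  exists 0, 0; rewrite scale0r (cfun_sum_cfdot (chi_cf rho)) big1 // => i _.
  by have /negbFE/eqP -> := z0 i; rewrite scale0r.
exists '[chi_cf rho, 'chi_i], i.
rewrite {1}(cfun_sum_cfdot (chi_cf rho)) (bigD1 i) //= big1 ?addr0 // => j ji.
have sq_ge0 rho' : 0 <= '[chi_cf rho', 'chi_i] * '[chi_cf rho', 'chi_i].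
  by rewrite -expr2 -intr_normK ?chi_cf_int // exprn_ge0.
have others rho' : is_partition rho' -> rho' != rho -> '[chi_cf rho', 'chi_i] = 0.
  move=> pr' ne; have := chi_cf_gram i i; rewrite eqxx (bigD1 rho) //= => E.
  have ge1 : 1 <= '[chi_cf rho, 'chi_i] * '[chi_cf rho, 'chi_i].
    rewrite -expr2 -intr_normK ?chi_cf_int // exprn_ege1 //.
    by rewrite norm_intr_ge1 ?chi_cf_int.
  have le0 : \sum_(r | is_partition r && (r != rho))
      '[chi_cf r, 'chi_i] * '[chi_cf r, 'chi_i] <= 0.
    by rewrite -(lerD2l ('[chi_cf rho, 'chi_i] * '[chi_cf rho, 'chi_i])) E addr0.
  have /eqP := le_anti (introT andP (conj le0 (sumr_ge0 _ (fun r _ => sq_ge0 r)))).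
  rewrite psumr_eq0 => [/allP/(_ rho' (mem_index_enum _))|r _]; last exact: sq_ge0.
  by rewrite pr' ne /= mulf_eq0 orbb => /eqP.
have := chi_cf_gram i j; rewrite eq_sym (negPf ji) (bigD1 rho) //= big1 => [|r /andP[prr ne]].
  by rewrite addr0 => /eqP; rewrite mulf_eq0 (negPf zi) /= => /eqP ->; rewrite scale0r.
by rewrite others // mul0r.
Qed.

(** Convolution with a class function rescales an irreducible character. The denominator
    [chi_cf rho 1] is cleared because the scalar in [chi_cf_proportional] might still be zero. *)
Lemma chi_convolution rho (s : 'S_d) (phi : 'CF(G)) : is_partition rho ->
  chi_cf rho 1%g * (\sum_t chi_cf rho (t * s)%g * phi t^-1%g) =
  chi_cf rho s * (\sum_t chi_cf rho t * phi t^-1%g).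
Proof.
move=> /chi_cf_proportional[c [i ->]].
have conv y : \sum_t (c *: 'chi_i) (t * y)%g * phi t^-1%g =
    c * '[phi, 'chi_i] * (#|G|%:R * ('chi_i y / 'chi_i 1%g)).
  rewrite {1}(cfun_sum_cfdot phi).
  transitivity (\sum_j c * '[phi, 'chi_j] * \sum_(t in G) 'chi_i (t * y)%g * 'chi_j t^-1%g).
    under eq_bigr do rewrite sum_cfunE mulr_sumr.
    rewrite exchange_big; apply: eq_bigr => j _; rewrite mulr_sumr.
    by apply: eq_big => [t|t _]; rewrite ?inE // !cfunE; ring.
  rewrite (bigD1 i) //= [X in _ + X]big1 ?addr0 => [|j ji].
    have := generalized_orthogonality_relation y i i; rewrite eqxx mul1r => <-.
    by rewrite mulVKf // (neq0CG G).
  have := generalized_orthogonality_relation y i j; rewrite eq_sym (negPf ji) mul0r.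
  by move=> /eqP; rewrite mulf_eq0 invr_eq0 (negPf (neq0CG _)) /= => /eqP ->; rewrite mulr0.
have conv1 : \sum_t (c *: 'chi_i) t * phi t^-1%g =
    c * '[phi, 'chi_i] * (#|G|%:R * ('chi_i 1%g / 'chi_i 1%g)).
  by rewrite -conv; apply: eq_bigr => t _; rewrite mulg1.
by rewrite conv conv1 !cfunE; have := irr1_neq0 i; move: ('chi_i 1%g) => x x0; field.
Qed.
End Irreducibility.

(** * Content products *)

Definition rising (R : comNzRingType) (x : R) (k : nat) : R := \prod_(i < k) (x + i%:R).

Lemma risingD (R : comNzRingType) (x : R) k l :
  rising x (k + l) = rising x k * rising (x + k%:R) l.
Proof.
rewrite /rising big_split_ord; congr (_ * _).
by apply: eq_bigr => i _; rewrite natrD addrA.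
Qed.

Lemma risingS (R : comNzRingType) (x : R) k : rising x k.+1 = x * rising (x + 1) k.
Proof. by rewrite -add1n risingD /rising big_ord1 addr0. Qed.

Lemma risingSr (R : comNzRingType) (x : R) k : rising x k.+1 = rising x k * (x + k%:R).
Proof. by rewrite /rising big_ord_recr. Qed.

Lemma ffactSSr m i : (m.+1 ^_ i = m ^_ i + i * m ^_ i.-1)%N.
Proof.
case: i => [|i]; first by rewrite !ffactn0.
rewrite ffactnS [in RHS]ffactnSr /=; case: (leqP i m) => im; last first.
  by rewrite !ffact_small //; lia.
by rewrite [in LHS]mulnC mulSn mulnC; nia.
Qed.

(** A form of the Chu-Vandermonde identity. Passing from [m] to [m.+1] expands at [x + 1]; moving
    each term back to [x] costs a multiple of the next one, matching the second summand of
    [ffactSSr]. *)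
Lemma rising_shift (R : comNzRingType) (x : R) m s :
  rising (x + m%:R) s =
  \sum_(i < s.+1) ('C(s, i) * m ^_ i)%:R * rising (x + i%:R) (s - i).
Proof.
elim: m x => [|m IH] x.
  rewrite addr0 big_ord_recl bin0 ffactn0 mul1r addr0 subn0 big1 ?addr0 //.
  by move=> i _; rewrite ffact0n muln0 mul0r.
rewrite -[m.+1]add1n natrD addrA IH.
under [RHS]eq_bigr do rewrite add1n ffactSSr mulnDr natrD mulrDl.
rewrite big_split /= [X in _ = _ + X]big_ord_recl mul0n muln0 mul0r add0r.
apply/eqP; rewrite [X in _ == X]addrC -subr_eq -sumrB big_ord_recr /= subnn /rising !big_ord0 subrr addr0.
apply/eqP; apply: eq_bigr => i _; rewrite -/(rising _ _) -!/(rising _ _) /=.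
rewrite -mulrBr.
have [k kE] : exists k, (s - i = k.+1)%N by exists (s - i).-1; have := ltn_ord i; lia.
have -> : (s - i.+1 = k)%N by lia.
have binE : ('C(s, i.+1) * (i.+1 * m ^_ i) = 'C(s, i) * m ^_ i * k.+1)%N.
  by rewrite mulnA [('C(_, _) * _.+1)%N]mulnC mul_bin_left kE; nia.
rewrite binE kE risingSr risingS [in RHS]natrM -mulrA; congr (_ * _).
have -> : x + 1 + i%:R = x + i%:R + 1 by ring.
have -> : x + i.+1%:R = x + i%:R + 1 by rewrite -natr1; ring.
by rewrite -natr1; ring.
Qed.

(** * Determinants of Jacobi-Trudi type *)

Section Determinant.
Variable d : nat.
Implicit Types (rho : {ffun 'I_d -> 'I_d.+1}) (w : {ffun 'I_d -> nat}).

(** The Jacobi-Trudi determinant with [h] in place of the complete symmetric functions. The choice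
    [1 / k!] produces the degree [chi rho 1], the choice ['C(N + k, k)] the pairing of [chi rho]
    with [fixcount]. *)
Definition det_shift (R : pzRingType) (h : nat -> R) w : R :=
  \sum_(p : 'S_d) (-1) ^+ p *
    \prod_v (if (staircase d (p v) <= w v)%N then h (w v - staircase d (p v))%N else 0).

Lemma det_shiftE (R : comPzRingType) (h : nat -> R) w :
  det_shift h w = \det (\matrix_(v, j)
    (if (staircase d j <= w v)%N then h (w v - staircase d j)%N else 0)).
Proof.
by apply: eq_bigr => p _; congr (_ * _); apply: eq_bigr => v _; rewrite mxE.
Qed.

Local Notation r := d.-1.
Local Notation c := ('X : {poly rat}).
Local Notation ifact k := ((k`!%:R^-1 : rat)%:P).

Definition rising_hom (k : nat) : {poly rat} := rising (c + r%:R) k * ifact k.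

Lemma rising_neq0 (k l : nat) : rising (c + k%:R) l != 0.
Proof.
apply/prodf_neq0 => i _; rewrite -addrA -natrD -polyC_natr.
by rewrite -size_poly_eq0 size_XaddC.
Qed.

Lemma ifactM k l : (l <= k)%N -> ((k ^_ l)%:R : {poly rat}) * ifact k = ifact (k - l).
Proof.
move=> lk; rewrite -polyC_natr -polyCM; congr (_%:P).
rewrite -(ffact_fact lk) natrM invfM mulrA mulfV ?mul1r //.
by rewrite pnatr_eq0 -lt0n ffact_gt0.
Qed.

(* Multiplied by [rising c r], the matrix on the left becomes the one on the right times a
   triangular matrix that does not depend on [rho]; working over [{poly rat}] makes the common
   factor cancel although it vanishes for small integers. *)
Lemma det_shift_rising rho :
  det_shift rising_hom (chi_weight rho) =
  (\prod_(v < d) rising (c + (staircase d v)%:R) (rho v)) *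
  det_shift (fun k => ifact k) (chi_weight rho).
Proof.
pose w := chi_weight rho; pose st := staircase d.
have st_r j : (st j <= r)%N by rewrite ffunE leq_subr.
have wE v : w v = (st v + rho v)%N by rewrite !ffunE addnC.
(* These are the coefficients of [rising_shift] at [x = c + st j], [m = w v - st j], [s = r - st j],
   with [i = st l - st j]; the remaining [m ^_ i / m!] is the entry [1 / (w v - st l)!] of [V]. *)
pose U := \matrix_(l < d, j < d) (('C(r - st j, st l - st j)%:R : {poly rat}) *
   ((st j <= st l)%N%:R * rising (c + (st l)%:R) (r - st l))).
pose V := \matrix_(v < d, j < d) (if (st j <= w v)%N then ifact (w v - st j) else 0).
pose A := \matrix_(v < d, j < d) (if (st j <= w v)%N then rising_hom (w v - st j) else 0).
have detU : \det U = \prod_(l < d) rising (c + (st l)%:R) (r - st l).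
  rewrite -det_tr det_trig; last first.
    apply/is_trig_mxP => i j ij; rewrite !mxE [(_ <= _)%N](_ : _ = false) ?mul0r ?mulr0 //.
    by rewrite !ffunE; have := ltn_ord j; lia.
  by apply: eq_bigr => l _; rewrite !mxE subnn bin0 leqnn !mul1r.
have AE : rising c r *: A = diag_mx (\row_v rising c (w v)) *m (V *m U).
  apply/matrixP => v j; rewrite mul_diag_mx !mxE.
  under [X in _ = _ * X]eq_bigr do rewrite !mxE.
  case: leqP => jw; last first.
    rewrite mulr0 big1 ?mulr0 // => l _.
    case: leqP => lw; rewrite ?mul0r //.
    by rewrite [(st j <= st l)%N](_ : _ = false) ?mul0r ?mulr0 //; lia.
  rewrite /rising_hom mulrA -risingD; set m := (w v - st j)%N.
  have -> : (r + m = w v + (r - st j))%N by have := st_r j; rewrite /m; lia.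
  rewrite risingD -mulrA; congr (_ * _).
  have -> : c + (w v)%:R = c + (st j)%:R + m%:R by rewrite -addrA -natrD subnKC.
  rewrite rising_shift mulr_suml.
  pose F a := (if (a <= w v)%N then ifact (w v - a) else 0) *
    (('C(r - st j, a - st j)%:R : {poly rat}) *
     ((st j <= a)%N%:R * rising (c + a%:R) (r - a))).
  transitivity (\sum_(0 <= a < d) F a); last first.
    rewrite big_mkord (reindex_inj rev_ord_inj); apply: eq_bigr => l _ /=.
    by transitivity (F (st l)) => //; congr F; rewrite /st ffunE; lia.
  have dE : d = ((r - st j).+1 + st j)%N by have := ltn_ord j; have := st_r j; lia.
  have Z : \sum_(0 <= a < st j) F a = 0.
    rewrite big_nat big1 // => a; case/andP => _ aj.
    by rewrite /F [(st j <= a)%N]leqNgt aj /= mul0r !mulr0.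
  rewrite [in RHS]dE (big_cat_nat (n := st j)) ?leq_addl //= Z add0r.
  rewrite -[X in \sum_(X <= _ < _) _]add0n big_addn addnK big_mkord.
  apply: eq_bigr => i _; rewrite /F leq_addl mul1r addnK.
  have -> : c + (i + st j)%:R = c + (st j)%:R + i%:R by rewrite natrD; ring.
  have -> : (r - (i + st j) = r - st j - i)%N by lia.
  case: leqP => iw; last by rewrite ffact_small ?muln0 ?mul0r //; rewrite /m; lia.
  have -> : (w v - (i + st j) = m - i)%N by rewrite /m; lia.
  by rewrite -(ifactM (k := m)) ?natrM; [ring | rewrite /m; lia].
have detA : rising c r ^+ d * \det A =
    (\prod_(v < d) rising c (w v)) * (\det V * \det U).
  by rewrite -detZ AE det_mulmx det_diag det_mulmx; congr (_ * _); apply: eq_bigr => v _; rewrite mxE.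
have E1 : rising c r ^+ d = (\prod_(l < d) rising c (st l)) * \det U.
  transitivity (\prod_(l < d) rising c r); first by rewrite prodr_const card_ord.
  by rewrite detU -big_split; apply: eq_bigr => l _ /=; rewrite -risingD subnKC.
have E2 : \prod_(v < d) rising c (w v) =
    (\prod_(l < d) rising c (st l)) * \prod_(v < d) rising (c + (st v)%:R) (rho v).
  by rewrite -big_split; apply: eq_bigr => v _; rewrite wE risingD.
have nz : (\prod_(l < d) rising c (st l)) * \det U != 0.
  rewrite -E1 expf_neq0 //; by have := rising_neq0 0 r; rewrite mulr0n addr0.
rewrite !det_shiftE; apply: (mulfI nz); rewrite -{1}E1 detA E2; ring.
Qed.

Lemma det_shift_map (R S : pzRingType) (f : {rmorphism R -> S}) (h : nat -> R) w :
  f (det_shift h w) = det_shift (f \o h) w.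
Proof.
rewrite rmorph_sum; apply: eq_bigr => p _; rewrite rmorphM rmorph_sign.
congr (_ * _); rewrite rmorph_prod; apply: eq_bigr => v _.
by case: ifP; rewrite ?rmorph0.
Qed.

Lemma eq_det_shift (R : pzRingType) (h h' : nat -> R) w :
  h =1 h' -> det_shift h w = det_shift h' w.
Proof.
by move=> E; apply: eq_bigr => p _; congr (_ * _); apply: eq_bigr => v _; rewrite E.
Qed.

Lemma rising_nat N k : rising (N.+1%:R : rat) k = ((N + k) ^_ k)%:R.
Proof.
elim: k => [|k IH]; first by rewrite /rising big_ord0 ffactn0.
by rewrite risingSr IH addnS ffactSS -natrD -natrM mulnC addSn.
Qed.

Lemma horner_rising (x : rat) a k : (rising (c + a%:R) k).[x] = rising (x + a%:R) k.
Proof.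
rewrite /rising -horner_evalE rmorph_prod; apply: eq_bigr => i _.
by rewrite /= horner_evalE -!polyC_natr !hornerE.
Qed.

Lemma det_shift_binomial rho N :
  det_shift (fun k => 'C(N + k, k)%:R : rat) (chi_weight rho) =
  (\prod_(v < d) \prod_(j < rho v) (N.+1%:R + j%:R - v%:R)) *
  det_shift (fun k => k`!%:R^-1) (chi_weight rho).
Proof.
(* Here [x + r = N.+1] turns [rising_hom k] into ['C(N + k, k)], and [x + staircase d v = N.+1 - v]
   gives the content factors of row [v]. *)
pose x : rat := N.+1%:R - r%:R.
have := congr1 (horner_eval x) (det_shift_rising rho).
rewrite rmorphM rmorph_prod !det_shift_map.
rewrite (@eq_det_shift _ _ (fun k => 'C(N + k, k)%:R : rat)); last first.
  move=> k /=; rewrite horner_evalE hornerM horner_rising hornerC /x subrK rising_nat.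
  by rewrite -bin_ffact natrM mulfK // pnatr_eq0 -lt0n fact_gt0.
rewrite [X in _ = _ * X -> _](@eq_det_shift _ _ (fun k => k`!%:R^-1 : rat)); last first.
  by move=> k /=; rewrite horner_evalE hornerC.
move=> ->; congr (_ * _); apply: eq_bigr => v _ /=.
rewrite horner_evalE horner_rising; apply: eq_bigr => j _.
rewrite /x ffunE natrB; last by have := ltn_ord v; lia.
by ring.
Qed.

End Determinant.

(** * Fixed points of permutations on tensors *)

Section Contents.
Variables (d : nat) (K : finType).
Implicit Types (f g : {ffun 'I_d -> K}) (c : {ffun K -> 'I_d.+1}).

Definition content f : {ffun K -> 'I_d.+1} := [ffun k => inord #|[set x | f x == k]|].

Lemma contentE f k : content f k = #|[set x | f x == k]| :> nat.
Proof. by rewrite ffunE inordK // ltnS -[X in (_ <= X)%N](card_ord d) max_card. Qed.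

Lemma content_perm f s : content (ffun_perm f s) = content f.
Proof. by apply/ffunP => k; rewrite !ffunE card_ffun_perm_fiber. Qed.

Lemma sum_content f : (\sum_k content f k = d)%N.
Proof.
rewrite -[RHS](card_ord d) -sum1_card (partition_big f xpredT) //=.
by apply: eq_bigr => k _; rewrite contentE -sum1dep_card.
Qed.

Lemma content_inj f g : content f = content g -> exists s, g = ffun_perm f s.
Proof.
move=> E; have : perm_eq [tuple g i | i < d] [tuple f i | i < d].
  have cnt (h : {ffun 'I_d -> K}) k : count_mem k (map h (enum 'I_d)) = content h k.
    rewrite contentE count_map -sum1_count big_enum_cond -sum1dep_card.
    by apply: eq_bigl.
  apply/allP => k _; apply/eqP.
  have := cnt g k; rewrite -E -(cnt f) => H; exact: H.
case/tuple_permP => p pE; exists p^-1%g; apply/ffunP => x; rewrite ffunE invgK.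
have := congr1 (fun t => nth (g x) t x) pE.
by rewrite -!tnth_nth !tnth_mktuple.
Qed.

Lemma content_surj c : (\sum_k c k = d)%N -> exists f, content f = c.
Proof.
move=> sc; pose s := flatten [seq nseq (c k) k | k <- enum K].
have sz : size s = d.
  rewrite size_flatten /shape -map_comp sumnE big_map big_enum -[RHS]sc.
  by apply: eq_bigr => k _; rewrite /= size_nseq.
exists [ffun i => tnth (tcast sz (in_tuple s)) i]; apply/ffunP => k; apply: val_inj.
rewrite [LHS]contentE.
transitivity (count_mem k s).
  rewrite -sum1dep_card; transitivity (\sum_(i < d | tnth (tcast sz (in_tuple s)) i == k) 1)%N.
    by apply: eq_bigl => i; rewrite ffunE.
  rewrite -(big_tuple _ _ (tcast sz (in_tuple s)) (pred1 k) (fun=> 1%N)) sum1_count.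
  by rewrite val_tcast.
rewrite /s count_flatten -map_comp sumnE big_map big_enum (bigD1 k) //= big1 ?addn0.
  by rewrite count_nseq /= eqxx mul1n.
by move=> l lk; rewrite count_nseq /= (negPf lk).
Qed.

(* Functions up to permutation of their arguments are classified by their fibre sizes. *)
Lemma burnside_content (Q : pred {ffun K -> 'I_d.+1}) :
  (\sum_(t : 'S_d) #|[set f : {ffun 'I_d -> K} | [forall x, f (t x) == f x] & Q (content f)]| =
   d`! * #|[set c : {ffun K -> 'I_d.+1} | (\sum_k c k == d)%N & Q c]|)%N.
Proof.
pose S := [set f : {ffun 'I_d -> K} | Q (content f)].
have actS : [acts [set: 'S_d], on S | ffun_perm_action d K].
  by apply/actsP => t _ f; rewrite !inE /= content_perm.
have := Frobenius_Cauchy actS.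
rewrite cardsT card_Sn mulnC => E.
transitivity (\sum_(a in [set: 'S_d]) #|'Fix_(S | ffun_perm_action d K)[a]%g|)%N.
  apply: eq_big => [t|t _]; first by rewrite inE.
  apply: eq_card => f; rewrite !inE andbC sub1set inE /=.
  by rewrite ffun_perm_fixed.
rewrite E; congr (_ * _)%N.
pose blk c := [set f in S | content f == c].
have cS : [set content f | f in S] =
    [set c : {ffun K -> 'I_d.+1} | (\sum_k c k == d)%N & Q c].
  apply/setP => c; rewrite !inE; apply/imsetP/andP => [[f + ->]|[/eqP/content_surj[f <-] Qf]].
    by rewrite inE sum_content eqxx.
  by exists f; rewrite ?inE.
rewrite -cS -[RHS](card_in_imset (f := blk)).
  rewrite -imset_comp; congr #|pred_of_set _|; apply: eq_in_imset => f fS /=.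
  apply/setP => g; rewrite !inE; apply/orbitP/andP => [[t _ <-]|[gS /eqP E1]].
    by rewrite /= content_perm; rewrite inE in fS.
  by have [t ->] := content_inj (esym E1); exists t; rewrite ?inE.
move=> _ _ /imsetP[f fS ->] /imsetP[g gS ->] /setP/(_ f).
by rewrite !inE eqxx andbT => /esym; rewrite inE in fS; rewrite fS /= => /eqP.
Qed.

End Contents.

Definition fixcount d N (t : 'S_d) : nat :=
  #|[set e : {ffun 'I_d -> 'I_N} | [forall x, e (t x) == e x]]|.

(** Stars and bars, splitting off the first part; the bound [d] on the parts is harmless since
    [k <= d]. *)
Lemma card_weak_compositions d N k : (k <= d)%N ->
  (\sum_(c : {ffun 'I_N.+1 -> 'I_d.+1}) (\sum_i c i == k) = 'C(N + k, k))%N.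
Proof.
have rec M j : (j <= d)%N ->
    (\sum_(c : {ffun 'I_M.+1 -> 'I_d.+1}) (\sum_i c i == j) =
     \sum_(l < j.+1) \sum_(c : {ffun 'I_M -> 'I_d.+1}) (\sum_i c i == l))%N.
  move=> jd; rewrite (big_ffun_cons addn).
  pose g v := (\sum_(c : {ffun 'I_M -> 'I_d.+1}) (v + \sum_i c i == j))%N.
  transitivity (\sum_(v < d.+1) g v)%N.
    apply: eq_bigr => v _; apply: eq_bigr => c _; congr (nat_of_bool (_ == _)).
    by rewrite big_ord_recl ffun_cons0; congr addn; apply: eq_bigr => i _; rewrite ffun_consS.
  transitivity (\sum_(v < j.+1) g v)%N.
    rewrite [RHS](big_ord_widen d.+1 g) ?ltnS // [RHS]big_mkcond; apply: eq_bigr => v _.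
    case: ltnP => // jv; rewrite /g big1 // => c _.
    by apply/eqP; rewrite eqb0; apply/negP => /eqP; lia.
  rewrite (reindex_inj rev_ord_inj); apply: eq_bigr => l _ /=.
  apply: eq_bigr => c _; congr nat_of_bool; move: (\sum_i c i)%N (ltn_ord l) => S lj.
  by apply/eqP/eqP; lia.
elim: N k => [|N IH] k kd.
  rewrite rec // add0n binn big_ord_recl /= big_ffun0 big_ord0 eqxx big1 // => l _.
  by rewrite big_ffun0 big_ord0.
rewrite rec // (eq_bigr (fun l : 'I_k.+1 => 'C(N + l, l))); last first.
  by move=> l _; rewrite IH //; have := ltn_ord l; lia.
elim: k {kd} => [|k IHk]; first by rewrite big_ord1 !addn0 !bin0.
by rewrite big_ord_recr /= IHk [(N.+1 + k.+1)%N]addnS binS addnC !addSnnS.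
Qed.

Section BurnsideCount.
Variables (d N : nat) (mu la : 'I_d -> nat).
Hypothesis tot : (\sum_v la v = d + \sum_v mu v)%N.

Lemma count_row_sums :
  #|[set c : {ffun 'I_d * 'I_N.+1 -> 'I_d.+1} | (\sum_k c k == d)%N &
      [forall v, \sum_k c (v, k) + mu v == la v]%N]| =
  (\prod_v if mu v <= la v then 'C(N + (la v - mu v), la v - mu v) else 0)%N.
Proof.
pose A v (c : {ffun 'I_N.+1 -> 'I_d.+1}) := (\sum_k c k + mu v == la v)%N.
transitivity (\prod_v \sum_c A v c)%N; last first.
  have [/forallP le|/forallPn[v nle]] := boolP [forall v, mu v <= la v]%N; last first.
    rewrite (bigD1 v) //= [in RHS](bigD1 v) //= (negPf nle) mul0n big1 ?mul0n // => c _.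
    by apply/eqP; rewrite eqb0 /A; move: nle; rewrite -ltnNge; apply: contraL => /eqP; lia.
  apply: eq_bigr => v _; rewrite le -(@card_weak_compositions d).
    apply: eq_bigr => c _; congr nat_of_bool; rewrite /A.
    by have := le v; move: (\sum_k _)%N => S leS; apply/eqP/eqP; lia.
  have E : (\sum_v (la v - mu v) = d)%N.
    apply: (@addIn (\sum_v mu v)); rewrite -tot -big_split /=.
    by apply: eq_bigr => u _; rewrite subnK.
  by rewrite -[X in (_ <= X)%N]E (bigD1 v) //= leq_addr.
rewrite bigA_distr_bigA /=.
pose cur (F : {ffun 'I_d -> {ffun 'I_N.+1 -> 'I_d.+1}}) : {ffun 'I_d * 'I_N.+1 -> 'I_d.+1} :=
  [ffun vk => F vk.1 vk.2].
rewrite -sum1dep_card (reindex cur) /=; last first.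
  exists (fun c => [ffun v => [ffun k => c (v, k)]]) => [F|c] _.
    by apply/ffunP => v; apply/ffunP => k; rewrite !ffunE.
  by apply/ffunP => -[v k]; rewrite !ffunE.
rewrite big_mkcond; apply: eq_bigr => F _.
have SE v : (\sum_k cur F (v, k) = \sum_k F v k)%N by apply: eq_bigr => k _; rewrite ffunE.
have totE : (\sum_k cur F k = \sum_v \sum_k F v k)%N.
  by rewrite pair_big /=; apply: eq_bigr => -[v k] _; rewrite ffunE.
have [/forallP h|/forallPn[v nh]] := boolP [forall v, A v (F v)].
  rewrite [RHS]big1; last by move=> v _; rewrite (h v).
  rewrite totE (_ : [forall v, _] = true); last by apply/forallP => v; rewrite SE; exact: h.
  rewrite andbT; case: eqP => // -[]; apply: (@addIn (\sum_v mu v)).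
  by rewrite -tot -big_split; apply: eq_bigr => v _; exact/eqP/h.
rewrite (bigD1 v) //= (negPf nh) mul0n (_ : [forall v, _] = false) ?andbF //.
by apply/negbTE/forallPn; exists v; rewrite SE.
Qed.

(** A pair of fixed functions is one fixed function into ['I_d * 'I_N.+1]. Its orbits correspond to
    matrices of fibre sizes with prescribed row sums, and each row is an independent weak
    composition into [N.+1] parts. *)
Lemma burnside_count :
  (\sum_(t : 'S_d)
     #|[set f : {ffun 'I_d -> 'I_d} | [forall x, f (t x) == f x] &
         [forall v, #|[set x | f x == v]| + mu v == la v]%N]| * fixcount N.+1 t =
   d`! * \prod_v if mu v <= la v then 'C(N + (la v - mu v), la v - mu v) else 0)%N.
Proof.
rewrite -count_row_sums -burnside_content; apply: eq_bigr => t _.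
rewrite /fixcount -cardsX.
pose h (fe : {ffun 'I_d -> 'I_d} * {ffun 'I_d -> 'I_N.+1}) :
  {ffun 'I_d -> 'I_d * 'I_N.+1} := [ffun x => (fe.1 x, fe.2 x)].
have hinj : injective h.
  move=> [f e] [f' e'] /ffunP E; congr (_, _); apply/ffunP => x;
    by have := E x; rewrite !ffunE => -[].
rewrite -(card_imset _ hinj); apply: eq_card => f.
have fE : f = h ([ffun x => (f x).1], [ffun x => (f x).2]).
  by apply/ffunP => x; rewrite !ffunE; case: (f x).
rewrite {1}fE (mem_imset _ _ hinj) !inE /=.
have rowE v : (\sum_k content f (v, k) = #|[set x | [ffun x => (f x).1] x == v]|)%N.
  rewrite -sum1dep_card (partition_big (fun x => (f x).2) xpredT) //=.
  apply: eq_bigr => k _; rewrite contentE -sum1dep_card; apply: eq_bigl => x.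
  by rewrite ffunE -pair_eqE; case: (f x).
rewrite (eq_forallb (fun v => congr1 (fun s => s + mu v == la v)%N (rowE v))).
apply/idP/idP.
  case/andP=> /andP[/forallP h1 ->] /forallP h2; rewrite andbT.
  apply/forallP => x; have := h1 x; have := h2 x; rewrite !ffunE.
  by case: (f x) (f (t x)) => [a b] [a' b'] /= /eqP -> /eqP ->.
case/andP => /forallP h1 ->; rewrite andbT; apply/andP; split;
  by apply/forallP => x; rewrite !ffunE (eqP (h1 x)).
Qed.

End BurnsideCount.

(** * The eigenvalue of fixed-point counting *)

Section Eigenvalue.
Variable d : nat.
Implicit Types (rho : {ffun 'I_d -> 'I_d.+1}) (s t : 'S_d).

Lemma sum_chi_fixcount rho N : is_partition rho ->
  (\sum_(t : 'S_d) chi rho t * (fixcount N.+1 t)%:Z)%:~R =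
  d`!%:R * det_shift (fun k => 'C(N + k, k)%:R : rat) (chi_weight rho).
Proof.
move=> pr; rewrite /det_shift mulr_sumr.
under eq_bigr do rewrite /chi mulr_suml.
rewrite exchange_big rmorph_sum; apply: eq_bigr => p _ /=.
have tot : (\sum_v chi_weight rho v = d + \sum_v staircase d (p v))%N.
  rewrite sum_chi_weight //; congr addn; exact: reindex_inj (@perm_inj _ p).
transitivity (d`!%:R * ((-1) ^+ p * \prod_v
   ((if staircase d (p v) <= chi_weight rho v then
    'C(N + (chi_weight rho v - staircase d (p v)), chi_weight rho v - staircase d (p v))
    else 0)%N%:R : rat))); last first.
  by congr (_ * (_ * _)); apply: eq_bigr => v _; case: ifP.
rewrite -natr_prod mulrCA -natrM -(burnside_count N tot).
under eq_bigr do rewrite -mulrA; rewrite -mulr_sumr rmorphM rmorph_sign; congr (_ * _).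
rewrite natr_sum rmorph_sum; apply: eq_bigr => t _.
rewrite -PoszM /= -pmulrn; congr ((_ * _)%N%:R).
apply: eq_card => f; rewrite !inE; congr (_ && _); apply: eq_forallb => v.
by rewrite !ffunE.
Qed.

Lemma porbit_sizes1 : porbit_sizes (1%g : 'S_d) = nseq d 1%N.
Proof.
have one : all (pred1 1%N) (porbit_sizes (1%g : 'S_d)).
  apply/allP => k /mapP[c]; rewrite mem_enum => /imsetP[x _ ->] ->.
  apply/cards1P; exists x; apply/setP => y; rewrite inE.
  apply/porbitP/eqP => [[i ->]|->]; first by rewrite expg1n perm1.
  by exists 0%N; rewrite expg0 perm1.
have := sumn_porbit_sizes (1%g : 'S_d); rewrite card_ord => E.
move/all_pred1P: one => one; move: E; rewrite {1}one sumn_nseq mul1n => sz.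
by rewrite one sz.
Qed.

Lemma pmuls_ones m (w : {ffun 'I_d -> nat}) :
  (\sum_v w v = m + \sum_v staircase d v)%N ->
  (pmuls (nseq m 1%N) w)%:~R = m`!%:R * det_shift (fun k => k`!%:R^-1 : rat) w.
Proof.
elim: m w => [|m IH] w tot.
  rewrite mul1r /= /vdm /det_shift rmorph_sum; apply: eq_bigr => p _.
  rewrite rmorphM rmorph_sign; congr (_ * _).
  have tot' : (\sum_v w v = \sum_v expo_perm (staircase d) p v)%N.
    rewrite tot add0n (reindex_inj (@perm_inj _ p)); apply: eq_bigr => v _.
    by rewrite [RHS]ffunE.
  case: eqP => [->|ne].
    by rewrite big1 // => v _; rewrite [expo_perm _ _ _]ffunE leqnn subnn invr1.
  have [/forallP h|/forallPn[v nh]] := boolP [forall v, staircase d (p v) <= w v]%N; last first.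
    by rewrite (bigD1 v) //= (negPf nh) mul0r.
  case: ne; apply/ffunP => v; rewrite ffunE; apply/eqP; rewrite eq_sym.
  have := eq_leq tot'; rewrite leqNgt => /negP nlt; rewrite eqn_leq h /=.
  rewrite leqNgt; apply/negP => lt; apply: nlt.
  rewrite (bigD1 v) //= [X in (_ < X)%N](bigD1 v) //= ffunE -addSn leq_add //.
  by apply: leq_sum => u _; rewrite ffunE.
rewrite [pmuls _ _]/(pmul 1 (pmuls (nseq m 1%N)) w) /pmul rmorph_sum.
pose h k : rat := k`!%:R^-1.
transitivity (\sum_v (if (0 < w v)%N then m`!%:R * det_shift h (expo_dn w v 1) else 0)).
  apply: eq_bigr => v _; case: ifP => v0 //=; rewrite IH //.
  rewrite (bigD1 v) //= ffunE eqxx mul1n.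
  rewrite (eq_bigr w) => [|u /negPf uv]; last by rewrite ffunE uv mul0n subn0.
  by move: tot; rewrite (bigD1 v) //=; lia.
transitivity (m`!%:R * \sum_(p : 'S_d) (-1) ^+ p * (m.+1%:R *
    \prod_v (if (staircase d (p v) <= w v)%N then h (w v - staircase d (p v))%N else 0))); last first.
  rewrite factS natrM [m.+1%:R * _]mulrC -mulrA; congr (_ * _).
  by rewrite mulr_sumr; apply: eq_bigr => p _; rewrite mulrCA.
transitivity (m`!%:R * \sum_v \sum_(p : 'S_d) (-1) ^+ p *
   (if (0 < w v)%N then \prod_u (if (staircase d (p u) <= expo_dn w v 1 u)%N
      then h (expo_dn w v 1 u - staircase d (p u))%N else 0) else 0)).
  rewrite mulr_sumr; apply: eq_bigr => v _; case: ifP => // _.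
  by rewrite big1 ?mulr0 // => p _; rewrite mulr0.
congr (_ * _); rewrite exchange_big; apply: eq_bigr => p _ /=.
rewrite -mulr_sumr; congr (_ * _).
have totp : (\sum_v w v = m.+1 + \sum_v staircase d (p v))%N.
  by rewrite tot; congr addn; exact: reindex_inj (@perm_inj _ p).
(* lowering the exponent at [v] multiplies the term by [w v - staircase (p v)] *)
have step v : (if (0 < w v)%N then \prod_u (if (staircase d (p u) <= expo_dn w v 1 u)%N
      then h (expo_dn w v 1 u - staircase d (p u))%N else 0) else 0) =
   ((w v)%:R - (staircase d (p v))%:R) *
   \prod_u (if (staircase d (p u) <= w u)%N then h (w u - staircase d (p u))%N else 0).
  rewrite [in RHS](bigD1 v) //= (bigD1 v) //= mulrA.
  set P1 := \prod_(u | _) _; set P2 := \prod_(u | _) _.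
  have -> : P1 = P2.
    apply: eq_bigr => u /negPf uv.
    by have -> : expo_dn w v 1 u = w u by rewrite ffunE uv mul0n subn0.
  have -> : expo_dn w v 1 v = (w v - 1)%N by rewrite ffunE eqxx mul1n.
  case: (leqP (staircase d (p v)) (w v)) => le; last first.
    by rewrite mulr0 mul0r; case: ifP => // v0; rewrite leqNgt (_ : (_ < _)%N) ?mul0r //; lia.
  rewrite -natrB //; case: (ltngtP (staircase d (p v)) (w v)) le => // [lt|->] _; last first.
    rewrite subnn !mul0r; case: ifP => // v0.
    by rewrite (_ : (_ <= _)%N = false) ?mul0r //; lia.
  rewrite (leq_ltn_trans _ lt) // (_ : (_ <= _)%N = true); last by lia.
  congr (_ * _); rewrite /h -subnDA add1n subnS.
  case: (w v - _)%N (subn_gt0 (staircase d (p v)) (w v)) => [|k _]; first by rewrite lt.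
  rewrite /= factS natrM invfM mulrA mulfV ?mul1r //.
  by rewrite pnatr_eq0.
rewrite (eq_bigr _ (fun v _ => step v)).
(* The factors add up to [m.+1], the total excess of [w] over the permuted staircase. *)
rewrite -mulr_suml sumrB -!natr_sum totp natrD addrK.
by [].
Qed.

Lemma chi_one rho : is_partition rho ->
  (chi rho 1%g)%:~R = d`!%:R * det_shift (fun k => k`!%:R^-1 : rat) (chi_weight rho).
Proof. by move=> pr; rewrite chi_pmuls porbit_sizes1 pmuls_ones // sum_chi_weight. Qed.

Definition content_prod rho N : int :=
  \prod_(v < d) \prod_(j < rho v) (N%:Z + j%:Z - v%:Z).

Lemma sum_chi_fixcount_prod rho N : is_partition rho ->
  \sum_(t : 'S_d) chi rho t * (fixcount N.+1 t)%:Z = content_prod rho N.+1 * chi rho 1%g.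
Proof.
move=> pr; apply: (@intr_inj rat); rewrite sum_chi_fixcount // det_shift_binomial.
rewrite rmorphM /= chi_one // mulrCA; congr (_ * _).
rewrite rmorph_prod; apply: eq_bigr => v _; rewrite rmorph_prod; apply: eq_bigr => j _.
by rewrite /= rmorphB rmorphD.
Qed.

Lemma fixcountV N (t : 'S_d) : fixcount N t^-1%g = fixcount N t.
Proof.
apply: eq_card => e; rewrite !inE; apply/forallP/forallP => h x.
  by have := h (t x); rewrite permK eq_sym.
by have := h (t^-1%g x); rewrite permKV eq_sym.
Qed.

(** By [chi_convolution] the eigenvalue can be read off at [s = 1], where [sum_chi_fixcount_prod]
    computes it. *)
Lemma chi_eigen rho N s : is_partition rho ->
  \sum_(t : 'S_d) chi rho (t * s)%g * (fixcount N.+1 t)%:Z =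
  content_prod rho N.+1 * chi rho s.
Proof.
move=> pr.
have actS g (f : {ffun 'I_d -> 'I_N.+1}) : f \in setT -> ffun_perm_action d 'I_N.+1 f g \in setT.
  by rewrite !inE.
pose phi := fixchar actS.
have phiE t : phi t^-1%g = ((fixcount N.+1 t)%:Z)%:~R.
  rewrite fixcharE -pmulrn -fixcountV; congr (_%:R); apply: eq_card => f.
  by rewrite !inE ffun_perm_fixed.
have sumE y : \sum_t chi_cf rho (t * y)%g * phi t^-1%g =
    (\sum_(t : 'S_d) chi rho (t * y)%g * (fixcount N.+1 t)%:Z)%:~R.
  by rewrite rmorph_sum; apply: eq_bigr => t _; rewrite chi_cfE phiE rmorphM.
have := chi_convolution s phi pr; rewrite sumE.
have -> : \sum_t chi_cf rho t * phi t^-1%g = (content_prod rho N.+1 * chi rho 1%g)%:~R.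
  rewrite -sum_chi_fixcount_prod // rmorph_sum; apply: eq_bigr => t _.
  by rewrite chi_cfE phiE rmorphM.
rewrite !chi_cfE -!rmorphM => /intr_inj E.
have [z|nz] := eqVneq (chi rho 1%g) 0; last by apply: (mulfI nz); rewrite E; ring.
(* A vanishing degree forces the scalar of [chi_cf_proportional] to vanish, and with it all of
   [chi rho]. *)
have chi0 y : chi rho y = 0.
  apply: (@intr_inj algC); rewrite -chi_cfE.
  have [c [i cE]] := chi_cf_proportional pr.
  have /eqP := chi_cfE rho 1%g; rewrite z cE cfunE mulf_eq0 (negPf (irr1_neq0 i)) orbF.
  by move/eqP->; rewrite cfunE mul0r.
by rewrite big1 ?chi0 ?mulr0 // => t _; rewrite chi0 mul0r.
Qed.

Lemma sum_chi_regular s :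
  \sum_(rho : {ffun 'I_d -> 'I_d.+1} | is_partition rho) chi rho 1%g * chi rho s =
  (d`! * (s == 1%g))%:R.
Proof.
rewrite chi_column_orthogonality card_intertwiners_conj; congr (_%:R).
rewrite -sum1dep_card big_mkcond -card_Sn -sum_nat_const.
by apply: eq_bigr => g _; rewrite conj1g eq_sym; case: eqP.
Qed.

End Eigenvalue.

(** * Operators commuting with unitary tensor powers *)

Lemma poly_eq0_inj (C : idomainType) (p : {poly C}) (z : nat -> C) :
  injective z -> (forall k, p.[z k] = 0) -> p = 0.
Proof.
move=> zinj pz; apply/eqP; apply: contraT => p0.
have := @max_poly_roots _ p [seq z k | k <- iota 0 (size p)] p0.
rewrite size_map size_iota ltnn; apply.
  by apply/allP => _ /mapP[k _ ->]; apply/rootP.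
by rewrite map_inj_uniq ?iota_uniq.
Qed.

Lemma prodr_nat_bool (C : comNzRingType) (T : finType) (b : pred T) :
  \prod_x (b x)%:R = [forall x, b x]%:R :> C.
Proof.
have [/forallP h|/forallPn[x nh]] := boolP [forall x, b x].
  by rewrite big1 // => x _; rewrite h.
by rewrite (bigD1 x) //= (negPf nh) mul0r.
Qed.

Section TensorPower.
Variables (C : numClosedFieldType) (d N : nat).
Local Notation I := {ffun 'I_d -> 'I_N}.
Implicit Types (A B : 'M[C]_N) (a b c : I).

Definition tpow A a b : C := \prod_r A (a r) (b r).

Lemma tpowM A B a b : tpow (A *m B) a b = \sum_c tpow A a c * tpow B c b.
Proof.
rewrite /tpow; under eq_bigr do rewrite mxE.
rewrite bigA_distr_bigA; apply: eq_bigr => c _.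
by rewrite -big_split.
Qed.

Lemma tpow_diag (h : 'rV[C]_N) a b : tpow (diag_mx h) a b = (a == b)%:R * \prod_r h 0 (a r).
Proof.
rewrite /tpow; under eq_bigr do rewrite mxE.
have [->|ne] := eqVneq a b.
  by rewrite mul1r; apply: eq_bigr => r _; rewrite eqxx mulr1n.
have /existsP[r abr] : [exists r, a r != b r].
  by apply: contraNT ne => /existsPn h0; apply/eqP/ffunP => r; have /negbNE/eqP := h0 r.
by rewrite (bigD1 r) //= (negPf abr) mulr0n !mul0r.
Qed.

Variable M : I -> I -> C.

Definition commutes A :=
  forall a b, \sum_c M a c * tpow A c b = \sum_c tpow A a c * M c b.

Lemma commutesM A B : commutes A -> commutes B -> commutes (A *m B).
Proof.
move=> cA cB a b; under eq_bigr do rewrite tpowM mulr_sumr.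
rewrite exchange_big /=.
transitivity (\sum_c (\sum_e M a e * tpow A e c) * tpow B c b).
  apply: eq_bigr => c _; rewrite mulr_suml; apply: eq_bigr => e _; ring.
transitivity (\sum_c (\sum_e tpow A a e * M e c) * tpow B c b).
  by apply: eq_bigr => c _; rewrite cA.
transitivity (\sum_c \sum_e tpow A a e * M e c * tpow B c b).
  by apply: eq_bigr => c _; rewrite mulr_suml.
rewrite exchange_big /=.
transitivity (\sum_c tpow A a c * (\sum_e M c e * tpow B e b)).
  apply: eq_bigr => c _; rewrite mulr_sumr; apply: eq_bigr => e _; ring.
transitivity (\sum_c tpow A a c * (\sum_e tpow B c e * M e b)).
  by apply: eq_bigr => c _; rewrite cB.
transitivity (\sum_c \sum_e tpow A a c * (tpow B c e * M e b)).
  by apply: eq_bigr => c _; rewrite mulr_sumr.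
rewrite exchange_big /=; apply: eq_bigr => c _; rewrite tpowM mulr_suml.
by apply: eq_bigr => e _; ring.
Qed.

Hypothesis cU : forall A, A \is unitarymx -> commutes A.

(* The Cayley parametrization supplies infinitely many numbers of modulus [1]. *)
Lemma unit_modulus_seq : {z : nat -> C | injective z & forall k, `|z k| = 1}.
Proof.
have nz k : 1 - 'i * k%:R != 0 :> C.
  apply/negP => /eqP/(congr1 (fun z : C => 'Re z)).
  rewrite raddf0 raddfB /= (Creal_ReP _ _) ?real1 // mulrC ReMl ?realn // Re_i mulr0 subr0.
  by move/eqP; rewrite oner_eq0.
exists (fun k => (1 + 'i * k%:R) / (1 - 'i * k%:R)).
  move=> k l /eqP; rewrite eqr_div // => /eqP E.
  have : 2 * 'i * (k%:R - l%:R) = 0 :> C.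
    rewrite (_ : _ * _ = (1 + 'i * k%:R) * (1 - 'i * l%:R) -
      (1 + 'i * l%:R) * (1 - 'i * k%:R)); last by ring.
    by rewrite E subrr.
  move/eqP; rewrite !mulf_eq0 pnatr_eq0 (negPf (neq0Ci _)) /= subr_eq0 eqr_nat.
  by move/eqP.
move=> k; rewrite normf_div -[X in _ / X]norm_conjC rmorphB rmorphM /= conjCi.
rewrite rmorph1 rmorph_nat mulNr opprK divff // normr_eq0.
by rewrite -conjC_eq0 rmorphD rmorphM /= conjCi rmorph1 rmorph_nat mulNr.
Qed.

Definition occ a i : nat := #|[set r | a r == i]|.

(** Commutation with the diagonal unitary having [z] at place [i] and [1] elsewhere gives
    [z ^+ occ a i = z ^+ occ b i]; infinitely many [z] force equal exponents. *)
Lemma occ_commute a b : M a b != 0 -> occ a =1 occ b.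
Proof.
move=> nz i; have [z zinj z1] := unit_modulus_seq.
pose D k : 'rV[C]_N := \row_j (if j == i then z k else 1).
have DU k : diag_mx (D k) \is unitarymx.
  apply/unitarymxP; rewrite tr_diag_mx map_diag_mx mulmx_diag -diag_const_mx.
  congr diag_mx; apply/rowP => j; rewrite !mxE; case: ifP => _; rewrite -normCK ?z1 ?normr1 expr1n //.
have prodD k (e : I) : \prod_r D k 0 (e r) = z k ^+ occ e i.
  rewrite (eq_bigr (fun r => if e r == i then z k else 1)); last by move=> r _; rewrite mxE.
  by rewrite -big_mkcond /= prodr_const /occ cardsE.
have zk k : z k ^+ occ a i = z k ^+ occ b i.
  have := cU (DU k) a b.
  rewrite (bigD1 b) //= big1 ?addr0 => [|c /negPf cb]; last by rewrite tpow_diag cb mul0r mulr0.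
  rewrite (bigD1 a) //= big1 ?addr0 => [|c /negPf ca]; last by rewrite tpow_diag eq_sym ca !mul0r.
  by rewrite !tpow_diag !eqxx !mul1r !prodD mulrC => /(mulIf nz).
have p0 : 'X^(occ a i) - 'X^(occ b i) = 0 :> {poly C}.
  by apply: (poly_eq0_inj zinj) => k; rewrite !hornerE zk subrr.
move/eqP: p0; rewrite subr_eq0 => /eqP/(congr1 (fun p : {poly C} => size p)).
by rewrite !size_polyXn => -[].
Qed.

(** A diagonal tensor power depends only on occupation numbers, which agree wherever [M] is nonzero.
    So the diagonal factor in the spectral theorem need not be unitary. *)
Lemma commutes_diag h : commutes (diag_mx h).
Proof.
move=> a b.
rewrite (bigD1 b) //= big1 ?addr0 => [|c /negPf cb]; last by rewrite tpow_diag cb mul0r mulr0.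
rewrite (bigD1 a) //= big1 ?addr0 => [|c /negPf ca]; last by rewrite tpow_diag eq_sym ca !mul0r.
rewrite !tpow_diag !eqxx !mul1r mulrC.
have [->|/occ_commute E] := eqVneq (M a b) 0; first by rewrite !mulr0.
congr (_ * _).
have prod_occ (e : I) : \prod_r h 0 (e r) = \prod_i h 0 i ^+ occ e i.
  rewrite (partition_big e xpredT) //=; apply: eq_bigr => i _.
  rewrite (eq_bigr (fun=> h 0 i)) => [|r /eqP -> //].
  by rewrite prodr_const /occ cardsE.
by rewrite !prod_occ; apply: eq_bigr => i _; rewrite E.
Qed.

Lemma commutes_normal A : A \is normalmx -> commutes A.
Proof.
move=> /orthomx_spectralP ->; have PU := spectral_unitarymx A.
apply: commutesM; last exact: cU.
apply: commutesM; last exact: commutes_diag.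
by apply: cU; rewrite invmx_unitary // trmxC_unitary.
Qed.

Lemma commutes_all A : commutes A.
Proof.
move=> a b; pose T := (A ^t*)%sesqui.
(* The hermitian parts of [A]: a natural [k] keeps [H1 + k%:R *: H2] hermitian, and the parameter
   ['i] recovers [A]. *)
pose H1 : 'M[C]_N := 2^-1 *: (A + T).
pose H2 : 'M[C]_N := (2 * 'i)^-1 *: (A - T).
have two0 : 2 != 0 :> C by rewrite pnatr_eq0.
have AE : A = H1 + 'i *: H2.
  apply/matrixP => i j; rewrite !mxE.
  by have := neq0Ci C; move: ('i : C) => x x0; field; rewrite ?x0 ?two0.
have TT : (T ^t*)%sesqui = A by rewrite trmxCK.
have cH (k : nat) : commutes (H1 + k%:R *: H2).
  apply: commutes_normal; set H := _ + _.
  suff HE : (H ^t*)%sesqui = H by apply/normalmxP; rewrite HE.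
  have c2 : (2 : C)^* = 2 := rmorph_nat _ 2.
  have ck : (k%:R : C)^* = k%:R := rmorph_nat _ k.
  apply/matrixP => i j; rewrite !mxE.
  move: (2 : C) c2 two0 (k%:R : C) ck => w cw w0 l cl.
  rewrite !(rmorphD, rmorphN, rmorphM, fmorphV) /= conjCi cw cl !conjCK.
  have := neq0Ci C; move: ('i : C) => x x0.
  by field; rewrite ?x0 ?w0.
pose tp a b : {poly C} := \prod_r ((H1 (a r) (b r))%:P + 'X * (H2 (a r) (b r))%:P).
pose p : {poly C} := \sum_c (M a c)%:P * tp c b - \sum_c tp a c * (M c b)%:P.
have tpE a' b' x : (tp a' b').[x] = tpow (H1 + x *: H2) a' b'.
  rewrite /tp -horner_evalE rmorph_prod; apply: eq_bigr => r _.
  by rewrite /= horner_evalE !hornerE !mxE.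
have pE x : p.[x] = \sum_c M a c * tpow (H1 + x *: H2) c b - \sum_c tpow (H1 + x *: H2) a c * M c b.
  rewrite /p hornerD hornerN !horner_sum; congr (_ - _); apply: eq_bigr => c _;
    by rewrite hornerM hornerC tpE.
have p0 : p = 0.
  apply: (@poly_eq0_inj _ p (fun k => k%:R)) => [k l /eqP|k].
    by rewrite eqr_nat => /eqP.
  by rewrite pE cH subrr.
apply/eqP; rewrite -subr_eq0 {1 2}AE -pE p0 horner0 //.
Qed.

Definition tsym (X : 'I_d -> 'M[C]_N) a b : C := \sum_(s : 'S_d) \prod_r X (s r) (a r) (b r).

(* Inclusion-exclusion over the subsets [e] of the indices. *)
Lemma tsymE X a b : (-1) ^+ d * tsym X a b =
  \sum_(e : {ffun 'I_d -> bool}) (\prod_s (if e s then -1 else 1)) *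
     tpow (\sum_s (e s)%:R *: X s) a b.
Proof.
(* The last product contains a factor zero as soon as [f] misses a value, so only permutations
   survive, each with the sign [(-1) ^+ d]. *)
transitivity (\sum_(f : {ffun 'I_d -> 'I_d}) (\prod_r X (f r) (a r) (b r)) *
   \prod_s (-1 + (s \notin codom f)%:R) : C).
  rewrite (bigID (fun f : {ffun 'I_d -> 'I_d} => injectiveb f)) /= [X in _ = _ + X]big1 ?addr0.
    rewrite mulr_sumr (reindex (fun s : 'S_d => pval s)) /=; last first.
      exists (insubd (1%g : 'S_d)) => [s _|f inj]; first exact: valKd.
      exact: insubdK.
    apply: eq_big => [s|s _]; first by rewrite (valP s).
    rewrite mulrC; congr (_ * _); first by apply: eq_bigr => r _; rewrite pvalE.
    transitivity (\prod_(r < d) (-1) : C); first by rewrite prodr_const card_ord.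
    apply: eq_bigr => r _; rewrite (_ : r \in codom _) ?addr0 //.
    by rewrite -[X in X \in _](permKV s r) -pvalE codom_f.
  move=> f ninj; have /existsP[r nr] : [exists r, r \notin codom f].
    apply: contraNT ninj => /existsPn h; apply/injectiveP.
    have : #|image f 'I_d| == #|'I_d|.
      apply/eqP/eq_card => r; have := h r; rewrite negbK => /codomP[x ->].
      by rewrite image_f.
    by move/image_injP => inj x y; apply: inj.
  by rewrite [X in _ * X](bigD1 r) //= nr addNr mul0r mulr0.
(* Each factor is expanded: [e s] selects the [-1], and otherwise [f] must miss [s]. Hence [f] takes
   its values in the subset [e]. *)
transitivity (\sum_(e : {ffun 'I_d -> bool}) \sum_(f : {ffun 'I_d -> 'I_d})
    (\prod_r X (f r) (a r) (b r)) *
    \prod_s ((if e s then -1 else 1) * ((e s || (s \notin codom f))%:R)) : C).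
  rewrite exchange_big; apply: eq_bigr => f _; rewrite -mulr_sumr; congr (_ * _).
  rewrite -(bigA_distr_bigA (fun s (e : bool) =>
     (if e then -1 else 1) * ((e || (s \notin codom f))%:R))) /=.
  by apply: eq_bigr => s _; rewrite big_bool /= mulr1 mul1r.
apply: eq_bigr => e _; rewrite /tpow.
transitivity ((\prod_s (if e s then -1 else 1)) *
   \sum_(f : {ffun 'I_d -> 'I_d}) \prod_r ((e (f r))%:R * X (f r) (a r) (b r)) : C); last first.
  congr (_ * _); rewrite -(bigA_distr_bigA (fun r s => (e s)%:R * X s (a r) (b r))).
  by apply: eq_bigr => r _; rewrite summxE; apply: eq_bigr => s _; rewrite mxE.
rewrite mulr_sumr; apply: eq_bigr => f _; rewrite !big_split /= !prodr_nat_bool.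
rewrite mulrC -mulrA; congr (_ * (_%:R * _)); congr nat_of_bool.
apply/forallP/forallP => h x; first by have := h (f x); rewrite codom_f orbF.
by case: (boolP (x \in codom f)) => [/codomP[y ->]|]; rewrite ?h ?orbT.
Qed.

Lemma commutes_tsym X a b :
  \sum_c M a c * tsym X c b = \sum_c tsym X a c * M c b.
Proof.
have s0 : (-1) ^+ d != 0 :> C by rewrite signr_eq0.
apply: (mulfI s0).
transitivity (\sum_(e : {ffun 'I_d -> bool}) (\prod_s (if e s then -1 else 1)) *
    (\sum_c M a c * tpow (\sum_s (e s)%:R *: X s) c b)).
  rewrite mulr_sumr; transitivity (\sum_c M a c * ((-1) ^+ d * tsym X c b)).
    by apply: eq_bigr => c _; ring.
  under eq_bigr => c _ do rewrite tsymE mulr_sumr.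
  rewrite exchange_big; apply: eq_bigr => e _; rewrite mulr_sumr.
  by apply: eq_bigr => c _; ring.
rewrite mulr_sumr; transitivity (\sum_c ((-1) ^+ d * tsym X a c) * M c b); last first.
  by apply: eq_bigr => c _; ring.
under [RHS]eq_bigr => c _ do rewrite tsymE mulr_suml.
rewrite exchange_big; apply: eq_bigr => e _; rewrite commutes_all mulr_sumr.
by apply: eq_bigr => c _; ring.
Qed.

(** [tsym] of the matrix units [delta_mx (b r) (k r)] is the sum of the matrix units of the tensor
    space over the orbit of [(b, k)]; this is its commutation with [M], entry by entry. *)
Lemma commutes_orbit (x y b k : I) :
  \sum_(s : 'S_d) M x [ffun r => b (s r)] * (y == [ffun r => k (s r)])%:R =
  \sum_(s : 'S_d) (x == [ffun r => b (s r)])%:R * M [ffun r => k (s r)] y.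
Proof.
have symE u v : tsym (fun r => delta_mx (b r) (k r)) u v =
    \sum_(s : 'S_d) (u == [ffun r => b (s r)])%:R * (v == [ffun r => k (s r)])%:R.
  apply: eq_bigr => s _; rewrite -natrM mulnb.
  transitivity (\prod_r (((u r == b (s r)) && (v r == k (s r)))%:R : C)).
    by apply: eq_bigr => r _; rewrite mxE.
  rewrite prodr_nat_bool; congr (nat_of_bool _)%:R; apply/forallP/andP => [h|[/eqP -> /eqP ->] r].
    by split; apply/eqP/ffunP => r; rewrite ffunE; have /andP[/eqP ? /eqP ?] := h r.
  by rewrite !ffunE !eqxx.
have := commutes_tsym (fun r => delta_mx (b r) (k r)) x y.
under eq_bigr => c _ do rewrite symE mulr_sumr.
rewrite exchange_big /= => E; transitivity (\sum_(s : 'S_d) \sum_c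
    M x c * ((c == [ffun r => b (s r)])%:R * (y == [ffun r => k (s r)])%:R)).
  apply: eq_bigr => s _; rewrite (bigD1 [ffun r => b (s r)]) //= eqxx mul1r big1 ?addr0 //.
  by move=> c /negPf ->; rewrite mul0r mulr0.
rewrite {}E; under eq_bigr => c _ do rewrite symE mulr_suml.
rewrite exchange_big /=; apply: eq_bigr => s _.
rewrite (bigD1 [ffun r => k (s r)]) //= eqxx mulr1 big1 ?addr0 //.
by move=> c /negPf ->; rewrite mulr0 mul0r.
Qed.

End TensorPower.

(** * First returns and partial traces *)

Section FirstReturn.
Variables (N : nat) (s : 'S_N) (S : {set 'I_N}).

(** Zero steps are allowed here, unlike in [first_return]. On an orbit inside [S] the search fails
    and the value carries no meaning. *)
Definition first_hit (x : 'I_N) : 'I_N :=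
  iter (find (fun k => iter k s x \notin S) (iota 0 N)) s x.

Lemma first_return_hit x : first_return s (fun z => z \notin S) x = first_hit (s x).
Proof.
rewrite /first_return /first_hit iterSr; congr (iter _ s (s x)).
by apply: eq_find => k /=; rewrite -iterSr.
Qed.

Lemma first_hit_eq k x : (k < N)%N -> iter k s x \notin S ->
  (forall j, (j < k)%N -> iter j s x \in S) -> first_hit x = iter k s x.
Proof.
move=> kN kS jS; rewrite /first_hit; congr (iter _ s x).
set A := fun k => _.
have hA : has A (iota 0 N) by apply/hasP; exists k; rewrite ?mem_iota.
have fN : (find A (iota 0 N) < N)%N by rewrite -[X in (_ < X)%N](size_iota 0) -has_find.
apply/eqP; rewrite eqn_leq; apply/andP; split; rewrite leqNgt; apply/negP => lt.
  by have := before_find 0%N lt; rewrite nth_iota // add0n /A kS.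
by have := nth_find 0%N hA; rewrite nth_iota // add0n /A jS.
Qed.

Lemma first_hit_notin x : x \notin S -> first_hit x = x.
Proof. by move=> xS; apply: (@first_hit_eq 0) => //; apply: leq_ltn_trans (ltn_ord x). Qed.

Lemma first_hitP x : ~~ (porbit s x \subset S) ->
  exists k, [/\ (k < N)%N, first_hit x = iter k s x, iter k s x \notin S &
    forall j, (j < k)%N -> iter j s x \in S].
Proof.
case/subsetPn => y; rewrite porbit_traject => /trajectP[k kx ->] kS.
have kN : (k < N)%N by apply: leq_trans kx _; rewrite -[X in (_ <= X)%N]card_ord max_card.
have [l lS lmin] := @ex_minnP (fun l => iter l s x \notin S) (ex_intro _ k kS).
have lk : (l < N)%N by apply: leq_ltn_trans (lmin k kS) kN.
have jS j : (j < l)%N -> iter j s x \in S.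
  by move=> jl; apply/negPn/negP => /lmin; rewrite leqNgt jl.
by exists l; split => //; exact: first_hit_eq.
Qed.

Lemma first_hit_step x : ~~ (porbit s x \subset S) -> x \in S -> first_hit (s x) = first_hit x.
Proof.
move=> /first_hitP[[|k] [kN -> kS jS] xS]; first by rewrite /= xS in kS.
rewrite iterSr; apply: first_hit_eq; first exact: ltnW.
  by rewrite -iterSr.
by move=> j jk; rewrite -iterSr jS.
Qed.

Variables (K : finType) (a b : 'I_N -> K).

(** [u r] is the row index at position [r]. At a traced-out position, one in [S], the column index
    equals it; elsewhere the two are [a r] and [b r]. The row index at [s r] has to be the column
    index at [r]. *)
Definition chained (u : {ffun 'I_N -> K}) : bool :=
  [forall r, if r \in S then u (s r) == u r else (u r == a r) && (u (s r) == b r)].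

Definition inner_cycles : {set {set 'I_N}} := [set c in porbits s | c \subset S].

Lemma chained_iter u k x : chained u -> (forall j, (j < k)%N -> iter j s x \in S) ->
  u (iter k s x) = u x.
Proof.
move=> /forallP cu; elim: k => // k IH jS.
by have := cu (iter k s x); rewrite jS //= => /eqP ->; apply: IH => j jk; apply/jS/ltnW.
Qed.

Lemma chained_hit u x : chained u -> ~~ (porbit s x \subset S) -> u x = a (first_hit x).
Proof.
move=> cu /first_hitP[k [_ -> kS jS]]; rewrite -(chained_iter cu jS).
by have /forallP/(_ (iter k s x)) := cu; rewrite (negPf kS) => /andP[/eqP].
Qed.

(* Outside the cycles contained in [S], [u x] is forced to be the value of [a] at the first
   point of the orbit of [x] that leaves [S]. *)
Lemma card_chained :
  #|[set u | chained u]| =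
  ([forall r, (r \notin S) ==> (a (first_return s (fun z => z \notin S) r) == b r)]
   * #|K| ^ #|inner_cycles|)%N.
Proof.
have orb_out r : r \notin S -> ~~ (porbit s r \subset S).
  by move=> rS; apply/subsetPn; exists r; rewrite ?porbit_id.
have orbS r : porbit s (s r) = porbit s r.
  by rewrite -[in LHS](expg1 s) porbit_perm.
set cond := [forall r, _]; have [/forallP condP|/forallPn[r]] := boolP cond; last first.
  rewrite negb_imply => /andP[rS ne]; rewrite mul0n; apply: eq_card0 => u; rewrite inE.
  apply/negP => cu; case/eqP: ne; rewrite first_return_hit -(chained_hit cu); last by rewrite orbS orb_out.
  by have /forallP/(_ r) := cu; rewrite (negPf rS) => /andP[_ /eqP].
rewrite mul1n; pose CT := {c : {set 'I_N} | c \in inner_cycles}.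
have <- : #|{ffun CT -> K}| = (#|K| ^ #|inner_cycles|)%N by rewrite card_ffun card_sig.
pose h (f : {ffun CT -> K}) : {ffun 'I_N -> K} :=
  [ffun x => if insub (porbit s x) is Some c then f c else a (first_hit x)].
have mem_inner x : (porbit s x \in inner_cycles) = (porbit s x \subset S).
  by rewrite inE; apply/andb_idl => _; apply: imset_f.
have rep (c : CT) : {x | porbit s x = val c}.
  have ex : exists x, porbit s x == val c.
    by have := valP c; rewrite inE => /andP[/imsetP[x _ ->] _]; exists x.
  by exists (xchoose ex); exact/eqP/(xchooseP ex).
have hin f x (i : porbit s x \in inner_cycles) : h f x = f (Sub (porbit s x) i).
  by rewrite ffunE insubT.
have hout f x : ~~ (porbit s x \subset S) -> h f x = a (first_hit x).
  by move=> o; rewrite ffunE insubN // mem_inner.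
have hinj : injective h.
  move=> f g /ffunP E; apply/ffunP => c; have [x xc] := rep c.
  have i : porbit s x \in inner_cycles by rewrite xc; exact: valP.
  have ci : Sub (porbit s x) i = c :> CT by apply: val_inj; rewrite SubK.
  by have := E x; rewrite !(hin _ _ i) ci.
rewrite -cardsT -(card_imset _ hinj); apply: eq_card => u; rewrite inE.
apply/idP/imsetP => [cu|[f _ ->]].
  exists [ffun c => u (sval (rep c))] => //; apply/ffunP => x.
  have [i|o] := boolP (porbit s x \in inner_cycles); last by rewrite mem_inner in o; rewrite hout ?chained_hit.
  rewrite (hin _ _ i) ffunE; case: (rep _) => y  /= yx.
  have /porbitP[k ->] : x \in porbit s y by rewrite yx porbit_id.
  rewrite permX (chained_iter cu) // => j _; rewrite mem_inner -yx in i.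
  by apply: (subsetP i); rewrite -permX mem_porbit.
apply/forallP => r; case: ifPn => rS.
  have [i|o] := boolP (porbit s r \in inner_cycles).
    by have := hin f (s r); rewrite orbS => ->; rewrite (hin _ _ i).
  by rewrite mem_inner in o; rewrite !hout ?orbS // first_hit_step.
rewrite !hout ?orbS ?orb_out // first_hit_notin // eqxx -first_return_hit.
by have := condP r; rewrite rS.
Qed.

End FirstReturn.

Lemma eq_first_return N (s : 'S_N) (A B : pred 'I_N) x :
  A =1 B -> first_return s A x = first_return s B x.
Proof.
move=> AB; rewrite /first_return; congr (iter _.+1 s x).
by apply: eq_find => k; rewrite AB.
Qed.

Lemma first_return_in N (s : 'S_N) (A : pred 'I_N) x : A x -> A (first_return s A x).
Proof.
move=> Ax; pose B k := A (iter k.+1 s x).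
have hB : has B (iota 0 N).
  apply/hasP; exists #|porbit s x|.-1; last first.
    by rewrite /B prednK ?iter_porbit // lt0n card_porbit_neq0.
  rewrite mem_iota add0n /= prednK ?lt0n ?card_porbit_neq0 //.
  by rewrite -[X in (_ <= X)%N]card_ord max_card.
have := nth_find 0%N hB; rewrite nth_iota ?add0n //.
by rewrite -[X in (_ < X)%N](size_iota 0) -has_find.
Qed.

Section LabelledChains.
Variables (N k l : nat) (s : 'S_N) (K : finType) (k0 : K).
Variables (lab : 'I_N -> 'I_l + 'I_k) (unl : 'I_l + 'I_k -> 'I_N).
Hypotheses (labK : cancel lab unl) (unlK : cancel unl lab).
Variables (a b : 'I_l -> K).

Definition chain_val (c : 'I_l -> K) (y : {ffun 'I_k -> K}) (r : 'I_N) : K :=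
  match lab r with inl i => c i | inr j => y j end.

Let S := [set x : 'I_N | if lab x is inr _ then true else false].

(** The labelling [lab] separates kept from traced-out positions abstractly, so one count serves
    both marginals with the two blocks exchanged. *)
Lemma sum_chains (pr : 'I_l -> 'I_l) :
  (forall i, unl (inl (pr i)) = first_return s (fun z => z \notin S) (unl (inl i))) ->
  (\sum_(y : {ffun 'I_k -> K}) [forall r, chain_val a y (s r) == chain_val b y r] =
   [forall i, a (pr i) == b i] * #|K| ^ #|inner_cycles s S|)%N.
Proof.
move=> prE; pose ext (c : 'I_l -> K) x := if lab x is inl i then c i else k0.
have -> : [forall i, a (pr i) == b i] = [forall r, (r \notin S) ==>
    (ext a (first_return s (fun z => z \notin S) r) == ext b r)].
  apply/forallP/forallP => h.
    move=> r; apply/implyP; rewrite inE /ext; case E : (lab r) => [i|//] _.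
    by rewrite -(labK r) E -prE unlK h.
  move=> i; have := h (unl (inl i)); rewrite -prE inE unlK /= /ext !unlK.
  by [].
rewrite -card_chained; pose h (y : {ffun 'I_k -> K}) := [ffun r => chain_val a y r].
have hinj : injective h.
  move=> y y' /ffunP E; apply/ffunP => j.
  by have := E (unl (inr j)); rewrite !ffunE /chain_val unlK.
transitivity (\sum_(y : {ffun 'I_k -> K} | [forall r, chain_val a y (s r) == chain_val b y r]) 1)%N.
  by rewrite [RHS]big_mkcond; apply: eq_bigr => y _; case: ifP.
rewrite sum1dep_card -(card_imset _ hinj); apply: eq_card => u; rewrite inE.
have hS y : (forall r, chain_val a y (s r) == chain_val b y r) <-> chained s S (ext a) (ext b) (h y).
  split=> [H|/forallP H r].
    apply/forallP => r; rewrite !ffunE (eqP (H r)) !inE /chain_val /ext.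
    by case: (lab r) => [i|j]; rewrite !eqxx.
  have := H r; rewrite !ffunE inE /chain_val /ext; case: (lab r) => [i|j] //.
  by case/andP.
apply/imsetP/idP => [[y + ->]|cu].
  by rewrite inE => /forallP/hS.
have uE : u = h [ffun j => u (unl (inr j))].
  apply/ffunP => r; rewrite !ffunE /chain_val; case E : (lab r) => [i|j].
    have /forallP/(_ r) := cu; rewrite inE E => /andP[/eqP -> _].
    by rewrite /ext E.
  by rewrite ffunE -E labK.
by exists [ffun j => u (unl (inr j))] => //; rewrite inE; apply/forallP/hS; rewrite -uE.
Qed.

End LabelledChains.

Section Marginals.
Variables (p q : nat) (s : 'S_(p + q)) (K : finType) (k0 : K).

Definition val1 (c : 'I_p -> K) (y : {ffun 'I_q -> K}) (r : 'I_(p + q)) : K :=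
  match fintype.split r with inl i => c i | inr j => y j end.

Definition val2 (c : 'I_q -> K) (x : {ffun 'I_p -> K}) (r : 'I_(p + q)) : K :=
  match fintype.split r with inl i => x i | inr j => c j end.

Lemma sum_chains1 (a b : 'I_p -> K) :
  (\sum_(y : {ffun 'I_q -> K}) [forall r, val1 a y (s r) == val1 b y r] =
   [forall i, a (pr1 s i) == b i] * #|K| ^ kappa1 s)%N.
Proof.
have := @sum_chains _ _ _ s K k0 _ _ (@splitK p q) (@unsplitK p q) a b (@pr1 p q s).
set S := [set x | _] => E.
have SE : S = [set x : 'I_(p + q) | (p <= x)%N].
  by apply/setP => x; rewrite !inE; case: fintype.splitP => [j|j] ->; have := ltn_ord j; lia.
rewrite SE in E; rewrite -[RHS]E //.
move=> i; apply: val_inj => /=.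
have AE : (fun z : 'I_(p + q) => (z < p)%N) =1 (fun z => z \notin [set x : 'I_(p + q) | (p <= x)%N]).
  by move=> z; rewrite inE -ltnNge.
(* The first return lies in the kept block, so [insubd] in [pr1] does not fall back on its
   default. *)
rewrite val_insubd -(eq_first_return s _ AE).
by rewrite (@first_return_in _ s (fun z : 'I_(p + q) => (z < p)%N)) //=; exact: ltn_ord.
Qed.

Lemma sum_chains2 (a b : 'I_q -> K) :
  (\sum_(y : {ffun 'I_p -> K}) [forall r, val2 a y (s r) == val2 b y r] =
   [forall i, a (pr2 s i) == b i] * #|K| ^ kappa2 s)%N.
Proof.
pose swap A B (x : A + B) : B + A := match x with inl u => inr u | inr v => inl v end.
have labK : cancel (fun x => swap _ _ (@fintype.split p q x)) (fun x => @unsplit p q (swap _ _ x)).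
  by move=> x /=; rewrite -{2}(splitK x); case: (fintype.split x).
have unlK : cancel (fun x => @unsplit p q (swap _ _ x)) (fun x => swap _ _ (@fintype.split p q x)).
  by move=> x; rewrite unsplitK; case: x.
have := @sum_chains _ _ _ s K k0 _ _ labK unlK a b (@pr2 p q s).
set S := [set x | _] => E.
have SE : S = [set x : 'I_(p + q) | (x < p)%N].
  by apply/setP => x; rewrite !inE; case: fintype.splitP.
rewrite SE in E; rewrite -[RHS]E.
  apply: eq_bigr => y _; congr nat_of_bool; apply: eq_forallb => r.
  by rewrite /chain_val /val2; case: (fintype.split (s r)) (fintype.split r) => [i|i] [j|j].
move=> i; apply: val_inj => /=.
have AE : (fun z : 'I_(p + q) => (p <= z)%N) =1 (fun z => z \notin [set x : 'I_(p + q) | (x < p)%N]).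
  by move=> z; rewrite inE -leqNgt.
rewrite val_insubd -(eq_first_return s _ AE).
set f := first_return _ _ _; have pf : (p <= f)%N.
  by apply: (@first_return_in _ s (fun z : 'I_(p + q) => (p <= z)%N)) => /=; rewrite leq_addr.
have fpq := ltn_ord f.
have -> : (f - p < q)%N by lia.
by rewrite subnKC.
Qed.

End Marginals.

Lemma mxvec_index_eq m n (i i' : 'I_m) (j j' : 'I_n) :
  (mxvec_index i j == mxvec_index i' j') = (i == i') && (j == j').
Proof.
by rewrite (inj_eq (@cast_ord_inj _ _ _)) (inj_eq enum_rank_inj) -pair_eqE.
Qed.

From mathcomp Require Import all_classical all_reals all_analysis.
From mathcomp Require Import complex.
Import Order.TTheory GRing.Theory Num.Theory numFieldNormedType.Exports.
Local Open Scope ring_scope.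

(** * The Weingarten function *)

Lemma chiV d (rho : {ffun 'I_d -> 'I_d.+1}) s : chi rho s^-1%g = chi rho s.
Proof. by rewrite !chi_pmuls /porbit_sizes porbitsV. Qed.

Lemma chiJ d (rho : {ffun 'I_d -> 'I_d.+1}) s g : chi rho (s ^ g)%g = chi rho s.
Proof. by apply: (@intr_inj algC); rewrite -!chi_cfE cfunJ ?inE. Qed.

Section Weingarten.
Variables (R : realType) (d N : nat).
Implicit Types (rho : {ffun 'I_d -> 'I_d.+1}) (s t : 'S_d).

Lemma CrhoE rho M : Crho R rho M = (content_prod rho M)%:~R.
Proof.
rewrite rmorph_prod; apply: eq_bigr => v _; rewrite rmorph_prod; apply: eq_bigr => j _.
by rewrite /= rmorphB rmorphD.
Qed.

Lemma WgJ M s g : Wg R M (s ^ g)%g = Wg R M s.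
Proof. by rewrite /Wg; congr (_ * _); apply: eq_bigr => rho _; rewrite chiJ. Qed.

Lemma WgV M s : Wg R M s^-1%g = Wg R M s.
Proof. by rewrite /Wg; congr (_ * _); apply: eq_bigr => rho _; rewrite chiV. Qed.

Definition Wg_conv s : R := \sum_t Wg R N.+1 (t * s^-1)%g * (fixcount N.+1 t)%:R.

Lemma sum_chi_fixcount_shift rho s : is_partition rho ->
  \sum_t (chi rho (t * s)%g)%:~R * (fixcount N.+1 t)%:R =
  Crho R rho N.+1 * (chi rho s)%:~R.
Proof.
move=> pr; rewrite CrhoE -rmorphM -chi_eigen // rmorph_sum.
by apply: eq_bigr => t _; rewrite rmorphM /= -pmulrn.
Qed.

(** Convolution with [fixcount] cancels the denominators. Over all partitions the sum would be the
    delta function at [1]; those with [Crho = 0] are missing. *)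
Lemma Wg_convE s :
  Wg_conv s = (d`!%:R)^-1 * \sum_(rho | is_partition rho && (Crho R rho N.+1 != 0))
    (chi rho 1%g)%:~R * (chi rho s)%:~R.
Proof.
rewrite /Wg_conv /Wg; under eq_bigr do rewrite -mulrA mulr_suml.
rewrite -mulr_sumr exchange_big; congr (_ * _); apply: eq_bigr => rho /andP[pr nz] /=.
transitivity ((chi rho 1%g)%:~R / Crho R rho N.+1 *
   \sum_t (chi rho (t * s^-1)%g)%:~R * (fixcount N.+1 t)%:R).
  rewrite mulr_sumr; apply: eq_bigr => t _; ring.
by rewrite sum_chi_fixcount_shift // chiV mulrA divfK.
Qed.

(** A further convolution with [fixcount] multiplies the term of [rho] by [Crho], so the missing
    terms would contribute zero and the full sum of [sum_chi_regular] can be used. *)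
Lemma Wg_conv_fixcount s :
  \sum_t (Wg_conv t - (t == 1%g)%:R) * (fixcount N.+1 (t^-1 * s)%g)%:R = 0.
Proof.
under eq_bigr do rewrite mulrBl; rewrite sumrB; apply/eqP; rewrite subr_eq0; apply/eqP.
have d0 : (d`!%:R != 0 :> R) by rewrite pnatr_eq0 -lt0n fact_gt0.
have shift rho : is_partition rho ->
    \sum_t (chi rho t)%:~R * (fixcount N.+1 (t^-1 * s)%g)%:R =
    Crho R rho N.+1 * (chi rho s)%:~R.
  move=> pr; rewrite -(chiV rho s) -sum_chi_fixcount_shift //.
  rewrite (reindex_inj (@invg_inj _)) /= (reindex_inj (mulIg s^-1%g)) /=.
  apply: eq_bigr => t _; rewrite chiV; congr (_ * (fixcount _ _)%:R).
  by rewrite invgK mulgKV.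
transitivity ((d`!%:R)^-1 * \sum_(rho : {ffun 'I_d -> 'I_d.+1} | is_partition rho)
   (chi rho 1%g)%:~R * (Crho R rho N.+1 * (chi rho s)%:~R) : R).
  under eq_bigr do rewrite Wg_convE -mulrA mulr_suml.
  rewrite -mulr_sumr exchange_big; congr (_ * _) => /=.
  rewrite big_mkcondr; apply: eq_bigr => rho pr; case: eqP => [->|_] /=.
    by rewrite mul0r mulr0.
  by rewrite -shift // mulr_sumr; apply: eq_bigr => t _; rewrite mulrA.
rewrite [RHS](bigD1 1%g) //= eqxx mul1r invg1 mul1g [X in _ = _ + X]big1 ?addr0; last first.
  by move=> t /negPf ->; rewrite mul0r.
transitivity ((d`!%:R)^-1 * \sum_t (fixcount N.+1 t)%:R * (d`! * (t * s == 1)%g)%:R : R).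
  congr (_ * _).
  under eq_bigr => rho pr do rewrite -(sum_chi_fixcount_shift s pr) mulr_sumr.
  rewrite exchange_big; apply: eq_bigr => t _ /=.
  have := congr1 (fun z : int => z%:~R : R) (sum_chi_regular (t * s)%g).
  rewrite rmorph_nat rmorph_sum /= => <-; rewrite mulr_sumr.
  by apply: eq_bigr => rho _; rewrite rmorphM /=; ring.
rewrite (bigD1 s^-1%g) //= mulVg eqxx muln1 big1 ?addr0 => [|t ts]; last first.
  by rewrite -eq_invg_mul (inv_eq invgK) (negPf ts) muln0 mulr0.
by rewrite fixcountV mulrC mulfK.
Qed.

End Weingarten.

(** * Resolution of the identity on tensors *)

Section TensorIdentity.
Variables (R : realType) (d N : nat).
Local Notation I := {ffun 'I_d -> 'I_N.+1}.

Definition fcomp (a : I) (s : 'S_d) : I := [ffun r => a (s r)].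

Lemma fcompM a s t : fcomp (fcomp a s) t = fcomp a (t * s)%g.
Proof. by apply/ffunP => r; rewrite !ffunE permM. Qed.

Lemma fcomp1 a : fcomp a 1%g = a.
Proof. by apply/ffunP => r; rewrite ffunE perm1. Qed.

Lemma fcomp_inj s : injective (fcomp^~ s).
Proof. by move=> a b /(congr1 (fcomp^~ s^-1%g)) /=; rewrite !fcompM mulVg !fcomp1. Qed.

Lemma fcomp_eqV a b s : (fcomp a s == b) = (a == fcomp b s^-1%g).
Proof. by rewrite -[RHS](inj_eq (@fcomp_inj s)) fcompM mulgV fcomp1. Qed.

Lemma fixcount_fcomp s : (fixcount N.+1 s)%:R = \sum_(a : I) ((fcomp a s == a)%:R : R).
Proof.
rewrite /fixcount -sum1dep_card big_mkcond natr_sum; apply: eq_bigr => a _.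
rewrite (_ : (fcomp a s == a) = [forall x, a (s x) == a x]); first by case: ifP.
by apply/eqP/forallP => [/ffunP h x|h]; [apply/eqP; rewrite -[RHS]h ffunE | apply/ffunP => x; rewrite ffunE (eqP (h x))].
Qed.

(* The squares of the entries of the difference of both sides add up to [0]. *)
Lemma Wg_resolution (a b : I) :
  \sum_s Wg_conv R N s * (fcomp a s == b)%:R = (a == b)%:R.
Proof.
pose c (s : 'S_d) := Wg_conv R N s - (s == 1%g)%:R.
pose A (a b : I) := \sum_(s : 'S_d) c s * (fcomp a s == b)%:R.
suff A0 : A a b = 0.
  move: A0; rewrite /A /c; under eq_bigr do rewrite mulrBl.
  rewrite sumrB => /eqP; rewrite subr_eq0 => /eqP ->.
  rewrite (bigD1 1%g) //= eqxx mul1r fcomp1 big1 ?addr0 // => s /negPf ->.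
  by rewrite mul0r.
have sq0 : \sum_(ab : I * I) A ab.1 ab.2 ^+ 2 = 0.
  (* Summing over all entries yields the quadratic form of the Gram matrix [fixcount (t^-1 * s)],
     which annihilates [c] by [Wg_conv_fixcount]. *)
  transitivity (\sum_s \sum_t c s * c t * (fixcount N.+1 (t^-1 * s)%g)%:R).
    transitivity (\sum_(ab : I * I) \sum_(s : 'S_d) \sum_(t : 'S_d) c s * c t *
        ((fcomp ab.1 s == ab.2) && (fcomp ab.1 t == ab.2))%:R).
      apply: eq_bigr => ab _.
      rewrite expr2 /A mulr_suml; apply: eq_bigr => s _; rewrite mulr_sumr.
      by apply: eq_bigr => t _; rewrite -mulnb natrM mulrACA.
    rewrite exchange_big /=; apply: eq_bigr => s _.
    rewrite exchange_big /=; apply: eq_bigr => t _.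
    rewrite -(pair_bigA _ (fun a b : I => c s * c t * ((fcomp a s == b) && (fcomp a t == b))%:R)) /=.
    rewrite fixcount_fcomp mulr_sumr; apply: eq_bigr => a' _.
    rewrite (bigD1 (fcomp a' s)) //= eqxx /= big1 ?addr0 => [|b' ne]; last first.
      by rewrite eq_sym (negPf ne) mulr0.
    congr (_ * _%:R); congr nat_of_bool.
    by rewrite -(inj_eq (@fcomp_inj t^-1%g)) !fcompM mulVg fcomp1 eq_sym.
  rewrite big1 // => s _; rewrite -[RHS](mulr0 (c s)) -[in RHS](Wg_conv_fixcount R N s).
  by rewrite mulr_sumr; apply: eq_bigr => t _; rewrite mulrA.
have /eqP := sq0; rewrite psumr_eq0 => [|ab _]; last exact: sqr_ge0.
by move=> /allP/(_ (a, b) (mem_index_enum _)); rewrite sqrf_eq0 => /eqP.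
Qed.

End TensorIdentity.

Local Open Scope complex_scope.

Section Expansion.
Variables (R : realType) (d N : nat).
Local Notation I := {ffun 'I_d -> 'I_N.+1}.
Variable M : I -> I -> R[i].
Hypothesis cU : forall A : 'M[R[i]]_N.+1, A \is unitarymx -> commutes M A.

Lemma commutes_fcomp (x y b k : I) :
  \sum_(s : 'S_d) M x (fcomp b s) * (y == fcomp k s)%:R =
  \sum_(s : 'S_d) (x == fcomp b s)%:R * M (fcomp k s) y.
Proof. exact: (commutes_orbit cU). Qed.

(* Since the Weingarten convolution resolves the identity, [M a b] is a sum over [k] of matrix
   elements of [M] times an operator invariant under permutations, which commutes with [M]. *)
Lemma weingarten_expansion (a b : I) :
  M a b = \sum_(s : 'S_d) \sum_(t : 'S_d) (Wg R N.+1 (s^-1 * t)%g)%:C *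
    (fcomp a s == b)%:R * \sum_k M (fcomp k t^-1%g) k.
Proof.
pose W (s : 'S_d) : R[i] := (Wg R N.+1 s)%:C.
have WJ s g : W (s ^ g)%g = W s by rewrite /W WgJ.
have WV s : W s^-1%g = W s by rewrite /W WgV.
transitivity (\sum_(k : I) \sum_(nu : 'S_d) W nu^-1%g *
    \sum_(s : 'S_d) M a (fcomp b s) * (k == fcomp (fcomp k nu) s)%:R).
  transitivity (\sum_z M a z * (\sum_(s : 'S_d) Wg_conv R N s * (fcomp z s == b)%:R)%:C).
    transitivity (\sum_z M a z * (z == b)%:R).
      rewrite (bigD1 b) //= eqxx mulr1 big1 ?addr0 // => z /negPf ->.
      by rewrite mulr0.
    apply: eq_bigr => z _; congr (_ * _).
    by have := congr1 (real_complex R) (Wg_resolution R z b); rewrite rmorph_nat => <-.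
  transitivity (\sum_(s : 'S_d) M a (fcomp b s^-1%g) * (Wg_conv R N s)%:C).
    transitivity (\sum_z \sum_(s : 'S_d) M a z * ((Wg_conv R N s)%:C * (fcomp z s == b)%:R)).
      apply: eq_bigr => z _; rewrite rmorph_sum mulr_sumr; apply: eq_bigr => s _.
      by rewrite rmorphM rmorph_nat.
    rewrite exchange_big; apply: eq_bigr => s _ /=.
    rewrite (bigD1 (fcomp b s^-1%g)) //= big1 ?addr0 => [|z zb]; rewrite fcomp_eqV.
      by rewrite eqxx mulr1.
    by rewrite (negPf zb) !mulr0.
  rewrite (reindex_inj (@invg_inj _)) /=.
  transitivity (\sum_(s : 'S_d) \sum_(nu : 'S_d) \sum_(k : I)
     W nu^-1%g * (M a (fcomp b s) * (k == fcomp (fcomp k nu) s)%:R)).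
    apply: eq_bigr => s _; rewrite invgK /Wg_conv rmorph_sum mulr_sumr.
    rewrite (reindex_inj (@invg_inj _)) /= (reindex_inj (mulgI s)) /=.
    apply: eq_bigr => nu _.
    rewrite rmorphM fixcountV fixcount_fcomp rmorph_sum !mulr_sumr; apply: eq_bigr => k _.
    by rewrite rmorph_nat invgK invMg mulgKV -/(W _) fcompM eq_sym mulrCA.
  rewrite exchange_big [RHS]exchange_big; apply: eq_bigr => nu _ /=.
  rewrite exchange_big; apply: eq_bigr => k _ /=.
  by rewrite mulr_sumr.
transitivity (\sum_(k : I) \sum_(nu : 'S_d) W nu^-1%g *
    \sum_(s : 'S_d) (a == fcomp b s)%:R * M (fcomp (fcomp k nu) s) k).
  by apply: eq_bigr => k _; apply: eq_bigr => nu _; rewrite commutes_fcomp.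
transitivity (\sum_(s : 'S_d) \sum_(nu : 'S_d) \sum_(k : I) W nu^-1%g *
    ((a == fcomp b s)%:R * M (fcomp (fcomp k nu) s) k)).
  rewrite exchange_big [RHS]exchange_big; apply: eq_bigr => nu _ /=.
  rewrite [RHS]exchange_big; apply: eq_bigr => k _ /=.
  by rewrite mulr_sumr.
(* After the changes of variables the two arguments of [Wg] are conjugate by [s], and [Wg] is a
   class function. *)
rewrite [RHS](reindex_inj (@invg_inj _)) /=; apply: eq_bigr => s _.
rewrite [RHS](reindex_inj (@invg_inj _)) [RHS](reindex_inj (mulgI s)) /=.
apply: eq_bigr => nu _; rewrite mulr_sumr; apply: eq_bigr => k _.
rewrite !invgK invMg fcompM fcomp_eqV invgK -/(W _) mulrA; congr (_ * _ * _).
by rewrite -[RHS](WJ _ s) conjgE !mulgA mulVg mul1g mulgKV.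
Qed.

End Expansion.

(** * Haar integration *)

Section ComplexClass.
Variables (R : realType) (X : Type).
Local Notation Re := (@complex.Re R).
Local Notation Im := (@complex.Im R).

(* A class of real functions closed under the ring operations, and the complex functions
   with both coordinates in it: applied to measurable, bounded and continuous functions. *)
Record ring_class (Q : (X -> R) -> Prop) : Prop := RingClass {
  ring_class_cst : forall c, Q (fun=> c);
  ring_classD : forall f g, Q f -> Q g -> Q (fun x => f x + g x);
  ring_classM : forall f g, Q f -> Q g -> Q (fun x => f x * g x) }.

Definition cclass (Q : (X -> R) -> Prop) (f : X -> R[i]) : Prop :=
  Q (fun x => Re (f x)) /\ Q (fun x => Im (f x)).

Variables (Q : (X -> R) -> Prop) (rQ : ring_class Q).
Local Notation cQ := (cclass Q).

Lemma eq_cclass (f g : X -> R[i]) : f =1 g -> cQ f -> cQ g.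
Proof. by move=> /funext ->. Qed.

Lemma ring_classN f : Q f -> Q (fun x => - f x).
Proof.
move=> Qf; have := ring_classM rQ (ring_class_cst rQ (-1)) Qf.
by congr Q; apply/funext => x; rewrite mulN1r.
Qed.

Lemma cclass_cst c : cQ (fun=> c).
Proof. by split; exact: ring_class_cst. Qed.

Lemma cclassD f g : cQ f -> cQ g -> cQ (fun x => f x + g x).
Proof.
move=> [f1 f2] [g1 g2]; split.
  by have := ring_classD rQ f1 g1; congr Q; apply/funext => x; case: (f x) (g x) => ? ? [].
by have := ring_classD rQ f2 g2; congr Q; apply/funext => x; case: (f x) (g x) => ? ? [].
Qed.

Lemma cclassM f g : cQ f -> cQ g -> cQ (fun x => f x * g x).
Proof.
move=> [f1 f2] [g1 g2]; split.
  have := ring_classD rQ (ring_classM rQ f1 g1) (ring_classN (ring_classM rQ f2 g2)).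
  by congr Q; apply/funext => x; case: (f x) (g x) => ? ? [].
have := ring_classD rQ (ring_classM rQ f1 g2) (ring_classM rQ f2 g1).
by congr Q; apply/funext => x; case: (f x) (g x) => ? ? [].
Qed.

Lemma cclass_conj f : cQ f -> cQ (fun x => Complex (Re (f x)) (- Im (f x))).
Proof. by move=> [f1 f2]; split => //=; exact: ring_classN. Qed.

Lemma cclass_sum (J : finType) (f : J -> X -> R[i]) :
  (forall j, cQ (f j)) -> cQ (fun x => \sum_j f j x).
Proof.
move=> fQ; elim: (index_enum J) => [|j s IH].
  by apply: eq_cclass (cclass_cst 0) => x; rewrite big_nil.
by apply: eq_cclass (cclassD (fQ j) IH) => x; rewrite big_cons.
Qed.

Lemma cclass_prod (J : finType) (f : J -> X -> R[i]) :
  (forall j, cQ (f j)) -> cQ (fun x => \prod_j f j x).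
Proof.
move=> fQ; elim: (index_enum J) => [|j s IH].
  by apply: eq_cclass (cclass_cst 1) => x; rewrite big_nil.
by apply: eq_cclass (cclassM (fQ j) IH) => x; rewrite big_cons.
Qed.

Lemma cclass_mulmx m n p (A : X -> 'M[R[i]]_(m, n)) (B : X -> 'M[R[i]]_(n, p)) :
  (forall i j, cQ (fun x => A x i j)) -> (forall i j, cQ (fun x => B x i j)) ->
  forall i j, cQ (fun x => (A x *m B x) i j).
Proof.
move=> AQ BQ i j.
have := cclass_sum (fun k => cclassM (AQ i k) (BQ k j)).
by apply: eq_cclass => x; rewrite mxE.
Qed.

Lemma cclass_conjT m n (A : X -> 'M[R[i]]_(m, n)) :
  (forall i j, cQ (fun x => A x i j)) -> forall i j, cQ (fun x => conjT (A x) i j).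
Proof. by move=> AQ i j; apply: eq_cclass (cclass_conj (AQ j i)) => x; rewrite !mxE. Qed.

End ComplexClass.

Section RandomMatrix.
Variables (R : realType) (N d : nat) (lam : 'I_N -> R).
Local Notation I := {ffun 'I_d -> 'I_N}.

Definition rotated (A : 'M[R[i]]_N) : 'M[R[i]]_N :=
  A *m diag_mx (\row_x (lam x)%:C) *m conjT A.

Lemma cclass_rotated (X : Type) (Q : (X -> R) -> Prop) (A : X -> 'M[R[i]]_N) :
  ring_class Q -> (forall i j, cclass Q (fun x => A x i j)) ->
  forall i j, cclass Q (fun x => rotated (A x) i j).
Proof.
move=> rQ AQ; apply: (cclass_mulmx rQ); last exact: (cclass_conjT rQ).
apply: (cclass_mulmx rQ) => // i j; exact: (cclass_cst rQ).
Qed.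

Lemma conjTE m n (A : 'M[R[i]]_(m, n)) : conjT A = (A ^t*)%sesqui.
Proof. by apply/matrixP => i j; rewrite !mxE; case: (A j i). Qed.

Lemma conjTM m n p (A : 'M[R[i]]_(m, n)) (B : 'M[R[i]]_(n, p)) :
  conjT (A *m B) = conjT B *m conjT A.
Proof. by rewrite !conjTE trmx_mul map_mxM. Qed.

Lemma rotatedM V A : rotated (V *m A) = V *m rotated A *m conjT V.
Proof. by rewrite /rotated conjTM !mulmxA. Qed.

Lemma unitary_unitarymx (A : 'M[R[i]]_N) : unitary A <-> A \is unitarymx.
Proof. by rewrite /unitary conjTE; split => [/unitarymxP|/unitarymxP]. Qed.

Lemma unitaryM (A B : 'M[R[i]]_N) : unitary A -> unitary B -> unitary (A *m B).
Proof. by move=> /unitary_unitarymx a /unitary_unitarymx b; apply/unitary_unitarymx/mul_unitarymx. Qed.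

Lemma unitaryK (A : 'M[R[i]]_N) : unitary A -> conjT A *m A = 1%:M.
Proof. exact: mulmx1C. Qed.

Lemma unitary_bound (A : 'M[R[i]]_N) i j : unitary A ->
  `|complex.Re (A i j)| <= 1 /\ `|complex.Im (A i j)| <= 1.
Proof.
move=> /(congr1 (fun B : 'M[R[i]]_N => complex.Re (B i i))).
rewrite !mxE eqxx /= raddf_sum /=.
have E k : complex.Re (A i k * conjT A k i) = complex.Re (A i k) ^+ 2 + complex.Im (A i k) ^+ 2.
  by rewrite !mxE; case: (A i k) => a b /=; rewrite !expr2; ring.
under eq_bigr do rewrite E.
rewrite (bigD1 j) //= => h.
have ge0 : 0 <= \sum_(k | k != j) (complex.Re (A i k) ^+ 2 + complex.Im (A i k) ^+ 2).
  by apply: sumr_ge0 => k _; rewrite addr_ge0 ?sqr_ge0.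
have := sqr_ge0 (complex.Re (A i j)); have := sqr_ge0 (complex.Im (A i j)).
move: (complex.Re _) (complex.Im _) h ge0 => a b.
by split; rewrite -(@ler_pXn2r _ 2) ?nnegrE // expr1n -normrX ger0_norm ?sqr_ge0 //; lra.
Qed.

End RandomMatrix.

Section Clamp.
Variable R : realType.

(* Haar invariance is only available for bounded continuous functions, so the entries are
   replaced by their projections to [[-1, 1]], which does not change unitary matrices. *)
Definition clamp (x : R) : R := 2^-1 * (`|x + 1| - `|x - 1|).

Lemma clamp_id x : `|x| <= 1 -> clamp x = x.
Proof.
rewrite ler_norml => /andP[h1 h2]; rewrite /clamp ger0_norm ?ler0_norm; [|lra..].
by field.
Qed.

Lemma clamp_bounded x : `|clamp x| <= 1.
Proof.
rewrite /clamp normrM ger0_norm ?invr_ge0 // -(ler_pM2l (ltr0Sn R 1)) mulVKf ?pnatr_eq0 // mulr1.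
by apply: le_trans (ler_dist_dist _ _) _; rewrite (_ : _ - _ = 2) ?ger0_norm //; ring.
Qed.

Definition bounded_function (X : Type) (f : X -> R) : Prop := exists B, forall x, `|f x| <= B.

Lemma bounded_ring_class X : ring_class (@bounded_function X).
Proof.
split=> [c|f g [B hB] [B' hB']|f g [B hB] [B' hB']]; first by exists `|c|.
  by exists (B + B') => x; apply: le_trans (ler_normD _ _) (lerD (hB x) (hB' x)).
by exists (B * B') => x; rewrite normrM ler_pM.
Qed.

Lemma continuous_ring_class (X : topologicalType) :
  ring_class (fun f : X -> R => continuous f).
Proof.
split=> [c|f g cf cg|f g cf cg] x; first exact: cst_continuous.
  by apply: continuousD; [exact: cf | exact: cg].
by apply: continuousM; [exact: cf | exact: cg].
Qed.

Lemma measurable_ring_class d (X : measurableType d) :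
  ring_class (fun f : X -> R => measurable_fun setT f).
Proof.
split=> [c|f g cf cg|f g cf cg]; first exact: measurable_cst.
  exact: measurable_realfun.measurable_funD.
exact: measurable_realfun.measurable_funM.
Qed.

Lemma ring_classI X (Q Q' : (X -> R) -> Prop) : ring_class Q -> ring_class Q' ->
  ring_class (fun f => Q f /\ Q' f).
Proof.
move=> [c D M] [c' D' M']; split=> [k|f g [? ?] [? ?]|f g [? ?] [? ?]].
- by split; [exact: c|exact: c'].
- by split; [exact: D|exact: D'].
- by split; [exact: M|exact: M'].
Qed.

Lemma clamp_continuous (X : topologicalType) (f : X -> R) :
  continuous f -> continuous (fun x => clamp (f x)).
Proof.
move=> cf; have [c D M] := @continuous_ring_class X.
have cN (g : X -> R) : continuous g -> continuous (fun x => `|g x|).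
  by move=> cg x; apply: (continuous_comp (cg x)); exact: norm_continuous.
apply: M => //; apply: (D) => //; first by apply: cN; exact: D.
apply: (ring_classN (@continuous_ring_class X)); apply: cN; exact: D.
Qed.

Lemma clamp_measurable d (X : measurableType d) (f : X -> R) :
  measurable_fun setT f -> measurable_fun setT (fun x => clamp (f x)).
Proof.
move=> cf; have [c D M] := @measurable_ring_class d X.
have cN (g : X -> R) : measurable_fun setT g -> measurable_fun setT (fun x => `|g x|).
  by move=> mg; apply: (measurableT_comp _ mg); exact: measurable_realfun.normr_measurable.
apply: M => //; apply: (D) => //; first by apply: cN; exact: D.
apply: (ring_classN (@measurable_ring_class d X)); apply: cN; exact: D.
Qed.

Variable N : nat.

Definition clamp_mx (x : 'M[R]_(N, N + N)) : 'M[R[i]]_N :=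
  \matrix_(i, j) Complex (clamp (x i (lshift N j))) (clamp (x i (rshift N j))).

Lemma clamp_mx_unitary (A : 'M[R[i]]_N) : unitary A -> clamp_mx (reim A) = A.
Proof.
move=> uA; apply/matrixP => i j; rewrite [LHS]mxE /reim row_mxEl row_mxEr !mxE.
by have [h1 h2] := unitary_bound i j uA; rewrite !clamp_id //; case: (A i j).
Qed.

End Clamp.

Section Expectation.
Variables (R : realType) (d : measure_display) (T : measurableType d) (P : probability T R).

Definition bounded_measurable (f : T -> R) : Prop :=
  measurable_fun setT f /\ bounded_function f.

Lemma bm_ring_class : ring_class bounded_measurable.
Proof. exact: ring_classI (@measurable_ring_class _ _ _) (@bounded_ring_class _ _). Qed.

Lemma bm_integrable f : bounded_measurable f -> P.-integrable setT (EFin \o f).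
Proof.
move=> [mf [B hB]]; apply: measurable_bounded_integrable => //.
  by rewrite [X in (X < _)%E]probability_setT ltry.
by exists B; split; rewrite ?num_real // => M BM x _; exact: le_trans (hB x) (ltW BM).
Qed.

Lemma cexpect_cst c : cexpect P (fun=> c) = c.
Proof. by rewrite /cexpect !Rintegral_cst // [X in fine X]probability_setT !mulr1; case: c. Qed.

Lemma cexpectD f g : cclass bounded_measurable f -> cclass bounded_measurable g ->
  cexpect P (fun t => f t + g t) = cexpect P f + cexpect P g.
Proof.
move=> [f1 f2] [g1 g2].
have -> : cexpect P f + cexpect P g =
  Complex (Rintegral P setT (fun t => complex.Re (f t)) + Rintegral P setT (fun t => complex.Re (g t)))
   (Rintegral P setT (fun t => complex.Im (f t)) + Rintegral P setT (fun t => complex.Im (g t))) by [].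
rewrite -!RintegralD //; try exact: bm_integrable.
by congr Complex; apply: eq_Rintegral => t _; case: (f t) (g t) => ? ? [].
Qed.

Lemma cexpectZ c f : cclass bounded_measurable f ->
  cexpect P (fun t => c * f t) = c * cexpect P f.
Proof.
move=> [f1 f2]; case: c => a b.
have -> : Complex a b * cexpect P f = Complex
   (a * Rintegral P setT (fun t => complex.Re (f t)) - b * Rintegral P setT (fun t => complex.Im (f t)))
   (a * Rintegral P setT (fun t => complex.Im (f t)) + b * Rintegral P setT (fun t => complex.Re (f t))) by [].
have rb := bm_ring_class.
have Z x (g : T -> R) : bounded_measurable g -> bounded_measurable (fun t => x * g t).
  by move=> bg; apply: (ring_classM rb) => //; exact: ring_class_cst.
rewrite -!RintegralZl //; try exact: bm_integrable.
rewrite -RintegralB //; try by apply: bm_integrable; exact: Z.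
rewrite -RintegralD //; try by apply: bm_integrable; exact: Z.
by congr Complex; apply: eq_Rintegral => t _; case: (f t).
Qed.

Lemma eq_cexpect f g : f =1 g -> cexpect P f = cexpect P g.
Proof. by move=> /funext ->. Qed.

Lemma cexpect_sum (J : finType) (f : J -> T -> R[i]) :
  (forall j, cclass bounded_measurable (f j)) ->
  cexpect P (fun t => \sum_j f j t) = \sum_j cexpect P (f j).
Proof.
move=> bf; elim: (index_enum J) => [|j s IH].
  by rewrite big_nil -[RHS]cexpect_cst; apply: eq_cexpect => t; rewrite big_nil.
rewrite big_cons -IH -cexpectD //; first by apply: eq_cexpect => t; rewrite big_cons.
elim: s {IH} => [|k s IH].
  apply: eq_cclass (cclass_cst bm_ring_class 0) => t; by rewrite big_nil.
by apply: eq_cclass (cclassD bm_ring_class (bf k) IH) => t; rewrite big_cons.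
Qed.

Lemma ae_Rintegral (f g : T -> R) : measurable_fun setT f -> measurable_fun setT g ->
  {ae P, forall t, f t = g t} -> Rintegral P setT f = Rintegral P setT g.
Proof.
move=> mf mg fg; congr fine; apply: ae_eq_integral => //.
- exact/measurable_realfun.measurable_EFinP.
- exact/measurable_realfun.measurable_EFinP.
- by apply: filterS fg => t -> _.
Qed.

Lemma ae_cexpect (f g : T -> R[i]) :
  cclass (fun h : T -> R => measurable_fun setT h) f ->
  cclass (fun h : T -> R => measurable_fun setT h) g ->
  {ae P, forall t, f t = g t} -> cexpect P f = cexpect P g.
Proof.
move=> [f1 f2] [g1 g2] fg; congr Complex; apply: ae_Rintegral => //;
  by apply: filterS fg => t ->.
Qed.

End Expectation.

(** Expanding the product over cycles chooses one index per cycle, that is, a function constant on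
    cycles. *)
Lemma TrPermE (R : realType) N d (s : 'S_d) (lam : 'I_N -> R) :
  TrPerm s lam =
  \sum_(f : {ffun 'I_d -> 'I_N} | [forall x, f (s x) == f x]) \prod_x lam (f x).
Proof.
rewrite (big_perm_invariant s +%R) /TrPerm.
rewrite [LHS]big_enum_val /=.
rewrite bigA_distr_bigA; apply: eq_bigr => f _.
rewrite [RHS](partition_big (porb_idx s) xpredT) //=; apply: eq_bigr => i _.
rewrite -prodr_const; apply: eq_big => x; last first.
  move=> xi; rewrite ffunE; congr (lam (f _)); apply/esym/eqP.
  by rewrite -(porb_repK i) porb_idx_eq eq_porbit_mem porb_repE.
by rewrite -[X in _ == X](porb_repK i) porb_idx_eq eq_porbit_mem porb_repE.
Qed.

Lemma TrPermV (R : realType) N d (s : 'S_d) (lam : 'I_N -> R) :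
  TrPerm s^-1%g lam = TrPerm s lam.
Proof. by rewrite /TrPerm porbitsV. Qed.

(** * Tensor moments of the random matrix *)

Section TensorMoments.
Variables (R : realType) (N d : nat) (lam : 'I_N.+1 -> R).
Local Notation I := {ffun 'I_d -> 'I_N.+1}.
Local Notation C := (R[i]).

Lemma tpow_fcomp (A : 'M[C]_N.+1) (a b : I) (s : 'S_d) :
  tpow A (fcomp a s) (fcomp b s) = tpow A a b.
Proof.
rewrite /tpow [RHS](reindex_inj (@perm_inj _ s)).
by apply: eq_bigr => r _; rewrite !ffunE.
Qed.

Lemma tpow1 (a b : I) : tpow (1%:M : 'M[C]_N.+1) a b = (a == b)%:R.
Proof. by rewrite -diag_const_mx tpow_diag big1 ?mulr1 // => r _; rewrite mxE. Qed.

(** Permutations commute with tensor powers, so cyclicity of the trace brings [conjT A] next to [A]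
    and the two cancel. *)
Lemma tpow_trace (A : 'M[C]_N.+1) (s : 'S_d) : unitary A ->
  \sum_k tpow (rotated lam A) (fcomp k s) k = (TrPerm s lam)%:C.
Proof.
move=> uA; pose D := diag_mx (\row_x (lam x)%:C).
transitivity (\sum_(c : I) \sum_(e : I) tpow D c e *
    \sum_k tpow (conjT A) e k * tpow A k (fcomp c s^-1%g)).
  transitivity (\sum_k \sum_(c : I) \sum_(e : I)
    tpow D c e * (tpow (conjT A) e k * tpow A k (fcomp c s^-1%g))).
    apply: eq_bigr => k _; rewrite /rotated tpowM exchange_big /=.
    transitivity (\sum_e \sum_c tpow A (fcomp k s) c * tpow D c e * tpow (conjT A) e k).
      by apply: eq_bigr => e _; rewrite tpowM mulr_suml.
    apply: eq_bigr => e _; apply: eq_bigr => c _.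
    rewrite -(tpow_fcomp _ k _ s) fcompM mulgV fcomp1; ring.
  rewrite exchange_big; apply: eq_bigr => c _ /=.
  by rewrite exchange_big; apply: eq_bigr => e _ /=; rewrite mulr_sumr.
rewrite TrPermE rmorph_sum [RHS]big_mkcond; apply: eq_bigr => c _ /=.
rewrite (bigD1 c) //= [X in _ + X]big1 ?addr0 => [|e /negPf ec]; last first.
  by rewrite tpow_diag eq_sym ec !mul0r.
rewrite -tpowM unitaryK // tpow1 tpow_diag eqxx mul1r.
have -> : (c == fcomp c s^-1%g) = [forall x, c (s x) == c x].
  rewrite -fcomp_eqV; apply/eqP/forallP => [E x|E].
    by have := congr1 (fun f : I => f x) E; rewrite /= ffunE => ->.
  by apply/ffunP => x; rewrite ffunE (eqP (E x)).
case: ifP => _; rewrite ?mulr0 // mulr1 rmorph_prod.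
by apply: eq_bigr => r _; rewrite mxE.
Qed.

Variables (dsp : measure_display) (T : measurableType dsp) (P : probability T R).
Variables (U : T -> 'M[C]_N.+1) (HU : haar_unitary P U).
Let W t := clamp_mx (reim (U t)).

Lemma clamped_bm (A : T -> 'M[C]_N.+1) :
  (forall i j, cclass (fun f : T -> R => measurable_fun setT f) (fun t => A t i j)) ->
  forall i j, cclass (@bounded_measurable R _ T) (fun t => clamp_mx (reim (A t)) i j).
Proof.
move=> mA i j; have [m1 m2] := mA i j; split.
  split; last by exists 1 => t; rewrite mxE; exact: clamp_bounded.
  by apply: eq_measurable_fun (clamp_measurable m1) => t _; rewrite mxE /= /reim row_mxEl mxE.
split; last by exists 1 => t; rewrite mxE; exact: clamp_bounded.
by apply: eq_measurable_fun (clamp_measurable m2) => t _; rewrite mxE /= /reim row_mxEr mxE.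
Qed.

Lemma haar_measurable i j :
  cclass (fun f : T -> R => measurable_fun setT f) (fun t => U t i j).
Proof. by have [mU _ _] := HU; exact: mU. Qed.

Lemma W_bm i j : cclass (@bounded_measurable R _ T) (fun t => W t i j).
Proof. exact: clamped_bm haar_measurable i j. Qed.

Lemma bm_measurable (f : T -> C) : cclass (@bounded_measurable R _ T) f ->
  cclass (fun f : T -> R => measurable_fun setT f) f.
Proof. by move=> [[? _] [? _]]. Qed.

Lemma W_ae : {ae P, forall t, unitary (U t) /\ W t = U t}.
Proof.
have [_ uU _] := HU; apply: filterS uU => t uUt.
by rewrite /W clamp_mx_unitary.
Qed.

Lemma cclass_tpow (X : Type) (Q : (X -> R) -> Prop) (A : X -> 'M[C]_N.+1) (a b : I) :
  ring_class Q -> (forall i j, cclass Q (fun x => A x i j)) ->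
  cclass Q (fun x => tpow (rotated lam (A x)) a b).
Proof.
move=> rQ AQ; apply: (cclass_prod rQ) => r; exact: cclass_rotated.
Qed.

(** The test function [F] clamps its argument in order to be bounded on all matrices. Almost surely
    [V *m U t] is unitary, so clamping leaves it unchanged. *)
Lemma haar_left_invariance (V : 'M[C]_N.+1) (a b : I) : unitary V ->
  cexpect P (fun t => tpow (rotated lam (W t)) a b) =
  cexpect P (fun t => tpow (rotated lam (V *m W t)) a b).
Proof.
move=> uV; have [mU uU inv] := HU.
pose F (x : 'M[R]_(N.+1, N.+1 + N.+1)) := tpow (rotated lam (clamp_mx x)) a b.
have cF : cclass (fun f : 'M[R]_(N.+1, N.+1 + N.+1) -> R => continuous f) F.
  apply: cclass_tpow; first exact: continuous_ring_class.
  move=> i j; split.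
    rewrite (_ : (fun x => _) = (fun x : 'M[R]_(N.+1, N.+1 + N.+1) => clamp (x i (lshift N.+1 j)))).
      exact: (clamp_continuous (@coord_continuous R _ _ i (lshift N.+1 j))).
    by apply/funext => x; rewrite mxE.
  rewrite (_ : (fun x => _) = (fun x : 'M[R]_(N.+1, N.+1 + N.+1) => clamp (x i (rshift N.+1 j)))).
    exact: (clamp_continuous (@coord_continuous R _ _ i (rshift N.+1 j))).
  by apply/funext => x; rewrite mxE.
have bF : cclass (@bounded_function R _) F.
  apply: cclass_tpow; first exact: bounded_ring_class.
  by move=> i j; split; exists 1 => x; rewrite mxE; exact: clamp_bounded.
rewrite -[LHS]/(cexpect P (fun t => F (reim (U t)))).
have -> : cexpect P (fun t => F (reim (U t))) = cexpect P (fun t => F (reim (V *m U t))).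
  move: F cF bF => F [cF1 cF2] [bF1 bF2].
  have e1 := inv V uV (fun x => complex.Re (F x)) cF1 bF1.
  have e2 := inv V uV (fun x => complex.Im (F x)) cF2 bF2.
  by rewrite /cexpect e1 e2.
apply: ae_cexpect.
- apply: cclass_tpow; first exact: measurable_ring_class.
  move=> i j; apply: bm_measurable; apply: clamped_bm => {}i {}j.
  by apply: (cclass_mulmx (@measurable_ring_class _ _ _)).
- apply: cclass_tpow; first exact: measurable_ring_class.
  apply: (cclass_mulmx (@measurable_ring_class _ _ _)) => // k l.
  by apply: bm_measurable; exact: W_bm.
apply: filterS W_ae => t [uUt ->].
by rewrite /F clamp_mx_unitary //; exact: unitaryM.
Qed.

Definition haar_moment (a b : I) : C := cexpect P (fun t => tpow (rotated lam (W t)) a b).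

Lemma tpow_bm (a b : I) : cclass (@bounded_measurable R _ T) (fun t => tpow (rotated lam (W t)) a b).
Proof. apply: cclass_tpow; [exact: bm_ring_class | exact: W_bm]. Qed.

(** Invariance says that conjugation by the tensor power of [V] fixes the moment; multiplying by
    that power on the right removes the one of [conjT V]. *)
Lemma haar_moment_commutes (V : 'M[C]_N.+1) : V \is unitarymx -> commutes haar_moment V.
Proof.
move=> /unitary_unitarymx uV a b.
have E c : haar_moment a c =
    \sum_e \sum_f tpow V a e * haar_moment e f * tpow (conjT V) f c.
  rewrite /haar_moment (haar_left_invariance _ _ uV).
  transitivity (cexpect P (fun t => \sum_e \sum_f
      (tpow V a e * tpow (conjT V) f c) * tpow (rotated lam (W t)) e f)).
    apply: eq_cexpect => t; rewrite rotatedM tpowM exchange_big /=; apply: eq_bigr => f _.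
    by rewrite tpowM mulr_suml; apply: eq_bigr => e _; ring.
  have bm e f : cclass (@bounded_measurable R _ T) (fun t =>
      (tpow V a e * tpow (conjT V) f c) * tpow (rotated lam (W t)) e f).
    by apply: (cclassM (@bm_ring_class _ _ _)); [exact: (cclass_cst (@bm_ring_class _ _ _)) | exact: tpow_bm].
  rewrite cexpect_sum => [|e]; last exact: (cclass_sum (@bm_ring_class _ _ _)).
  apply: eq_bigr => e _; rewrite cexpect_sum //; apply: eq_bigr => f _.
  by rewrite cexpectZ; [ring | exact: tpow_bm].
transitivity (\sum_c \sum_e \sum_f tpow V a e * haar_moment e f * (tpow (conjT V) f c * tpow V c b)).
  apply: eq_bigr => c _; rewrite E mulr_suml; apply: eq_bigr => e _; rewrite mulr_suml.
  by apply: eq_bigr => f _; rewrite mulrA.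
rewrite exchange_big; apply: eq_bigr => e _ /=; rewrite exchange_big /=.
transitivity (\sum_f tpow V a e * haar_moment e f * (f == b)%:R).
  by apply: eq_bigr => f _; rewrite -mulr_sumr -tpowM unitaryK // tpow1.
rewrite (bigD1 b) //= eqxx mulr1 big1 ?addr0 // => f /negPf ->.
by rewrite mulr0.
Qed.

Lemma haar_moment_trace (s : 'S_d) : \sum_k haar_moment (fcomp k s) k = (TrPerm s lam)%:C.
Proof.
rewrite -cexpect_sum => [|k]; last exact: tpow_bm.
rewrite -[RHS](cexpect_cst P); apply: ae_cexpect.
- apply: (cclass_sum (@measurable_ring_class _ _ _)) => k; exact/bm_measurable/tpow_bm.
- exact: (cclass_cst (@measurable_ring_class _ _ _)).
by apply: filterS W_ae => t [uUt ->]; exact: tpow_trace.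
Qed.

Lemma haar_moment_weingarten (a b : I) : haar_moment a b =
  \sum_(s : 'S_d) \sum_(t : 'S_d) (Wg R N.+1 (s^-1 * t)%g)%:C *
    (fcomp a s == b)%:R * (TrPerm t lam)%:C.
Proof.
rewrite (weingarten_expansion haar_moment_commutes).
apply: eq_bigr => s _; apply: eq_bigr => t _.
by rewrite haar_moment_trace TrPermV.
Qed.

(** Linearity of the expectation is applied to the clamped matrix, whose entries are bounded
    everywhere; the two integrands agree almost surely. *)
Lemma cexpect_tpow_sum (J : finType) (a b : J -> I) :
  cexpect P (fun t => \sum_j tpow (rotated lam (U t)) (a j) (b j)) =
  \sum_j haar_moment (a j) (b j).
Proof.
rewrite -cexpect_sum => [|j]; last exact: tpow_bm.
apply: ae_cexpect.
- apply: (cclass_sum (@measurable_ring_class _ _ _)) => j.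
  apply: cclass_tpow; [exact: measurable_ring_class | exact: haar_measurable].
- by apply: (cclass_sum (@measurable_ring_class _ _ _)) => j; exact/bm_measurable/tpow_bm.
by apply: filterS W_ae => t [_ ->].
Qed.

End TensorMoments.

(** * From tensor moments to the marginals *)

Section MarginalProducts.
Variables (R : realType) (m n p q : nat).
Variables (ii kk : 'I_p -> 'I_m) (jj ll : 'I_q -> 'I_n).
Local Notation XY := ({ffun 'I_p -> 'I_n} * {ffun 'I_q -> 'I_m})%type.

(** At the first [p] positions [xy.1] supplies the summed second component; at the last [q]
    positions [xy.2] supplies the summed first component. *)
Definition multi_index (c : 'I_p -> 'I_m) (e : 'I_q -> 'I_n) (xy : XY) : {ffun 'I_(p + q) -> 'I_(m * n)} :=
  [ffun r => mxvec_index (val1 c xy.2 r) (val2 e xy.1 r)].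

Lemma ptr_product (H : 'M[R[i]]_(m * n)) :
  (\prod_(a < p) ptr1 H (ii a) (kk a)) * (\prod_(b < q) ptr2 H (jj b) (ll b)) =
  \sum_(xy : XY) tpow H (multi_index ii jj xy) (multi_index kk ll xy).
Proof.
under eq_bigr do rewrite mxE.
under [X in _ * X]eq_bigr do rewrite mxE.
rewrite !bigA_distr_bigA big_distrlr pair_big /=; apply: eq_bigr => -[x y] _ /=.
rewrite /tpow big_split_ord; congr (_ * _); apply: eq_bigr => r _.
  by rewrite !ffunE /val1 /val2 (unsplitK (inl r)).
by rewrite !ffunE /val1 /val2 (unsplitK (inr r)).
Qed.

(** The condition splits by components. First components are free on cycles among the last [q]
    positions, giving [m] to the power [kappa1]; second components are free on cycles among the
    first [p]. *)
Lemma sum_multi_index (s : 'S_(p + q)) (k1 : 'I_m) (k2 : 'I_n) :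
  (\sum_(xy : XY) [forall r, multi_index ii jj xy (s r) == multi_index kk ll xy r])%:R =
  delta_perm R (pr1 s) ii kk * delta_perm R (pr2 s) jj ll
        * n%:R ^+ kappa2 s * m%:R ^+ kappa1 s.
Proof.
rewrite /delta_perm !prodr_nat_bool.
transitivity ((\sum_(xy : XY) [forall r, val2 jj xy.1 (s r) == val2 ll xy.1 r] *
   [forall r, val1 ii xy.2 (s r) == val1 kk xy.2 r])%:R : R).
  congr (_%:R); apply: eq_bigr => xy _; rewrite mulnb; congr nat_of_bool.
  apply/forallP/andP => [h|[/forallP h2 /forallP h1] r].
    by split; apply/forallP => r; have := h r; rewrite !ffunE mxvec_index_eq => /andP[].
  by rewrite !ffunE mxvec_index_eq h1 h2.
rewrite -(pair_bigA addn (fun x y => [forall r, val2 jj x (s r) == val2 ll x r] *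
   [forall r, val1 ii y (s r) == val1 kk y r])%N) /= -big_distrlr /=.
rewrite (sum_chains1 s k1) (sum_chains2 s k2) !card_ord !natrM !natrX.
by rewrite mulrACA mulrA; congr (_ * _ * _); exact: mulrC.
Qed.

End MarginalProducts.

Theorem theorem2p3 (R : realType) (m n : nat) (hm : (2 <= m)%N) (hn : (2 <= n)%N)
    (lam : 'I_(m * n) -> R)
    (dsp : measure_display) (T : measurableType dsp) (P : probability T R)
    (U : T -> 'M[R[i]]_(m * n)) (HU : haar_unitary P U)
    (p q : nat) (ii kk : 'I_p -> 'I_m) (jj ll : 'I_q -> 'I_n) :
  cexpect P (fun t =>
      let H := U t *m diag_mx (\row_x (lam x)%:C) *m conjT (U t) in
      (\prod_(a < p) ptr1 H (ii a) (kk a)) * (\prod_(b < q) ptr2 H (jj b) (ll b)))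
  = (\sum_(s : 'S_(p + q)) \sum_(t : 'S_(p + q))
        delta_perm R (pr1 s) ii kk * delta_perm R (pr2 s) jj ll
        * n%:R ^+ kappa2 s * m%:R ^+ kappa1 s
        * Wg R (m * n) (s^-1 * t)%g * TrPerm t lam)%:C.
Proof.
case: m hm lam U HU ii kk => // m hm; case: n hn jj ll => // n hn jj ll lam U HU ii kk.
transitivity (cexpect P (fun t => \sum_xy tpow (rotated lam (U t))
    (multi_index ii jj xy) (multi_index kk ll xy))).
  by apply: eq_cexpect => t; exact: ptr_product.
(* Chosen so that [N.+1] is convertible to [m.+1 * n.+1], since the moment formula is stated in
   dimension [N.+1]. *)
pose N := (n + m * n.+1)%N.
rewrite (@cexpect_tpow_sum R N (p + q) lam dsp T P U HU).
transitivity (\sum_(xy : _ * _) \sum_(s : 'S_(p + q)) \sum_(t : 'S_(p + q))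
  (Wg R N.+1 (s^-1 * t)%g)%:C * (fcomp (multi_index ii jj xy : {ffun 'I_(p + q) -> 'I_N.+1}) s
     == multi_index kk ll xy)%:R * (TrPerm t lam)%:C).
  by apply: eq_bigr => xy _; exact: haar_moment_weingarten.
rewrite exchange_big rmorph_sum; apply: eq_bigr => s _ /=.
rewrite exchange_big rmorph_sum; apply: eq_bigr => t _ /=.
rewrite -mulr_suml -mulr_sumr -(sum_multi_index R ii kk jj ll s ord0 ord0).
rewrite [RHS]rmorphM; congr (_ * _). rewrite [RHS]rmorphM [RHS]mulrC; congr (_ * _).
rewrite rmorph_nat natr_sum; apply: eq_bigr => xy _; congr (nat_of_bool _)%:R.
apply/eqP/forallP => [/ffunP h r|h]; first by apply/eqP; rewrite -[RHS]h [RHS]ffunE.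
by apply/ffunP => r; rewrite ffunE (eqP (h r)).
Qed.
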